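(* Let $q$ be an integer with $0<q<6$ and $\gcd(3,q)=1$. There is an algorithm that, given a generalised triangulation $\mathfrak{T}$ with $n$ tetrahedra of a closed orientable 3-manifold, computes the Turaev–Viro invariant $\mathrm{TV}_{3,q}(\mathfrak{T})$ in time polynomial in $n$.
   Context: **Triangulations.** A generalised triangulation $\mathfrak{T}$ of a closed 3-manifold $M$ is a collection of $n$ abstract tetrahedra whose $4n$ triangular faces are identified (''glued'') in pairs by affine maps so that the underlying topological space is homeomorphic to $M$; several vertices, edges or faces of the same tetrahedron may become identified. The equivalence classes of tetrahedron vertices, edges, triangles under the gluings are called the vertices, edges, triangles of $\mathfrak{T}$; write $V,E,F,T$ for the sets of vertices, edges, triangles, tetrahedra. The input size is $n$. **Turaev–Viro invariants.** Let $r\ge 3$, $0<q<2r$, $\gcd(r,q)=1$, and $I=\{0,\tfrac12,1,\dots,\tfrac{r-2}{2}\}$. A colouring is a map $\theta:E\to I$. It is admissible if for each triangle of $\mathfrak{T}$ with bounding edges $e_1,e_2,e_3$: (parity) $\theta(e_1)+\theta(e_2)+\theta(e_3)\in\mathbb{Z}$; (triangle inequalities) $\theta(e_a)\le\theta(e_b)+\theta(e_c)$ for all $\{a,b,c\}=\{1,2,3\}$; (upper bound) $\theta(e_1)+\theta(e_2)+\theta(e_3)\le r-2$. Let $\zeta=e^{i\pi q/r}$, $[m]=(\zeta^m-\zeta^{-m})/(\zeta-\zeta^{-1})$ for integers $m\geq 1$, $[0]=1$, and $[m]!=[m][m-1]\cdots[0]$. For an admissible colouring $\theta$ define weights: - each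 vertex $v$: $|v|_\theta=|\zeta-\zeta^{-1}|^2/(2r)$; - an edge $e$ of colour $i$: $|e|_\theta=(-1)^{2i}[2i+1]$; - a triangle $f$ with edge colours $i,j,k$: $|f|_\theta=(-1)^{i+j+k}\dfrac{[i+j-k]!\,[i+k-j]!\,[j+k-i]!}{[i+j+k+1]!}$; - a tetrahedron $t$ with edge colours $i_0,\dots,i_5$, whose four triangles have colours $(i_0,i_1,i_3)$, $(i_0,i_2,i_4)$, $(i_1,i_2,i_5)$, $(i_3,i_4,i_5)$ (so opposite pairs of edges have colours $(i_0,i_5),(i_1,i_4),(i_2,i_3)$): $|t|_\theta=\sum_{z^-\le z\le z^+}\dfrac{(-1)^z[z+1]!}{\tau(t,z)\,\kappa(t,z)}$, the sum being over integers $z$, where $\tau(t,z)=[z-i_0-i_1-i_3]!\,[z-i_0-i_2-i_4]!\,[z-i_1-i_2-i_5]!\,[z-i_3-i_4-i_5]!$, $\kappa(t,z)=[i_0+i_1+i_4+i_5-z]!\,[i_0+i_2+i_3+i_5-z]!\,[i_1+i_2+i_3+i_4-z]!$, $z^-=\max\{i_0+i_1+i_3,\,i_0+i_2+i_4,\,i_1+i_2+i_5,\,i_3+i_4+i_5\}$, $z^+=\min\{i_0+i_1+i_4+i_5,\,i_0+i_2+i_3+i_5,\,i_1+i_2+i_3+i_4\}$. Then $|\mathfrak{T}|_\theta=\prod_{v\in V}|v|_\theta\prod_{e\in E}|e|_\theta\prod_{f\in F}|f|_\theta\prod_{t\in T}|t|_\theta$ and $\mathrm{TV}_{r,q}(\mathfrak{T})=\sum_{\theta\text{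 admissible}}|\mathfrak{T}|_\theta$. Values are represented exactly as elements of the cyclotomic field $\mathbb{Q}(\zeta)$. The invariant here is the case $r=3$. *)

(* Defs.v *)
From HB Require Import structures.
From mathcomp Require Import all_boot all_order all_algebra all_fingroup.
From mathcomp Require Import complex.
From mathcomp Require Import all_classical all_reals all_analysis.
From Stdlib Require Import Relation_Operators.

Set Implicit Arguments.
Unset Strict Implicit.
Unset Printing Implicit Defensive.

Import Order.TTheory GRing.Theory Num.Theory.
Import numFieldNormedType.Exports.

Local Open Scope ring_scope.

(* Face [f] of a tetrahedron is the one opposite to its vertex [f].  Face [f]
   of [t] is glued to face [gluing t f f] of [neighbour t f], each vertex [i]
   of the face going to vertex [gluing t f i]; the value of [gluing t f] at the
   opposite vertex [f] is the only one making it a permutation.  Every face is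
   glued to a different face, so there is no boundary. *)
Record triangulation (n : nat) := Triangulation {
  neighbour : 'I_n -> 'I_4 -> 'I_n;
  gluing : 'I_n -> 'I_4 -> 'S_4;
  neighbourK : forall t f,
    neighbour (neighbour t f) (gluing t f f) = t;
  gluingK : forall t f,
    gluing (neighbour t f) (gluing t f f) = ((gluing t f)^-1)%g;
  gluing_neq : forall t f, (neighbour t f, gluing t f f) != (t, f)
}.

(* Orient each tetrahedron by its vertex order (0,1,2,3), reversed when [o t].
   The orientations are coherent when every gluing reverses them, i.e. when the
   two orientations induced on each triangle cancel; this is the usual notion of
   orientability for a manifold given by a triangulation. *)
Definition orientable n (T : triangulation n) : Prop :=
  exists o : 'I_n -> bool, forall t f,
    odd_perm (gluing T t f) (+) o t (+) o (neighbour T t f).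

Section Space.
Local Open Scope classical_set_scope.
Variable R : realType.

Definition std_simplex : set 'rV[R]_4 :=
  [set x | (forall i, 0 <= x ord0 i) /\ \sum_i x ord0 i = 1].

Variables (n : nat) (T : triangulation n).

Definition tetrahedra : topologicalType :=
  {t : 'I_n & (std_simplex : Type)}.

(* The affine gluing maps in barycentric coordinates. *)
Definition face_glued (x y : tetrahedra) : Prop :=
  exists f : 'I_4, [/\ set_val (tagged x) ord0 f = 0,
    tag y = neighbour T (tag x) f &
    forall i, set_val (tagged y) ord0 (gluing T (tag x) f i)
              = set_val (tagged x) ord0 i].

Definition identified (x y : tetrahedra) : bool :=
  `[< clos_refl_sym_trans tetrahedra face_glued x y >].

Lemma identified_refl : reflexive identified.
Proof. by move=> x; apply/asboolP; exact: rst_refl. Qed.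

Lemma identified_sym : symmetric identified.
Proof. by move=> x y; apply/asboolP/asboolP; exact: rst_sym. Qed.

Lemma identified_trans : transitive identified.
Proof.
by move=> y x z /asboolP xy /asboolP yz; apply/asboolP; exact: rst_trans xy yz.
Qed.

Canonical identified_equiv :=
  EquivRel identified identified_refl identified_sym identified_trans.

Definition underlying_space : topologicalType :=
  quotient_topology {eq_quot identified_equiv}%qT.

End Space.

Section Manifold.
Local Open Scope classical_set_scope.
Variables (R : realType) (X : topologicalType).

Definition locally_euclidean (d : nat) : Prop :=
  forall x : X, exists (U : set X) (f : X -> 'rV[R]_d) (g : 'rV[R]_d -> X),
    [/\ open U /\ U x, open (f @` U),
        {within U, continuous f}, {within f @` U, continuous g}
      & forall y, U y -> g (f y) = y].

Definition closed_manifold (d : nat) : Prop :=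
  [/\ hausdorff_space X, @second_countable X, compact [set: X]
    & locally_euclidean d].

End Manifold.

Section Cells.
Variables (n : nat) (T : triangulation n).

(* A face of a tetrahedron, given by its set of vertices. *)
Definition simplex : finType := ('I_n * {set 'I_4})%type.

Definition glued (x y : simplex) : bool :=
  [exists f : 'I_4, (f \notin x.2) &&
     (y == (neighbour T x.1 f, gluing T x.1 f @: x.2))].

Definition cell_of (x : simplex) : {set simplex} :=
  [set y | connect glued x y].

(* [cells 1], [cells 2], [cells 3] are the vertices, edges and triangles of the
   triangulation. *)
Definition cells (k : nat) : {set {set simplex}} :=
  [set cell_of x | x : simplex & #|x.2| == k].

Definition edge : finType := {e : {set simplex} | e \in cells 2}.

End Cells.

Arguments glued {n} T x y.
Arguments cell_of {n} T x.
Arguments cells {n} T k.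
Arguments edge {n} T.

Section TuraevViro.
Variables (n : nat) (T : triangulation n) (r : nat).

(* Colours are stored doubled: c : 'I_(r - 1) stands for c / 2. *)
Definition colouring : finType := {ffun edge T -> 'I_(r.-2).+1}.

(* The doubled colour of the edge joining vertices i != j of t; the default
   value is never used. *)
Definition colour (theta : colouring) (t : 'I_n) (i j : 'I_4) : nat :=
  if insub (cell_of T (t, [set i; j])) is Some e then theta e else 0%N.

Definition on_triangle A (F : nat -> nat -> nat -> A) (theta : colouring)
    (t : 'I_n) (f : 'I_4) : A :=
  let v (k : 'I_3) := lift f k in
  let v0 := v (@Ordinal 3 0 isT) in
  let v1 := v (@Ordinal 3 1 isT) in
  let v2 := v (@Ordinal 3 2 isT) in
  F (colour theta t v0 v1) (colour theta t v0 v2) (colour theta t v1 v2).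

Definition admissible_triple (a b c : nat) : bool :=
  [&& ~~ odd (a + b + c), a <= b + c, b <= a + c, c <= a + b
    & a + b + c <= (r - 2).*2]%N.

Definition admissible (theta : colouring) : bool :=
  [forall t, forall f, on_triangle admissible_triple theta t f].

Variables (C : numFieldType) (zeta : C).

Definition qint (m : nat) : C :=
  if m == 0%N then 1 else (zeta ^+ m - zeta ^- m) / (zeta - zeta^-1).

Definition qfact (m : nat) : C := \prod_(k < m.+1) qint k.

Definition vertex_weight : C := `|zeta - zeta^-1| ^+ 2 / (2 * r)%:R.

(* In the weights below the arguments are doubled colours; on admissible
   colourings all the halvings and subtractions are exact. *)
Definition edge_weight (a : nat) : C := (-1) ^+ a * qint a.+1.

Definition triangle_weight (a b c : nat) : C :=
  (-1) ^+ (a + b + c)./2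
  * (qfact (a + b - c)./2 * qfact (a + c - b)./2 * qfact (b + c - a)./2)
  / qfact ((a + b + c)./2).+1.

Definition tetrahedron_weight (a0 a1 a2 a3 a4 a5 : nat) : C :=
  let s0 := (a0 + a1 + a3)./2 in let s1 := (a0 + a2 + a4)./2 in
  let s2 := (a1 + a2 + a5)./2 in let s3 := (a3 + a4 + a5)./2 in
  let u0 := (a0 + a1 + a4 + a5)./2 in let u1 := (a0 + a2 + a3 + a5)./2 in
  let u2 := (a1 + a2 + a3 + a4)./2 in
  let z_min := maxn (maxn s0 s1) (maxn s2 s3) in
  let z_max := minn u0 (minn u1 u2) in
  \sum_(z_min <= z < z_max.+1)
    (-1) ^+ z * qfact z.+1
    / ((qfact (z - s0) * qfact (z - s1) * qfact (z - s2) * qfact (z - s3))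
       * (qfact (u0 - z) * qfact (u1 - z) * qfact (u2 - z))).

(* The weight of a triangle is symmetric in its edges, so it does not depend on
   which face of which tetrahedron is picked to represent the class. *)
Definition class_weight (theta : colouring) (c : {set simplex n}) : C :=
  if [pick p : 'I_n * 'I_4 | (p.1, [set~ p.2]) \in c] is Some p
  then on_triangle triangle_weight theta p.1 p.2 else 1.

Definition tet_weight (theta : colouring) (t : 'I_n) : C :=
  let v0 := @Ordinal 4 0 isT in let v1 := @Ordinal 4 1 isT in
  let v2 := @Ordinal 4 2 isT in let v3 := @Ordinal 4 3 isT in
  let c := colour theta t in
  tetrahedron_weight (c v0 v1) (c v0 v2) (c v0 v3) (c v1 v2) (c v1 v3) (c v2 v3).

Definition weight (theta : colouring) : C :=
  (\prod_(v in cells T 1) vertex_weight)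
  * (\prod_(e : edge T) edge_weight (theta e))
  * (\prod_(f in cells T 3) class_weight theta f)
  * (\prod_(t : 'I_n) tet_weight theta t).

Definition state_sum : C := \sum_(theta | admissible theta) weight theta.

End TuraevViro.

Definition zeta (R : realType) (r q : nat) : R[i] :=
  Complex (cos (pi * q%:R / r%:R)) (sin (pi * q%:R / r%:R)).

Definition turaev_viro (R : realType) (r q n : nat) (T : triangulation n) :
    R[i] :=
  state_sum T r (zeta R r q).

(* Random access machine programs, with time measured by the logarithmic cost
   criterion: each operation is charged the bit length of the values and of the
   indirect addresses it uses.  There are finitely many registers per program
   and an unbounded memory; both hold natural numbers. *)
Inductive cmd : Type :=
  | Skip
  | Const (x c : nat)     (* reg x := c *)
  | Add (x y z : nat)     (* reg x := reg y + reg z *)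
  | Sub (x y z : nat)     (* reg x := reg y - reg z, truncated *)
  | Read (x y : nat)      (* reg x := mem (reg y) *)
  | Write (x y : nat)     (* mem (reg x) := reg y *)
  | Seq (c1 c2 : cmd)
  | If (x : nat) (c1 c2 : cmd)  (* test reg x != 0 *)
  | While (x : nat) (c : cmd).

Record state := State { reg : nat -> nat; mem : nat -> nat }.

Definition upd (m : nat -> nat) (x v : nat) : nat -> nat :=
  fun y => if y == x then v else m y.

Definition set_reg (s : state) (x v : nat) := State (upd (reg s) x v) (mem s).
Definition set_mem (s : state) (x v : nat) := State (reg s) (upd (mem s) x v).

Definition bitlen (v : nat) : nat := (trunc_log 2 v).+1.

Local Open Scope nat_scope.

(* [exec c s k s']: started in [s], [c] halts in [s'] after time [k]. *)
Inductive exec : cmd -> state -> nat -> state -> Prop :=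
  | ExecSkip s : exec Skip s 1 s
  | ExecConst s x c : exec (Const x c) s (bitlen c) (set_reg s x c)
  | ExecAdd s x y z :
      exec (Add x y z) s (bitlen (reg s y) + bitlen (reg s z))
        (set_reg s x (reg s y + reg s z))
  | ExecSub s x y z :
      exec (Sub x y z) s (bitlen (reg s y) + bitlen (reg s z))
        (set_reg s x (reg s y - reg s z))
  | ExecRead s x y :
      exec (Read x y) s (bitlen (reg s y) + bitlen (mem s (reg s y)))
        (set_reg s x (mem s (reg s y)))
  | ExecWrite s x y :
      exec (Write x y) s (bitlen (reg s x) + bitlen (reg s y))
        (set_mem s (reg s x) (reg s y))
  | ExecSeq c1 c2 s k1 s1 k2 s2 :
      exec c1 s k1 s1 -> exec c2 s1 k2 s2 -> exec (Seq c1 c2) s (k1 + k2) s2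
  | ExecIfTrue x c1 c2 s k s' :
      reg s x != 0 -> exec c1 s k s' ->
      exec (If x c1 c2) s (bitlen (reg s x) + k) s'
  | ExecIfFalse x c1 c2 s k s' :
      reg s x = 0 -> exec c2 s k s' ->
      exec (If x c1 c2) s (bitlen (reg s x) + k) s'
  | ExecWhileTrue x c s k1 s1 k2 s2 :
      reg s x != 0 -> exec c s k1 s1 -> exec (While x c) s1 k2 s2 ->
      exec (While x c) s (bitlen (reg s x) + k1 + k2) s2
  | ExecWhileFalse x c s :
      reg s x = 0 -> exec (While x c) s (bitlen (reg s x)) s.

(* The number of tetrahedra, then for each face of each tetrahedron the
   neighbour and the images of the vertices 0, 1, 2, 3. *)
Definition encode n (T : triangulation n) : seq nat :=
  n :: flatten [seq (neighbour T p.1 p.2 : nat)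
                    :: [seq (gluing T p.1 p.2 i : nat) | i <- enum 'I_4]
               | p <- [seq (t, f) | t <- enum 'I_n, f <- enum 'I_4]].

Definition initial_state (input : seq nat) : state :=
  State (fun _ => 0) (nth 0 input).

Definition encode_rat (x : rat) : seq nat :=
  [:: nat_of_bool (x < 0)%R; absz (numq x); absz (denq x)].

Definition outputs (s : state) (w : seq nat) : Prop :=
  forall i, i < size w -> mem s i = nth 0 w i.

(* Main.v *)
Require Import Defs.
From mathcomp Require Import all_boot all_order all_algebra all_fingroup.
From mathcomp Require Import complex.
From mathcomp Require Import all_classical all_reals all_analysis.
From mathcomp Require Import zify ring.
Set Implicit Arguments.
Unset Strict Implicit.
Unset Printing Implicit Defensive.
Import Order.TTheory GRing.Theory Num.Theory.
Local Open Scope ring_scope.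

(** For r = 3 there are two colours, and a colouring is admissible exactly when
    it is a cocycle with values in the field of two elements.  Write eps for
    (-1)^q, which is -[2], and V for the number of vertices.  The weight of a
    cocycle is 2^-V eps^N, where N counts the edges, triangles and tetrahedra on
    which the cocycle does not vanish ([weight_eps]); these are the vertices,
    edges and faces of the surface dual to the cocycle.  When q is even the
    invariant is therefore the number of cocycles divided by 2^V.

    When q is odd the sum is one of signs, and the point is that the parity of N
    is linear on cocycles.  Twice N is a sum of contributions of the edges and of
    the tetrahedra ([surface_count]), so linearity is a congruence modulo 4.  In
    one tetrahedron the defect of additivity for cocycles x and y is, modulo 4,
    twice the number of faces on which x and y are equal and nonzero, plus 2 if
    the tetrahedron is full, that is if its four vertices are separated by x and
    y ([tet_countD]).  The faces are counted from both sides.  The full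
    tetrahedra are even in number because of the orientation ([even_full]): each
    triangle on which x and y are independent carries a sign, the cyclic order
    in which its edges take the three nonzero values of (x, y); this sign changes
    with the side from which the triangle is seen, so the signs cancel in total,
    whereas they add up to 4 or -4 in a full tetrahedron and to 0 in any other.
    So the sum is zero if N is odd for some cocycle, and otherwise it is again
    the number of cocycles divided by 2^V ([state_sum_zero],
    [state_sum_trivial]).

    The algorithm labels the vertices and edges by merging classes, starts from
    the indicator functions of the classes, which span the functions constant on
    them, and imposes the cocycle conditions one after the other by elimination
    ([span_eliminate], [card_eliminate]).  This yields the number of cocycles and
    a set of cocycles spanning all of them, on which the parity of N is tested.

    The running time needs no analysis of the data.  The program is written in a
    language of loops whose bounds are at most 16 n + 4, so the number of
    operations is polynomial ([cost_poly]); and an addition lengthens values by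
    at most one bit, so m operations on values of w bits cost at most
    2 m (w + m) ([runs]). *)

(** * Subspaces of a finite vector space over the field of two elements *)
Section Span.
Variables (S : finType) (N : nat).
Local Notation V := {ffun S -> bool}.
Implicit Types (R : 'I_N -> V) (x y : V) (l : V -> bool).

Definition combination R (c : {ffun 'I_N -> bool}) : V :=
  \sum_a (if c a then R a else 0).

Definition span R : {set V} := [set combination R c | c : {ffun 'I_N -> bool}].

Lemma bits_addxx x : x + x = 0.
Proof. by apply/ffunP => s; rewrite !ffunE; case: (x s). Qed.

Lemma row_in_span R a : R a \in span R.
Proof.
apply/imsetP; exists [ffun b => b == a] => //.
rewrite /combination (bigD1 a) //= ffunE eqxx big1 ?addr0 // => b /negPf ba.
by rewrite ffunE ba.
Qed.

Lemma spanD R x y : x \in span R -> y \in span R -> x + y \in span R.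
Proof.
case/imsetP => c _ -> /imsetP [d _ ->]; apply/imsetP.
exists [ffun a => c a (+) d a] => //.
rewrite /combination -big_split; apply: eq_bigr => a _ /=; rewrite ffunE.
by case: (c a); case: (d a); rewrite /= ?bits_addxx ?addr0 ?add0r.
Qed.

Definition additive_form l := forall x y, l (x + y) = l x (+) l y.

Lemma form_combination l R c : additive_form l ->
  l (combination R c) = \big[addb/false]_a (c a && l (R a)).
Proof.
move=> lD; have l0 : l 0 = false by have := lD 0 0; rewrite addr0; case: (l 0).
rewrite /combination; elim/big_rec2: _ => [//|a x b _ <-].
by rewrite lD; case: (c a); rewrite ?l0.
Qed.

Lemma form_span l R x : additive_form l -> (forall a, ~~ l (R a)) ->
  x \in span R -> ~~ l x.
Proof.
move=> lD l0 /imsetP [c _ ->]; rewrite form_combination // big1 // => a _.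
by rewrite (negPf (l0 a)) andbF.
Qed.

(** Adding the pivot R p to every row on which l holds, itself included, is the
    projection onto the kernel of l along R p. *)
Lemma span_eliminate l R R' p : additive_form l -> l (R p) ->
    (forall a, R' a = if l (R a) then R a + R p else R a) ->
  span R' = [set x in span R | ~~ l x].
Proof.
move=> lD lp R'E.
have lR' a : ~~ l (R' a) by rewrite R'E; case: ifP => [la|->//]; rewrite lD la lp.
have combE c : combination R' c =
    combination R c + (if l (combination R c) then R p else 0).
  rewrite form_combination // /combination.
  elim/big_rec3: _ => [|a x y b _ ->]; first by rewrite addr0.
  rewrite R'E; case: (c a) => /=; rewrite ?add0r //.
  case: (l (R a)); case: b => /=; rewrite ?addr0 //.
  + by rewrite addrACA bits_addxx addr0.
  + by rewrite addrAC.
  + by rewrite addrA.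
apply/setP => x; rewrite inE; apply/idP/andP.
  move=> xR'; split; last exact: form_span lD lR' xR'.
  case/imsetP: xR' => c _ ->; rewrite combE.
  apply: spanD; first by apply/imsetP; exists c.
  case: ifP => _; first exact: row_in_span.
  by rewrite -(bits_addxx (R p)) spanD ?row_in_span.
case=> /imsetP [c _ ->] lx; apply/imsetP; exists c => //.
by rewrite combE (negPf lx) addr0.
Qed.

(** Translation by p exchanges the kernel of l and its complement.  Counting
    vectors replaces any discussion of the independence of the rows. *)
Lemma card_eliminate l (A : {set V}) p : additive_form l -> p \in A -> l p ->
    (forall x y, x \in A -> y \in A -> x + y \in A) ->
  #|A| = #|[set x in A | ~~ l x]|.*2.
Proof.
move=> lD pA lp AD; pose B := [set x in A | ~~ l x]; rewrite -/B.
pose shift (x : V) : V := x + p.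
have -> : A = B :|: shift @: B.
  apply/setP => x; rewrite !inE; apply/idP/orP; last first.
    by case=> [/andP[]//|/imsetP [y]]; rewrite inE => /andP [yA _] ->; exact: AD.
  move=> xA; case lx: (l x); last by left; rewrite xA.
  right; apply/imsetP; exists (x + p); last by rewrite /shift -addrA bits_addxx addr0.
  by rewrite inE AD // lD lx lp.
rewrite cardsU card_imset; last by move=> x y /addIr.
have -> : B :&: shift @: B = finset.set0; last by rewrite cards0 subn0 addnn.
apply/setP => x; rewrite !inE; apply/negbTE/negP => /andP [/andP [_ lx]].
case/imsetP => y; rewrite inE => /andP [_ ly] xy.
by move: lx; rewrite xy /shift lD lp (negPf ly).
Qed.

End Span.

(** * Cells and cocycles *)
Section Cells.
Variables (n : nat) (T : triangulation n).

Definition glue (x : simplex n) (f : 'I_4) : simplex n :=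
  (neighbour T x.1 f, gluing T x.1 f @: x.2).

Lemma gluedP (x y : simplex n) : reflect (exists2 f, f \notin x.2 & y = glue x f)
  (glued T x y).
Proof.
apply: (iffP existsP) => [[f /andP [fx /eqP ->]]|[f fx ->]]; exists f => //.
by rewrite fx eqxx.
Qed.

Lemma glued_sym (x y : simplex n) : glued T x y -> glued T y x.
Proof.
case/gluedP => f fx ->; apply/gluedP; exists (gluing T x.1 f f).
  by rewrite mem_imset //; apply: perm_inj.
rewrite /glue /= neighbourK gluingK [x in LHS]surjective_pairing; congr (_, _).
rewrite -imset_comp -[LHS]imset_id; apply: eq_imset => i /=.
by rewrite permK.
Qed.

Lemma connect_glued_sym : connect_sym (glued T).
Proof.
have H (x y : simplex n) : connect (glued T) x y -> connect (glued T) y x.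
  case/connectP => p; elim: p x => /= [|z p IHp] x; first by move=> _ ->.
  case/andP => xz pz yz; apply: connect_trans (IHp z pz yz) _.
  by apply: connect1; apply: glued_sym.
by move=> x y; apply/idP/idP; apply: H.
Qed.

Lemma eq_cell_of (x y : simplex n) : (cell_of T x == cell_of T y) = connect (glued T) x y.
Proof.
apply/eqP/idP => [xy|xy].
  have: y \in cell_of T y by rewrite inE.
  by rewrite -xy inE.
by apply/setP => z; rewrite !inE; apply: same_connect => //; apply: connect_glued_sym.
Qed.

Lemma mem_cell_of (x y : simplex n) : (y \in cell_of T x) = (cell_of T y == cell_of T x).
Proof. by rewrite eq_cell_of inE connect_glued_sym. Qed.

Lemma connect_card (x y : simplex n) : connect (glued T) x y -> #|x.2| = #|y.2|.
Proof.
case/connectP => p; elim: p x => /= [|z p IHp] x; first by move=> _ ->.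
case/andP => /gluedP [f fx zE] pz yz; rewrite -(IHp z pz yz) zE /glue /=.
by rewrite card_imset //; apply: perm_inj.
Qed.

Lemma cell_of_in_cells (x : simplex n) k : (cell_of T x \in cells T k) = (#|x.2| == k).
Proof.
apply/imsetP/idP => [[y]|xk]; last by exists x; rewrite ?inE.
by rewrite inE => /eqP <- /eqP; rewrite eq_cell_of => /connect_card ->.
Qed.

(** A slot is an ordered pair of vertices of a tetrahedron; it stands for an edge,
   or for a vertex when the pair is diagonal. *)
Definition slot : finType := ('I_n * 'I_4 * 'I_4)%type.

Definition slot_cell (s : slot) := cell_of T (s.1.1, [set s.1.2; s.2]).

(** The slot glued to (t, i, j) across face f, with the pair reversed; for a face
   not containing the pair only the reversal is done, so that these moves
   generate both the gluings and the reversals. *)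
Definition partner (s : slot) (f : 'I_4) : slot :=
  if (f == s.1.2) || (f == s.2) then (s.1.1, s.2, s.1.2)
  else (neighbour T s.1.1 f, gluing T s.1.1 f s.2, gluing T s.1.1 f s.1.2).

Lemma slot_cell_partner s f : slot_cell (partner s f) = slot_cell s.
Proof.
case: s => [[t i] j]; rewrite /slot_cell /partner /=.
case: ifPn => /= [_|]; first by rewrite finset.setUC.
rewrite negb_or => /andP [fi fj]; apply/eqP; rewrite eq_cell_of connect_glued_sym.
apply: connect1; apply/gluedP; exists f; first by rewrite !inE negb_or fi fj.
by rewrite /glue /= imsetU1 imset_set1 finset.setUC.
Qed.

(** A step in a path of gluings is a move up to the reversal of the pair, and the
    reversal is the move across a face that does not contain the pair. *)
Lemma slot_cell_ind (A : Type) (F : slot -> A) :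
    (forall s f, F (partner s f) = F s) ->
  forall s s', slot_cell s = slot_cell s' -> F s = F s'.
Proof.
move=> HF; have Fsym t i j : F (t, j, i) = F (t, i, j).
  by rewrite -(HF (t, i, j) i) /partner /= eqxx.
have Fset t i j i' j' : [set i; j] = [set i'; j'] -> F (t, i, j) = F (t, i', j').
  move=> E.
  have h1 : i \in [set i'; j'] by rewrite -E set21.
  have h2 : j \in [set i'; j'] by rewrite -E set22.
  have h3 : i' \in [set i; j] by rewrite E set21.
  have h4 : j' \in [set i; j] by rewrite E set22.
  move: h1 h2 h3 h4; rewrite !inE.
  by do 4![case/orP => /eqP ?]; subst; rewrite // Fsym.
move=> [[t i] j] [[t' i'] j'] /eqP; rewrite /slot_cell eq_cell_of /=.
case/connectP => p; elim: p t i j => [|z p IHp] t i j /=.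
  by move=> _ [-> /Fset].
case/andP => /gluedP [f]; rewrite !inE negb_or => /andP [fi fj] zE pz zL.
have zE' : z = (neighbour T t f, [set gluing T t f j; gluing T t f i]).
  by rewrite zE /glue /= imsetU1 imset_set1 finset.setUC.
rewrite zE' in pz zL; rewrite -(IHp _ _ _ pz zL) -(HF (t, i, j) f).
by rewrite /partner /= (negPf fi) (negPf fj).
Qed.

Local Notation bits := {ffun slot -> bool}.

Definition constant_on_cells (x : bits) : bool :=
  [forall s, forall f, x (partner s f) == x s].

Lemma constant_on_cellsP (x : bits) :
  reflect (forall s s', slot_cell s = slot_cell s' -> x s = x s')
          (constant_on_cells x).
Proof.
apply: (iffP forallP) => [H|H s]; last first.
  by apply/forallP => f; apply/eqP/H/slot_cell_partner.
by apply: slot_cell_ind => s f; move/forallP: (H s) => /(_ f)/eqP.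
Qed.

Definition cocycle_form (t : 'I_n) (i j k : 'I_4) (x : bits) : bool :=
  x (t, i, j) (+) x (t, i, k) (+) x (t, j, k).

(** The degenerate triples are included: (i, i, i) makes the diagonal slots
    vanish, so that a cocycle is determined by its values on the edges. *)
Definition cocycle (x : bits) : bool :=
  [forall t, forall i, forall j, forall k, ~~ cocycle_form t i j k x].

Definition cocycles : {set bits} :=
  [set x | constant_on_cells x && cocycle x].

Lemma cocycleP (x : bits) :
  reflect (forall t i j k, ~~ cocycle_form t i j k x) (cocycle x).
Proof.
apply: (iffP idP) => [H t i j k|H].
  by move/forallP: H => /(_ t)/forallP/(_ i)/forallP/(_ j)/forallP/(_ k).
by apply/forallP => t; apply/forallP => i; apply/forallP => j; apply/forallP => k.
Qed.

Lemma cocycle_diag (x : bits) t i : x \in cocycles -> x (t, i, i) = false.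
Proof.
rewrite inE => /andP [_ /cocycleP /(_ t i i i)]; rewrite /cocycle_form.
by case: (x _).
Qed.

Lemma cocycle_sym (x : bits) t i j : x \in cocycles -> x (t, i, j) = x (t, j, i).
Proof.
rewrite inE => /andP [/constant_on_cellsP H _]; apply: H.
by rewrite /slot_cell /= finset.setUC.
Qed.

(** On a tetrahedron a cocycle is the coboundary of this labelling of the
    vertices.  Vertices are natural numbers here so that sums over the faces
    reduce to explicit values of the labels. *)
Definition label (x : bits) (t : 'I_n) (i : nat) : bool := x (t, ord0, inord i).

Lemma cocycle_label (x : bits) t (i j : 'I_4) :
  x \in cocycles -> x (t, i, j) = label x t i (+) label x t j.
Proof.
rewrite inE => /andP [_ /cocycleP /(_ t ord0 i j)].
by rewrite /cocycle_form /label !inord_val; case: (x _) (x _) (x _) => [] [] [].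
Qed.

Lemma cocycle_label0 (x : bits) t : x \in cocycles -> label x t 0 = false.
Proof. by move/cocycle_diag => H; rewrite /label (inord_val (ord0 : 'I_4)) H. Qed.

Lemma cocyclesD (x y : bits) :
  x \in cocycles -> y \in cocycles -> (x + y : {ffun slot -> bool}) \in cocycles.
Proof.
rewrite !inE => /andP [/constant_on_cellsP cx /cocycleP zx].
case/andP=> [/constant_on_cellsP cy /cocycleP zy]; apply/andP; split.
  by apply/constant_on_cellsP => s s' ss; rewrite !ffunE (cx _ _ ss) (cy _ _ ss).
apply/cocycleP => t i j k; move: (zx t i j k) (zy t i j k); rewrite /cocycle_form !ffunE.
by do 6![case: (fun_of_fin _ _)].
Qed.

End Cells.

(** * Linearity of the parity of the dual surface *)
Section Parity.
Variables (n : nat) (T : triangulation n).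
Local Notation bits := {ffun slot n -> bool}.
Local Notation face := ('I_n * 'I_4)%type.

Definition across (p : face) : face := (neighbour T p.1 p.2, gluing T p.1 p.2 p.2).

Lemma acrossK : involutive across.
Proof.
by case=> t f; rewrite /across /= neighbourK gluingK permK.
Qed.

Lemma across_neq p : across p != p.
Proof. by case: p => t f; apply: gluing_neq. Qed.

Definition face_cell (p : face) := cell_of T (p.1, [set~ p.2]).

(** The only vertex outside a face is the opposite one, so the two glued faces
    form a whole class. *)
Lemma face_cell_eq p p' :
  (face_cell p' == face_cell p) = (p' == p) || (p' == across p).
Proof.
have glueE r : glue T (r.1, [set~ r.2]) r.2 = ((across r).1, [set~ (across r).2]).
  rewrite /glue /across /=; congr (_, _); apply/setP => i; rewrite !inE.
  rewrite -[X in X \in _](permKV (gluing T r.1 r.2)) mem_imset; last exact: perm_inj.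
  by rewrite !inE (can2_eq (permKV _) (permK _)).
have step r y : glued T (r.1, [set~ r.2]) y -> y = ((across r).1, [set~ (across r).2]).
  by case/gluedP => f; rewrite !inE negbK => /eqP -> ->; apply: glueE.
have setC1_inj (i j : 'I_4) : [set~ i] = [set~ j] -> i = j.
  by move/setP => /(_ i); rewrite !inE eqxx => /esym/negbFE/eqP.
rewrite /face_cell eq_cell_of connect_glued_sym; apply/idP/idP; last first.
  case/orP => /eqP ->; first exact: connect0.
  apply: connect1; apply/gluedP; exists p.2; first by rewrite !inE negbK.
  by rewrite glueE.
case/connectP => l; elim: l p => [|z l IHl] p /=.
  by move=> _ E; case: p p' E => [t f] [t' f'] [-> /setC1_inj ->]; rewrite eqxx.
by case/andP => /step -> /IHl H /H; rewrite acrossK orbC.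
Qed.

Lemma face_cell_cells p : face_cell p \in cells T 3.
Proof. by rewrite cell_of_in_cells cardsC1 card_ord. Qed.

Lemma cells_face_cell C : C \in cells T 3 -> exists p, C = face_cell p.
Proof.
case/imsetP => [[t A]]; rewrite inE /= => /eqP A3 ->.
have : #|~: A| == 1 by rewrite cardsCs finset.setCK A3 card_ord.
by case/cards1P => f Af; exists (t, f); rewrite /face_cell /= -Af finset.setCK.
Qed.

Definition on_class (h : face -> nat) (C : {set simplex n}) : nat :=
  if [pick p : face | (p.1, [set~ p.2]) \in C] is Some p then h p else 0%N.

(** Summing over the faces of the tetrahedra avoids choosing representatives of
    the triangles, each of which is then counted twice. *)
Lemma sum_faces (h : face -> nat) : (forall p, h (across p) = h p) ->
  (\sum_p h p = (\sum_(C in cells T 3) on_class h C).*2)%N.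
Proof.
move=> hE.
rewrite (partition_big face_cell (fun C => C \in cells T 3)) => [|p _];
  last exact: face_cell_cells.
rewrite -addnn -big_split; apply: eq_bigr => C /cells_face_cell [p ->] /=.
have -> : on_class h (face_cell p) = h p.
  rewrite /on_class; case: pickP => [p' | /(_ p)]; last first.
    by rewrite mem_cell_of eqxx.
  rewrite mem_cell_of -!/(face_cell _) face_cell_eq.
  by case/orP => /eqP ->.
rewrite (bigD1 p) //= (bigD1 (across p)) /=; last first.
  by rewrite face_cell_eq eqxx orbT across_neq.
rewrite hE big1 ?addn0 // => p'; rewrite face_cell_eq.
by case/andP => /andP [/orP []-> //] /negPf ->.
Qed.

Definition face_nonzero (x : bits) (p : face) : bool :=
  [exists i, exists j, [&& i != p.2, j != p.2 & x (p.1, i, j)]].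

Lemma face_nonzero_across x p : constant_on_cells T x ->
  face_nonzero x (across p) = face_nonzero x p.
Proof.
move=> /forallP xT.
have H q : face_nonzero x q -> face_nonzero x (across q).
  case: q => t f /existsP [i /existsP [j /and3P [/= fi fj xij]]].
  apply/existsP; exists (gluing T t f j); apply/existsP; exists (gluing T t f i).
  rewrite /across /= !(inj_eq perm_inj) fi fj /=.
  move/forallP: (xT (t, i, j)) => /(_ f); rewrite /partner /=.
  by rewrite [f == i]eq_sym [f == j]eq_sym (negPf fi) (negPf fj) => /eqP ->.
by apply/idP/idP => [/H|]; [rewrite acrossK | apply: H].
Qed.

Definition edge_bit (x : bits) (t : 'I_n) (i j : nat) : bool :=
  x (t, inord i, inord j).

Definition nonzero_edges (x : bits) (t : 'I_n) : nat :=
  (edge_bit x t 0 1 + edge_bit x t 0 2 + edge_bit x t 0 3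
   + edge_bit x t 1 2 + edge_bit x t 1 3 + edge_bit x t 2 3)%N.

Lemma edge_bit_label x t i j : x \in cocycles T -> (i < 4)%N -> (j < 4)%N ->
  edge_bit x t i j = label x t i (+) label x t j.
Proof. by move=> xZ i4 j4; rewrite /edge_bit (cocycle_label _ _ _ xZ) !inordK. Qed.

Lemma nonzero_edges_label x t : x \in cocycles T ->
  let a := label x t in
  nonzero_edges x t = (a 1 + a 2 + a 3 + (a 1 (+) a 2) + (a 1 (+) a 3)
                       + (a 2 (+) a 3))%N.
Proof.
by move=> xZ a; rewrite /nonzero_edges !edge_bit_label // (cocycle_label0 _ xZ).
Qed.

Lemma face_nonzero_label (x : bits) t (f : 'I_4) : x \in cocycles T ->
  let a k := label x t (bump f k) in
  face_nonzero x (t, f) = (a 0 (+) a 1) || (a 0 (+) a 2) || (a 1 (+) a 2).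
Proof.
move=> xZ a.
have aE (k : 'I_3) : label x t (lift f k) = a k by [].
apply/existsP/idP => [[i /existsP [j /= /and3P []]] | ].
  case: (unliftP f i) => [i' ->|->]; last by rewrite eqxx.
  case: (unliftP f j) => [j' ->|->]; last by rewrite eqxx.
  move=> _ _; rewrite (cocycle_label _ _ _ xZ) !aE.
  by case: i' j' => [[|[|[|//]]] ?] [[|[|[|//]]] ?] /=; case: (a 0); case: (a 1);
    case: (a 2).
have H (i j : 'I_3) : a i (+) a j -> exists i,
  [exists j, [&& i != f, j != f & x (t, i, j)]].
  move=> aij; exists (lift f i); apply/existsP; exists (lift f j).
  by rewrite ![lift _ _ == _]eq_sym !neq_lift (cocycle_label _ _ _ xZ) !aE.
case/orP => [/orP []|].
- exact: (H (@Ordinal 3 0 isT) (@Ordinal 3 1 isT)).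
- exact: (H (@Ordinal 3 0 isT) (@Ordinal 3 2 isT)).
- exact: (H (@Ordinal 3 1 isT) (@Ordinal 3 2 isT)).
Qed.

(** A nonzero cocycle splits the four vertices into 1 + 3 or 2 + 2; it is then
    nonzero on 3 edges and 3 faces, or on 4 edges and 4 faces. *)
Lemma sum_face_nonzero x t : x \in cocycles T ->
  (\sum_f face_nonzero x (t, f) = nonzero_edges x t)%N.
Proof.
move=> xZ; rewrite (nonzero_edges_label _ xZ).
under eq_bigr do rewrite (face_nonzero_label _ _ xZ).
rewrite !big_ord_recl big_ord0 /bump /= (cocycle_label0 _ xZ).
by case: (label x t 1); case: (label x t 2); case: (label x t 3).
Qed.

(** Twice the number of triangles and tetrahedra on which x does not vanish,
    localized at t: each nonzero face counts once here and once in the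
    neighbouring tetrahedron. *)
Definition tet_count (x : bits) (t : 'I_n) : nat :=
  (nonzero_edges x t + (nonzero_edges x t != 0).*2)%N.

(** The four vertices of t are separated by x and y together. *)
Definition full (x y : bits) (t : 'I_n) : bool :=
  let e i j := edge_bit x t i j || edge_bit y t i j in
  [&& e 0 1, e 0 2, e 0 3, e 1 2, e 1 3 & e 2 3]%N.

(** On the face p, x and y are equal and not zero. *)
Definition common_face (x y : bits) (p : face) : bool :=
  face_nonzero x p && ~~ face_nonzero (x + y : {ffun slot n -> bool}) p.

Lemma labelD x y t i :
  label (x + y : {ffun slot n -> bool}) t i = label x t i (+) label y t i.
Proof. by rewrite /label ffunE. Qed.

Lemma tet_countD x y t : x \in cocycles T -> y \in cocycles T ->
  (tet_count x t + tet_count y t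
   = tet_count (x + y)%R t
     + (\sum_f common_face x y (t, f)).*2 + (full x y t).*2 %[mod 4])%N.
Proof.
move=> xZ yZ; have xyZ := cocyclesD xZ yZ.
rewrite /tet_count !nonzero_edges_label // /full !edge_bit_label //.
rewrite /common_face.
under eq_bigr do rewrite !face_nonzero_label //.
rewrite !big_ord_recl big_ord0 /bump /= !labelD.
rewrite (cocycle_label0 _ xZ) (cocycle_label0 _ yZ).
case: (label x t 1); case: (label x t 2); case: (label x t 3);
  by case: (label y t 1); case: (label y t 2); case: (label y t 3).
Qed.

(** On a triangle where x and y are independent, (x, y) takes each of the three
    nonzero values on one edge, and the swirl is 1 or -1 according to their
    cyclic order; it is 0 on the other triangles. *)
Definition swirl (x y : bits) (t : 'I_n) (i j k : 'I_4) : int :=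
  let c (p q : slot n) : int := (x p)%:R * (y q)%:R - (x q)%:R * (y p)%:R in
  c (t, i, j) (t, j, k) + c (t, j, k) (t, k, i) + c (t, k, i) (t, i, j).

(** The sign gives the face the orientation of the boundary of t. *)
Definition face_swirl (x y : bits) (p : face) : int :=
  (-1) ^+ p.2 * swirl x y p.1 (lift p.2 (@Ordinal 3 0 isT))
    (lift p.2 (@Ordinal 3 1 isT)) (lift p.2 (@Ordinal 3 2 isT)).

(** All four faces of a full tetrahedron turn in the same direction; the form
    4 - 8 k covers both signs. *)
Lemma sum_face_swirl x y t (b : bool) : x \in cocycles T -> y \in cocycles T ->
  exists k : nat,
    (-1) ^+ b * \sum_f face_swirl x y (t, f) = 4 * (full x y t)%:R - 8 * k%:R.
Proof.
move=> xZ yZ; rewrite /face_swirl /swirl /full !edge_bit_label //.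
under eq_bigr do rewrite !(cocycle_label _ _ _ xZ) !(cocycle_label _ _ _ yZ).
rewrite !big_ord_recl big_ord0 /bump /=.
rewrite (cocycle_label0 _ xZ) (cocycle_label0 _ yZ).
case: (label x t 1); case: (label x t 2); case: (label x t 3);
  case: (label y t 1); case: (label y t 2); case: (label y t 3); case: b;
  first [by exists 0%N | by exists 1%N].
Qed.

Lemma alternating_perm3 (F : 'I_3 -> 'I_3 -> 'I_3 -> int) (s : 'S_3) :
    (forall i j k, F j i k = - F i j k) -> (forall i j k, F i k j = - F i j k) ->
  forall i j k, uniq [:: i; j; k] -> F (s i) (s j) (s k) = (-1) ^+ odd_perm s * F i j k.
Proof.
move=> F12 F23; have F13 i j k : F k j i = - F i j k.
  by rewrite F12 F23 F12 opprK.
have [ts -> _] := prod_tpermP s.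
elim: ts => [|[a b] ts IHts] i j k ijk; first by rewrite big_nil !perm1 odd_perm1 mul1r.
rewrite big_cons !permM odd_permM odd_tperm /=.
rewrite IHts; last by rewrite -[X in uniq X]/(map (tperm a b) [:: i; j; k])
  map_inj_uniq //; apply: perm_inj.
rewrite signr_addb [_ * (-1) ^+ _]mulrC -mulrA; congr (_ * _).
move: ijk; case: (eqVneq a b) => [->|ab]; first by rewrite tperm1 !perm1 mul1r.
rewrite expr1 mulN1r => ijk.
have in3 c : c \in [:: i; j; k].
  have := @uniq_min_size _ [:: i; j; k] (enum 'I_3) ijk.
  by rewrite size_enum_ord => /(_ (fun x _ => mem_enum _ x) isT) [_ ->]; rewrite mem_enum.
move: ijk; rewrite /= !inE => /and3P [/norP [ij ik] jk _].
have [ji [ki kj]] : j != i /\ k != i /\ k != j by rewrite ![_ == i]eq_sym [k == j]eq_sym.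
move: (in3 a) (in3 b) ab; rewrite !inE.
by case/or3P => /eqP ->; case/or3P => /eqP -> ab; rewrite ?eqxx // in ab *;
  rewrite ?tpermL ?tpermR ?tpermD //; first [exact: F12 | exact: F23 | exact: F13].
Qed.

Lemma swirl_alternating x y t (F := swirl x y t) : x \in cocycles T -> y \in cocycles T ->
  (forall i j k, F j i k = - F i j k) /\ (forall i j k, F i k j = - F i j k).
Proof.
move=> xZ yZ; rewrite /F /swirl; split=> i j k;
  rewrite !(cocycle_sym t j i xZ, cocycle_sym t k j xZ, cocycle_sym t i k xZ);
  rewrite !(cocycle_sym t j i yZ, cocycle_sym t k j yZ, cocycle_sym t i k yZ);
  by ring.
Qed.

Lemma cancel_signs (A : int) (a b c : bool) (k m : nat) :
    odd m (+) odd k (+) c (+) a (+) b ->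
  (-1) ^+ b * ((-1) ^+ m * A) = - ((-1) ^+ a * ((-1) ^+ k * ((-1) ^+ c * A))).
Proof.
rewrite -(signr_odd _ k) -(signr_odd _ m).
by case: (odd m) (odd k) a b c => [] [] [] [] [] //= _;
  rewrite ?(expr0, expr1, mul1r, mulN1r, opprK).
Qed.

Hypothesis oriented : orientable T.

(** The swirls of the two sides of each triangle cancel, so the sums over the
    faces of the full tetrahedra, which are 4 or -4, add up to 0. *)
Lemma even_full x y : x \in cocycles T -> y \in cocycles T ->
  ~~ odd (\sum_t full x y t)%N.
Proof.
move=> xZ yZ; case: oriented => o oT.
pose w (p : face) : int := (-1) ^+ o p.1 * face_swirl x y p.
have glueE t f i j : i != f -> j != f -> forall z, z \in cocycles T ->
    z (t, i, j) = z (neighbour T t f, gluing T t f i, gluing T t f j).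
  move=> fi fj z zZ; rewrite [RHS](cocycle_sym _ _ _ zZ).
  move: zZ; rewrite inE => /andP [/forallP /(_ (t, i, j)) /forallP /(_ f) /eqP <- _].
  by rewrite /partner /= eq_sym (negPf fi) eq_sym (negPf fj).
have wN p : w (across p) = - w p.
  case: p => t f; rewrite /w /face_swirl /=.
  set g := gluing T t f; set t' := neighbour T t f.
  (* The map induced by the gluing between the vertices of the two faces. *)
  have [s gE] : exists s : 'S_3, forall i, g (lift f i) = lift (g f) (s i).
    have ex i : {j : 'I_3 | g (lift f i) = lift (g f) j}.
      case: (unliftP (g f) (g (lift f i))) => [j E | /perm_inj E]; first by exists j.
      by have := neq_lift f i; rewrite E eqxx.
    have inj : injective (fun i => sval (ex i)).
      move=> i j /= E; apply: (@lift_inj _ f); apply: (@perm_inj _ g).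
      by apply: etrans (svalP (ex i)) _; rewrite E; apply: esym (svalP (ex j)).
    by exists (perm inj) => i; rewrite permE; apply: svalP (ex i).
  have gL : g = lift_perm f (g f) s.
    apply/permP => i; case: (unliftP f i) => [j ->|->]; last by rewrite lift_perm_id.
    by rewrite lift_perm_lift gE.
  have [F12 F23] := swirl_alternating t' xZ yZ.
  have swE i j k : swirl x y t (lift f i) (lift f j) (lift f k) =
      swirl x y t' (lift (g f) (s i)) (lift (g f) (s j)) (lift (g f) (s k)).
    by rewrite /swirl !(glueE t f (lift f _) (lift f _)) 1?eq_sym ?neq_lift // !gE.
  rewrite [in RHS]swE.
  pose F (i j k : 'I_3) := swirl x y t' (lift (g f) i) (lift (g f) j) (lift (g f) k).
  have FE : forall i j k, uniq [:: i; j; k] -> F (s i) (s j) (s k) = (-1) ^+ s * F i j k.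
    by apply: alternating_perm3 => *; [exact: F12 | exact: F23].
  rewrite /F in FE; rewrite FE //.
  apply: cancel_signs; move: (oT t f); rewrite -/g -/t' {1}gL odd_lift_perm.
  by rewrite (addbC (odd f)).
have w0 : \sum_p w p = 0.
  have : \sum_p w p = - \sum_p w p.
    rewrite {1}(reindex_inj (inv_inj acrossK)) /= -sumrN.
    by apply: eq_bigr => p _; apply: wN.
  by lia.
have wE : \sum_p w p = \sum_t ((-1) ^+ o t * \sum_f face_swirl x y (t, f)).
  rewrite (eq_bigr (fun p => w (p.1, p.2))); last by case.
  by rewrite -(pair_bigA _ (fun t f => w (t, f))) /=; apply: eq_bigr => t _;
    rewrite big_distrr.
have kE t : {k : nat | (-1) ^+ o t * \sum_f face_swirl x y (t, f)
                      = 4 * (full x y t)%:R - 8 * k%:R}.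
  exact/cid/sum_face_swirl.
move: wE; rewrite w0 (eq_bigr _ (fun t _ => svalP (kE t))) sumrB -!big_distrr /= -!natr_sum.
move: (\sum_t _)%N (\sum_t _)%N => b a ab.
have -> : a = b.*2 by lia.
by rewrite odd_double.
Qed.

(** Twice the number of edges, triangles and tetrahedra on which x does not
    vanish, when E contains one slot for each edge.  Unlike the number itself, it
    needs no choice of a representative for each triangle. *)
Definition surface_count (E : {pred slot n}) (x : bits) : nat :=
  ((\sum_(s in E) x s).*2 + \sum_t tet_count x t)%N.

(** Half of [surface_count] is thus linear modulo 2. *)
Lemma surface_countD E x y : x \in cocycles T -> y \in cocycles T ->
  (surface_count E x + surface_count E y = surface_count E (x + y)%R %[mod 4])%N.
Proof.
move=> xZ yZ; rewrite /surface_count.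
set X := (\sum_(s in E) x s)%N; set Y := (\sum_(s in E) y s)%N.
set W := (\sum_(s in E) (x + y)%R s)%N.
have Esum : (X + Y = W + (\sum_(s in E) (x s && y s)).*2)%N.
  rewrite -mul2n big_distrr -!big_split; apply: eq_bigr => s _ /=; rewrite ffunE.
  by case: (x s) (y s) => [] [].
have tsum (r : seq 'I_n) : (\sum_(t <- r) tet_count x t + \sum_(t <- r) tet_count y t
   = \sum_(t <- r) tet_count (x + y)%R t
     + (\sum_(t <- r) \sum_f common_face x y (t, f)).*2
     + (\sum_(t <- r) full x y t).*2 %[mod 4])%N.
  elim: r => [|t r IHr]; first by rewrite !big_nil.
  by rewrite !big_cons; move: (tet_countD t xZ yZ) IHr; lia.
have fE : ~~ odd (\sum_t \sum_f common_face x y (t, f))%N.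
  rewrite pair_bigA /= (eq_bigr (fun p => common_face x y p : nat)); last by case.
  rewrite sum_faces ?odd_double // => p.
  move: xZ yZ (cocyclesD xZ yZ); rewrite !inE => /andP [cx _] /andP [cy _] /andP [cxy _].
  by rewrite /common_face !face_nonzero_across.
move: (even_full xZ yZ) (tsum (index_enum 'I_n)) Esum fE.
move: X Y W (\sum_(s in E) _)%N (\sum_t full _ _ _)%N (\sum_t \sum_f _)%N => X Y W a b c.
move: (\sum_t _)%N (\sum_t _)%N (\sum_t _)%N => d e k.
by lia.
Qed.

Lemma surface_count_half E x : x \in cocycles T ->
  surface_count E x = (\sum_(s in E) x s
    + \sum_(C in cells T 3) on_class (fun p => face_nonzero x p) C
    + \sum_t (nonzero_edges x t != 0))%N.*2.
Proof.
move=> xZ; rewrite !doubleD /surface_count -addnA; congr (_ + _)%N.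
rewrite -sum_faces; last first.
  by move: xZ; rewrite inE => /andP [cx _] p; rewrite face_nonzero_across.
rewrite (eq_bigr (fun p => face_nonzero x (p.1, p.2) : nat)); last by case.
rewrite -(pair_bigA _ (fun t f => face_nonzero x (t, f) : nat)) /=.
rewrite -mul2n big_distrr -big_split; apply: eq_bigr => t _ /=.
by rewrite sum_face_nonzero // /tet_count mul2n.
Qed.

End Parity.

(** * The state sum over cocycles *)
Section Weights.
Variables (n : nat) (T : triangulation n).
Variables (C : numFieldType) (z eps : C).
(* The quantum integer [2] is z + z^-1, so eps = - [2]. *)
Hypothesis z_neq0 : z != 0.
Hypothesis eps2 : eps * eps = 1.
Hypothesis z_trace : z + z^-1 = - eps.
Local Notation bits := {ffun slot n -> bool}.

Lemma eps_neq0 : eps != 0.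
Proof. by apply: contra_eqN eps2 => /eqP ->; rewrite mul0r eq_sym oner_eq0. Qed.

Lemma z_gap2 : (z - z^-1) ^+ 2 = - 3%:R.
Proof.
have -> : (z - z^-1) ^+ 2 = (z + z^-1) ^+ 2 - 4%:R * (z * z^-1) by ring.
by rewrite z_trace mulfV // sqrrN expr2 eps2; ring.
Qed.

Lemma z_gap_neq0 : z - z^-1 != 0.
Proof.
apply: contra_eqN z_gap2 => /eqP ->; rewrite expr0n /= eq_sym oppr_eq0.
by rewrite pnatr_eq0.
Qed.

Lemma qint1 : qint z 1 = 1.
Proof. by rewrite /qint /= !expr1 divff ?z_gap_neq0. Qed.

Lemma qint2 : qint z 2 = - eps.
Proof.
rewrite /qint /= -z_trace -exprVn.
have -> : z ^+ 2 - z^-1 ^+ 2 = (z + z^-1) * (z - z^-1) by ring.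
by rewrite mulfK ?z_gap_neq0.
Qed.

Lemma qfact0 : qfact z 0 = 1.
Proof. by rewrite /qfact big_ord1. Qed.

Lemma qfact1 : qfact z 1 = 1.
Proof. by rewrite /qfact !big_ord_recr big_ord0 /= qint1 /qint /= !mulr1. Qed.

Lemma qfact2 : qfact z 2 = - eps.
Proof. by rewrite /qfact !big_ord_recr big_ord0 /= qint2 qint1 /qint /= !mul1r. Qed.

Definition qfactE := (qfact0, qfact1, qfact2).

Lemma vertex_weight3 : vertex_weight 3 z = 2%:R^-1.
Proof.
rewrite /vertex_weight -normrX z_gap2 normrN normr_nat.
have -> : (2 * 3)%:R = 2%:R * 3%:R :> C by rewrite natrM.
by rewrite invfM mulrC mulfVK // pnatr_eq0.
Qed.

Lemma edge_weight_bit (b : bool) : edge_weight z b = eps ^+ b.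
Proof. by case: b; rewrite /edge_weight ?qint1 ?qint2 ?expr1 ?mulrNN mul1r. Qed.

Lemma triangle_weight_bits (a b c : bool) : ~~ (a (+) b (+) c) ->
  triangle_weight z a b c = eps ^+ [|| a, b | c].
Proof.
have epsV : (-1) ^+ 1 * (1 * 1 * 1) / - eps = eps :> C.
  by rewrite expr1 !mulr1 invrN mulrNN mul1r; apply: (mulIf eps_neq0);
    rewrite mulVf ?eps_neq0.
by case: a; case: b; case: c => //= _; rewrite /triangle_weight /= !qfactE ?epsV //
  ?expr0 ?mulr1 ?divr1.
Qed.

Lemma tetrahedron_weight_labels (a b c : bool) :
  tetrahedron_weight z a b c (a (+) b) (a (+) c) (b (+) c) = eps ^+ [|| a, b | c].
Proof.
by case: a; case: b; case: c; rewrite /tetrahedron_weight /= /maxn /minn /=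
  big_nat1 ?subnn ?subn0 /= ?subnn !qfactE ?expr0 ?expr1 !mulr1 ?mulrNN ?mul1r ?invr1
    ?mulr1.
Qed.

Definition bits_of (theta : colouring T 3) : bits :=
  [ffun s => odd (colour theta s.1.1 s.1.2 s.2)].

Definition colouring_of (x : bits) : colouring T 3 :=
  [ffun e : edge T =>
     inord (if [pick s | slot_cell T s == val e] is Some s then x s else false)].

Lemma colour_edge (theta : colouring T 3) (e : edge T) s :
  slot_cell T s = val e -> colour theta s.1.1 s.1.2 s.2 = theta e.
Proof. by rewrite /colour /slot_cell => ->; rewrite valK. Qed.

Lemma edge_slot (e : edge T) : exists2 s, slot_cell T s = val e & s.1.2 != s.2.
Proof.
case: e => e /= /imsetP [[t A]]; rewrite inE /= => /cards2P [i [j [ij Aij]]] ->.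
by exists (t, i, j); rewrite ?Aij.
Qed.

Lemma slot_edge (s : slot n) : s.1.2 != s.2 -> exists e : edge T, slot_cell T s = val e.
Proof.
move=> ij; have eP : slot_cell T s \in cells T 2 by rewrite cell_of_in_cells cards2 ij.
by exists (exist (fun c => c \in cells T 2) _ eP).
Qed.

Lemma colour_diag (theta : colouring T 3) t i : colour theta t i i = 0%N.
Proof.
by rewrite /colour insubN // cell_of_in_cells /= finset.setUid cards1.
Qed.

Lemma colour_bits (theta : colouring T 3) t i j :
  colour theta t i j = bits_of theta (t, i, j).
Proof.
rewrite ffunE /=; case: (eqVneq i j) => [->|ij]; first by rewrite colour_diag.
have [e E] := @slot_edge (t, i, j) ij.
by rewrite (@colour_edge _ _ (t, i, j) E); case: (theta e) => [[|[|]]].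
Qed.

Lemma bits_ofK : cancel bits_of colouring_of.
Proof.
move=> theta; apply/ffunP => e; rewrite ffunE; case: pickP => [s /eqP E|].
  rewrite ffunE (colour_edge theta E); apply: val_inj; rewrite /= inordK.
    by case: (theta e) => [[|[|]]].
  by case: odd.
by case: (edge_slot e) => s E _ /(_ s); rewrite E eqxx.
Qed.

Lemma colouring_ofK (x : bits) : x \in cocycles T -> bits_of (colouring_of x) = x.
Proof.
move=> xZ; apply/ffunP => -[[t i] j]; rewrite ffunE /=.
case: (eqVneq i j) => [<-|ij]; first by rewrite colour_diag (cocycle_diag _ _ xZ).
have [e E] := @slot_edge (t, i, j) ij.
rewrite (@colour_edge _ _ (t, i, j) E) ffunE inordK; last by case: pickP => // s _;
  case: (x s).
case: pickP => [s /eqP E'|/(_ (t, i, j))]; last by rewrite E eqxx.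
move: xZ; rewrite inE => /andP [/constant_on_cellsP xT _].
by rewrite (xT s (t, i, j)) ?E //; case: (x _).
Qed.

Lemma admissible_cocycle theta : admissible theta = (bits_of theta \in cocycles T).
Proof.
set x := bits_of theta; apply/idP/idP => [adm | xZ].
- have xT : constant_on_cells T x.
    apply/constant_on_cellsP => s s' ss; rewrite !ffunE /colour.
    by rewrite -!/(slot_cell T (_, _, _)) /slot_cell /= in ss *; rewrite ss.
  rewrite inE xT; apply/cocycleP => t i j k.
  have xsym i' j' : x (t, i', j') = x (t, j', i').
    by move/constant_on_cellsP: xT; apply; rewrite /slot_cell /= finset.setUC.
  have xdiag i' : x (t, i', i') = false by rewrite ffunE colour_diag.
  pose c (i j : nat) := x (t, inord i, inord j).
  have cE (i' j' : 'I_4) : x (t, i', j') = c i' j' by rewrite /c !inord_val.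
  have csym i' j' : c i' j' = c j' i' by rewrite /c xsym.
  have cdiag i' : c i' i' = false by rewrite /c xdiag.
  have tri (f : 'I_4) : ~~ (c (bump f 0) (bump f 1) (+) c (bump f 0) (bump f 2) (+) c
    (bump f 1) (bump f 2)).
    move/forallP: adm => /(_ t)/forallP/(_ f).
    rewrite /on_triangle /admissible_triple !colour_bits !oddD -/x !cE.
    by case/and5P; do 3![case: (c _ _)].
  move: (tri (@Ordinal 4 0 isT)) (tri (@Ordinal 4 1 isT)) (tri (@Ordinal 4 2 isT))
    (tri (@Ordinal 4 3 isT)).
  rewrite /bump /= /cocycle_form !cE.
  have c10 := csym 1 0; have c20 := csym 2 0; have c30 := csym 3 0.
  have c21 := csym 2 1; have c31 := csym 3 1; have c32 := csym 3 2.
  case: i j k => [[|[|[|[|//]]]] ?] [[|[|[|[|//]]]] ?] [[|[|[|[|//]]]] ?] /=;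
    rewrite ?c10 ?c20 ?c30 ?c21 ?c31 ?c32 ?cdiag;
    by case: (c 0 1) (c 0 2) (c 0 3) (c 1 2) (c 1 3) (c 2 3) => [] [] [] [] [] [].
- apply/forallP => t; apply/forallP => f; rewrite /on_triangle !colour_bits -/x.
  rewrite !(cocycle_label _ _ _ xZ) /admissible_triple.
  by do 3![case: (label _ _ _)].
Qed.

Section Cocycle.
Variables (theta : colouring T 3) (x : bits).
Hypothesis xE : bits_of theta = x.
Hypothesis xZ : x \in cocycles T.

Lemma class_weight_eps c :
  class_weight z theta c = eps ^+ on_class (fun p => face_nonzero x p) c.
Proof.
rewrite /class_weight /on_class; case: pickP => //= -[t f] _.
rewrite /on_triangle !colour_bits xE !(cocycle_label _ _ _ xZ) triangle_weight_bits.
  by rewrite (face_nonzero_label _ _ xZ) orbA.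
by do 3![case: (label _ _ _)].
Qed.

Lemma tet_weight_eps t : tet_weight z theta t = eps ^+ (nonzero_edges x t != 0)%N.
Proof.
rewrite /tet_weight !colour_bits xE !(cocycle_label _ _ _ xZ) /= (cocycle_label0 _ xZ).
rewrite !addFb tetrahedron_weight_labels (nonzero_edges_label _ xZ).
by do 3![case: (label _ _ _)].
Qed.

End Cocycle.

(* E selects one slot in each vertex and in each edge; a diagonal slot stands for
   a vertex. *)
Variable E : {pred slot n}.
Hypothesis E_inj : forall s s', s \in E -> s' \in E -> slot_cell T s
  = slot_cell T s' -> s = s'.
Hypothesis E_onto : forall s, exists2 s', s' \in E & slot_cell T s' = slot_cell T s.

Lemma card_vertices : #|cells T 1| = #|[set s in E | s.1.2 == s.2]|.
Proof.
have -> : cells T 1 = slot_cell T @: [set s in E | s.1.2 == s.2].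
  apply/setP => c; apply/idP/imsetP => [|[s]]; last first.
    rewrite inE => /andP [_ /eqP ss ->]; rewrite cell_of_in_cells /= ss finset.setUid.
    by rewrite cards1.
  case/imsetP => [[t A]]; rewrite inE /= => /cards1P [i ->] ->.
  have [s sE ss] := E_onto (t, i, i); exists s.
    rewrite inE sE /= ; apply: contraT => ij.
    move/eqP: ss; rewrite eq_cell_of => /connect_card /=.
    by rewrite cards2 ij finset.setUid cards1.
  by rewrite ss /slot_cell /= finset.setUid.
rewrite card_in_imset // => s s'; rewrite !inE => /andP [sE _] /andP [sE' _].
exact: E_inj.
Qed.

Lemma sum_edges theta : let x := bits_of theta in
  (\sum_(e : edge T) theta e = \sum_(s in E) x s)%N.
Proof.
move=> x.
have xE s (e : edge T) : slot_cell T s = val e -> x s = theta e :> nat.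
  by case: s => [[t i] j] se; rewrite -colour_bits (@colour_edge _ _ (t, i, j) se).
transitivity (\sum_(e : edge T) \sum_(s in E | slot_cell T s == val e) x s)%N.
  apply: eq_bigr => e _; have [s0 s0e _] := edge_slot e; have [s sE ss] := E_onto s0.
  rewrite (bigD1 s) /=; last by rewrite sE ss s0e eqxx.
  rewrite (xE s e) ?ss // big1 ?addn0 // => s' /andP [/andP [s'E /eqP s'e] /eqP []].
  by apply: E_inj => //; rewrite s'e ss.
rewrite (exchange_big_dep (fun s => s \in E)) /=; last by move=> e s _ /andP [].
apply: eq_bigr => s sE; case: (eqVneq s.1.2 s.2) => [sd|sd].
  have -> : x s = false by case: s sd {sE} => [[t i] j] /= ->; rewrite ffunE colour_diag.
  by rewrite big1.
have [e se] := slot_edge sd.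
rewrite (big_pred1 e) // => e' /=; rewrite sE se /= eq_sym.
by apply/eqP/eqP => [/val_inj|->].
Qed.

Definition dual_cells (x : bits) : nat :=
  (\sum_(s in E) x s + \sum_(c in cells T 3) on_class (fun p => face_nonzero x p) c
   + \sum_t (nonzero_edges x t != 0))%N.

Lemma weight_eps theta : bits_of theta \in cocycles T ->
  weight z theta = 2%:R^-1 ^+ #|cells T 1| * eps ^+ dual_cells (bits_of theta).
Proof.
move=> xZ; rewrite /weight.
under eq_bigr do rewrite vertex_weight3.
rewrite prodr_const -!mulrA; congr (_ * _); rewrite mulrA.
have -> : \prod_(e : edge T) edge_weight z (theta e) = eps ^+ (\sum_(e : edge T) theta e)%N.
  rewrite expr_sum; apply: eq_bigr => e _.
  by case: (theta e) => [[|[|//]] i]; [exact: (edge_weight_bit false) | exact: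
    (edge_weight_bit true)].
rewrite sum_edges /dual_cells !exprD !expr_sum; congr (_ * _ * _).
  by apply: eq_bigr => c _; apply: class_weight_eps.
by apply: eq_bigr => t _; apply: tet_weight_eps.
Qed.

Lemma state_sum_cocycles :
  state_sum T 3 z = 2%:R^-1 ^+ #|cells T 1| * \sum_(x in cocycles T) eps ^+ dual_cells x.
Proof.
rewrite /state_sum (reindex_onto colouring_of bits_of) => [|theta _]; last exact: bits_ofK.
rewrite big_distrr; apply: eq_big => [x | x].
  apply/andP/idP => [[]|xZ]; first by rewrite admissible_cocycle => xZ /eqP <-.
  by rewrite admissible_cocycle colouring_ofK.
by case/andP; rewrite admissible_cocycle => xZ /eqP xE; rewrite weight_eps // xE.
Qed.

Lemma dual_cells_half x : x \in cocycles T -> surface_count E x = (dual_cells x).*2.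
Proof. exact: surface_count_half. Qed.

Lemma state_sum_trivial : eps = 1 \/ (forall x,
  x \in cocycles T -> 4 %| surface_count E x)%N ->
  state_sum T 3 z = 2%:R^-1 ^+ #|cells T 1| * #|cocycles T|%:R.
Proof.
move=> H; rewrite state_sum_cocycles; congr (_ * _); rewrite -sum1_card natr_sum.
apply: eq_bigr => x xZ; case: H => [->|/(_ _ xZ)]; first by rewrite expr1n.
rewrite dual_cells_half // => x4; have /dvdnP [k ->] : (2 %| dual_cells x)%N by lia.
by rewrite mulnC exprM expr2 eps2 expr1n.
Qed.

(** Translation by x reverses all the signs. *)
Lemma state_sum_zero x : orientable T -> eps = -1 -> x \in cocycles T ->
  ~~ (4 %| surface_count E x)%N -> state_sum T 3 z = 0.
Proof.
move=> oT eps1 xZ x4; rewrite state_sum_cocycles.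
suff -> : \sum_(y in cocycles T) eps ^+ dual_cells y = 0 by rewrite mulr0.
set s := \sum_(y in _) _.
suff sN : s = - s.
  have : s *+ 2 == 0 by rewrite mulr2n {1}sN addNr.
  by rewrite mulrn_eq0 => /eqP.
pose shift (y : bits) : bits := x + y.
have shiftK : involutive shift by move=> y; rewrite /shift addrA bits_addxx add0r.
rewrite {1}/s (reindex_inj (inv_inj shiftK)) /= /s -sumrN; apply: eq_big => y.
  apply/idP/idP => H; last exact: cocyclesD.
  by rewrite -(shiftK y); apply: cocyclesD.
move=> xyZ; have yZ : y \in cocycles T by rewrite -(shiftK y); apply: cocyclesD.
rewrite eps1 -signr_odd -[in RHS]signr_odd.
have -> : odd (dual_cells (shift y)) = ~~ odd (dual_cells y).
  have := surface_countD oT E xZ yZ; rewrite -/(shift y); move: x4.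
  rewrite !dual_cells_half //.
  by move: (dual_cells (shift y)) (dual_cells x) (dual_cells y); lia.
by case: odd; rewrite /= ?expr0 ?expr1 ?opprK.
Qed.

End Weights.

(** * The root of unity *)
Section Root.
Variables (R : realType) (q : nat).
Hypotheses (q_gt0 : (0 < q)%N) (q_lt6 : (q < 6)%N) (q_coprime : coprime 3 q).

Let angle : R := pi * q%:R / 3%:R.

Lemma cos_pi_nat (m : nat) : cos (pi * m%:R : R) = (-1) ^+ m.
Proof.
elim: m => [|m IHm]; first by rewrite mulr0 cos0 expr0.
by rewrite -natr1 mulrDr mulr1 cosDpi IHm exprS mulN1r.
Qed.

Lemma sin_angle_neq0 : sin angle != 0.
Proof.
have pi0 : 0 < pi :> R := pi_gt0 R.
have [q3 | q3] : (q < 3)%N \/ (3 < q)%N.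
  by case: q q_coprime => [|[|[|[|]]]] //=; auto.
  have : 0 < sin angle.
    apply: sin_gt0_pi; rewrite /angle divr_gt0 ?mulr_gt0 ?ltr0n //=.
    by rewrite ltr_pdivrMr // ltr_pM2l // ltr_nat.
  by case: ltgtP.
have -> : angle = pi * (q - 3)%:R / 3%:R + pi.
  by rewrite natrB 1?ltnW // /angle; field.
rewrite sinDpi oppr_eq0.
have : 0 < sin (pi * (q - 3)%:R / 3%:R : R).
  apply: sin_gt0_pi; rewrite divr_gt0 ?mulr_gt0 ?ltr0n ?subn_gt0 //=.
  by rewrite ltr_pdivrMr // ltr_pM2l // ltr_nat ltn_subLR // ltnW.
by case: ltgtP.
Qed.

(** For c the cosine and e = (-1)^q, the triple angle formula 4 c^3 - 3 c = e is
    (c - e) (2 c + e)^2 = 0, and c = e would make the sine vanish. *)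
Lemma two_cos_angle : cos angle *+ 2 = - (-1) ^+ q :> R.
Proof.
set c := cos angle; set e : R := (-1) ^+ q.
have e2 : e * e = 1 by rewrite -expr2 sqrr_sign.
have cs : c ^+ 2 + sin angle ^+ 2 = 1 := cos2Dsin2 angle.
have c3 : 4 * c ^+ 3 - 3 * c = e.
  have -> : e = cos (angle + angle + angle).
    by rewrite /e -cos_pi_nat; congr cos; rewrite /angle; field.
  rewrite !cosD !sinD -/c.
  have s2 : sin angle ^+ 2 = 1 - c ^+ 2 by rewrite -cs; ring.
  transitivity (c ^+ 3 - 3 * c * sin angle ^+ 2); last by ring.
  by rewrite s2; ring.
have ce : c - e != 0.
  apply: contraNneq sin_angle_neq0 => /eqP; rewrite subr_eq0 => /eqP ce.
  by rewrite -sqrf_eq0; apply/eqP; move: cs; rewrite ce expr2 e2 => /eqP;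
    rewrite -subr_eq0 addrAC subrr add0r => /eqP.
have : (c - e) * (c *+ 2 + e) ^+ 2 = 0.
  have -> : (c - e) * (c *+ 2 + e) ^+ 2 = 4 * c ^+ 3 - 3 * c * (e * e) - e * (e * e)
    by rewrite -mulr_natr; ring.
  by rewrite e2 !mulr1 c3 subrr.
move/eqP; rewrite mulf_eq0 (negPf ce) sqrf_eq0 addr_eq0 => /eqP ->.
by [].
Qed.

Lemma zeta_neq0 : zeta R 3 q != 0.
Proof.
apply: contraNneq sin_angle_neq0 => /eqP; rewrite /zeta eq_complex /= => /andP [_].
exact.
Qed.

Lemma zeta_trace : zeta R 3 q + (zeta R 3 q)^-1 = - (-1) ^+ q.
Proof.
have -> : (zeta R 3 q)^-1 = Complex (cos angle) (- sin angle).
  apply: (mulfI zeta_neq0); rewrite mulfV ?zeta_neq0 // /zeta -/angle.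
  apply/eqP; rewrite eq_complex /= !mulrN opprK -!expr2 cos2Dsin2 eqxx /=.
  by rewrite mulrC addNr.
rewrite /zeta -/angle; apply/eqP; rewrite eq_complex /=.
have -> : (-1) ^+ q = Complex ((-1) ^+ q) 0 :> R[i].
  by rewrite -[in RHS]signr_odd -signr_odd; case: odd; rewrite ?expr0 ?expr1;
    apply/eqP; rewrite eq_complex /= ?oppr0 !eqxx.
by rewrite /= subrr oppr0 eqxx andbT -mulr2n two_cos_angle.
Qed.

End Root.

Import Defs.

(** * Running time of register programs *)
Section Timing.
Local Open Scope nat_scope.

(** Every register and memory cell holds at most w bits.  With w at least 5 this
    remains so for the immediate constants below 32. *)
Definition bounded (w : nat) (s : state) : Prop :=
  [/\ 5 <= w, forall r, reg s r < 2 ^ w & forall a, mem s a < 2 ^ w].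

(** Here m counts operations.  Each of them lengthens the values by at most one
    bit, hence is charged at most 2 (w + m). *)
Definition runs (c : cmd) (s : state) (m : nat) (s' : state) : Prop :=
  forall w, bounded w s ->
  exists k, [/\ exec c s k s', k <= 2 * m * (w + m) & bounded (w + m) s'].

Lemma bitlen_le v w : 0 < w -> v < 2 ^ w -> bitlen v <= w.
Proof.
move=> w0 vw; rewrite /bitlen; case: v vw => [|v] vw; first by rewrite trunc_log0.
by rewrite ltnNge -(leq_exp2l (m := 2)) // -ltnNge (leq_ltn_trans _ vw) // trunc_logP.
Qed.

Lemma bounded_widen w w' s : w <= w' -> bounded w s -> bounded w' s.
Proof.
move=> ww' [w5 hr hm]; have le2 : 2 ^ w <= 2 ^ w' by rewrite leq_exp2l.
split; first exact: leq_trans w5 ww'.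
  by move=> r; apply: leq_trans (hr r) le2.
by move=> a; apply: leq_trans (hm a) le2.
Qed.

Lemma bounded_set_reg w s x v :
  bounded w s -> v < 2 ^ w.+1 -> bounded w.+1 (set_reg s x v).
Proof.
move=> /(bounded_widen (leqnSn w)) [w5 hr hm] hv; split => //= r.
by rewrite /upd; case: eqP => _; first exact: hv; apply: hr.
Qed.

Lemma bounded_set_mem w s x v :
  bounded w s -> v < 2 ^ w.+1 -> bounded w.+1 (set_mem s x v).
Proof.
move=> /(bounded_widen (leqnSn w)) [w5 hr hm] hv; split => //= r.
by rewrite /upd; case: eqP => _; first exact: hv; apply: hm.
Qed.

Lemma bitlen_reg w s r : bounded w s -> bitlen (reg s r) <= w.
Proof. by case=> w5 hr _; apply: bitlen_le => //; apply: leq_trans w5. Qed.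

Lemma bitlen_mem w s a : bounded w s -> bitlen (mem s a) <= w.
Proof. by case=> w5 _ hm; apply: bitlen_le => //; apply: leq_trans w5. Qed.

Lemma runs_weaken c s m m' s' : m <= m' -> runs c s m s' -> runs c s m' s'.
Proof.
move=> mm' H w /H [k [ek kle bs]]; exists k; split=> //.
  by apply: leq_trans kle _; rewrite leq_mul // ?leq_mul2l // leq_add2l.
by apply: bounded_widen bs; rewrite leq_add2l.
Qed.

Lemma runs_skip s : runs Skip s 1 s.
Proof.
move=> w bs; exists 1; split; first exact: ExecSkip.
  by rewrite muln1 addn1 muln_gt0.
by apply: bounded_widen bs; rewrite leq_addr.
Qed.

Lemma runs_const s x c : c < 32 -> runs (Const x c) s 1 (set_reg s x c).
Proof.
move=> c32 w bs; have w5 : 5 <= w by case: bs.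
have cw : c < 2 ^ w by apply: leq_trans c32 _; rewrite -[32]/(2 ^ 5) leq_exp2l.
have := @bitlen_le c w _ cw; exists (bitlen c); split; first exact: ExecConst.
  by move: (H ltac:(lia)); lia.
rewrite addn1; apply: bounded_set_reg => //.
by apply: leq_trans cw _; rewrite leq_exp2l.
Qed.

Lemma runs_add s x y z :
  runs (Add x y z) s 1 (set_reg s x (reg s y + reg s z)).
Proof.
move=> w bs; have := bitlen_reg y bs; have := bitlen_reg z bs => hz hy.
eexists; split; first exact: ExecAdd.
  by lia.
rewrite addn1; apply: bounded_set_reg => //.
by case: bs => _ hr _; move: (hr y) (hr z); rewrite expnS; lia.
Qed.

Lemma runs_sub s x y z :
  runs (Sub x y z) s 1 (set_reg s x (reg s y - reg s z)).
Proof.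
move=> w bs; have := bitlen_reg y bs; have := bitlen_reg z bs => hz hy.
eexists; split; first exact: ExecSub.
  by lia.
rewrite addn1; apply: bounded_set_reg => //.
by case: bs => _ hr _; move: (hr y) (hr z); rewrite expnS; lia.
Qed.

Lemma runs_read s x y : runs (Read x y) s 1 (set_reg s x (mem s (reg s y))).
Proof.
move=> w bs; have := bitlen_reg y bs; have := bitlen_mem (reg s y) bs => hz hy.
eexists; split; first exact: ExecRead.
  by lia.
rewrite addn1; apply: bounded_set_reg => //.
by case: bs => _ _ hm; move: (hm (reg s y)); rewrite expnS; lia.
Qed.

Lemma runs_write s x y : runs (Write x y) s 1 (set_mem s (reg s x) (reg s y)).
Proof.
move=> w bs; have := bitlen_reg x bs; have := bitlen_reg y bs => hz hy.
eexists; split; first exact: ExecWrite.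
  by lia.
rewrite addn1; apply: bounded_set_mem => //.
by case: bs => _ hr _; move: (hr y); rewrite expnS; lia.
Qed.

Lemma runs_seq c1 c2 s m1 s1 m2 s2 :
  runs c1 s m1 s1 -> runs c2 s1 m2 s2 -> runs (Seq c1 c2) s (m1 + m2) s2.
Proof.
move=> H1 H2 w /H1 [k1 [e1 le1 /H2 [k2 [e2 le2 b2]]]].
exists (k1 + k2); split; first exact: ExecSeq e1 e2; last by rewrite addnA.
have h1 : 2 * m1 * (w + m1) <= 2 * m1 * (w + (m1 + m2)).
  by rewrite leq_mul2l addnA leq_addr orbT.
by rewrite mulnDr mulnDl; rewrite -addnA in le2; lia.
Qed.

Lemma runs_test x c s m s' (C : cmd) :
    (forall k, exec c s k s' -> exec C s (bitlen (reg s x) + k) s') ->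
  runs c s m s' -> runs C s m.+1 s'.
Proof.
move=> HC H w bs; have := bitlen_reg x bs => hx.
have [k [ek kle b']] := H _ bs.
exists (bitlen (reg s x) + k); split; first exact: HC.
  have : 2 * m * (w + m) <= 2 * m * (w + m.+1).
    by rewrite leq_mul2l leq_add2l leqnSn orbT.
  by rewrite -{3}addn1 mulnDr mulnDl; lia.
by apply: bounded_widen b'; rewrite leq_add2l.
Qed.

Lemma runs_if_true x c1 c2 s m s' :
  reg s x != 0 -> runs c1 s m s' -> runs (If x c1 c2) s m.+1 s'.
Proof. by move=> x0; apply: runs_test => k; apply: ExecIfTrue. Qed.

Lemma runs_if_false x c1 c2 s m s' :
  reg s x = 0 -> runs c2 s m s' -> runs (If x c1 c2) s m.+1 s'.
Proof. by move=> x0; apply: runs_test => k; apply: ExecIfFalse. Qed.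

Lemma runs_while_false x c s : reg s x = 0 -> runs (While x c) s 1 s.
Proof.
move=> x0 w bs; have hx := bitlen_reg x bs; exists (bitlen (reg s x)); split.
- exact: ExecWhileFalse.
- by lia.
- by apply: bounded_widen bs; rewrite leq_addr.
Qed.

Lemma runs_while_true x c s m1 s1 m2 s2 :
    reg s x != 0 -> runs c s m1 s1 -> runs (While x c) s1 m2 s2 ->
  runs (While x c) s (m1 + m2).+1 s2.
Proof.
move=> x0 H1 H2.
have := @runs_test x (Seq c (While x c)) s (m1 + m2) s2 (While x c).
apply; last exact: runs_seq H1 H2.
move=> k e; inversion e; subst.
by rewrite addnA; apply: ExecWhileTrue; eassumption.
Qed.

End Timing.

(** * A language of bounded loops *)
Section Loops.
Local Open Scope nat_scope.

Inductive expr : Type :=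
  | Var (r : nat)
  | Cst (c : nat)
  | Plus (e1 e2 : expr)
  | Minus (e1 e2 : expr)
  | Fetch (e : expr).

(** In [For i b p] register i runs over the numbers below the value of register
    b. *)
Inductive prog : Type :=
  | Nop
  | Asg (r : nat) (e : expr)
  | Sto (a e : expr)
  | Then (p q : prog)
  | Ite (e : expr) (p q : prog)
  | For (i b : nat) (p : prog).

Fixpoint eval (s : state) (e : expr) : nat :=
  match e with
  | Var r => reg s r
  | Cst c => c
  | Plus e1 e2 => eval s e1 + eval s e2
  | Minus e1 e2 => eval s e1 - eval s e2
  | Fetch e => mem s (eval s e)
  end.

Fixpoint run (p : prog) (s : state) : state :=
  match p with
  | Nop => s
  | Asg r e => set_reg s r (eval s e)
  | Sto a e => set_mem s (eval s a) (eval s e)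
  | Then p q => run q (run p s)
  | Ite e p q => if eval s e != 0 then run p s else run q s
  | For i b p =>
      set_reg (foldl (fun s k => run p (set_reg s i k)) s (iota 0 (reg s b)))
              i (reg s b)
  end.

Fixpoint assigned (p : prog) : seq nat :=
  match p with
  | Asg r _ => [:: r]
  | Then p q => assigned p ++ assigned q
  | Ite _ p q => assigned p ++ assigned q
  | For i _ p => i :: assigned p
  | _ => [::]
  end.

Lemma run_frame p s r : r \notin assigned p -> reg (run p s) r = reg s r.
Proof.
elim: p s => //= [x e|p IHp q IHq|e p IHp q IHq|i b p IHp] s.
- by rewrite inE /upd => /negPf ->.
- by rewrite mem_cat negb_or => /andP [hp hq]; rewrite IHq // IHp.
- by rewrite mem_cat negb_or => /andP [hp hq]; case: ifP => _; auto.
rewrite inE negb_or => /andP [/negPf ri hp]; rewrite /upd ri.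
move: (iota _ _) => l; elim: l s => //= k l IHl s.
by rewrite IHl IHp //= /upd ri.
Qed.

Lemma run_for (Inv : nat -> state -> Prop) (Q : state -> Prop) i b p s :
    Inv 0 s ->
    (forall k s1, k < reg s b -> Inv k s1 -> Inv k.+1 (run p (set_reg s1 i k))) ->
    (forall s1, Inv (reg s b) s1 -> Q (set_reg s1 i (reg s b))) ->
  Q (run (For i b p) s).
Proof.
move=> H0 HS HQ /=; apply: HQ; move: (reg s b) HS => N HS.
have H m k s1 : k + m = N -> Inv k s1 ->
    Inv N (foldl (fun s2 k => run p (set_reg s2 i k)) s1 (iota k m)).
  elim: m k s1 => [|m IHm] k s1 /=; first by rewrite addn0 => <-.
  move=> kN Ik; apply: IHm; first by rewrite addSnnS.
  by apply: HS => //; lia.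
exact: H.
Qed.

(** Registers from [scratch] on hold the intermediate results of compiled code. *)
Definition scratch := 40.

Fixpoint wf_expr (e : expr) : bool :=
  match e with
  | Var r => r < scratch
  | Cst c => c < 32
  | Plus e1 e2 => wf_expr e1 && wf_expr e2
  | Minus e1 e2 => wf_expr e1 && wf_expr e2
  | Fetch e => wf_expr e
  end.

(** Loops are bounded by the registers 0, 1 and 2, which are never assigned; this
    is what makes [cost] independent of the data. *)
Fixpoint wf (p : prog) : bool :=
  match p with
  | Nop => true
  | Asg r e => [&& 3 <= r, r < scratch & wf_expr e]
  | Sto a e => wf_expr a && wf_expr e
  | Then p q => wf p && wf q
  | Ite e p q => [&& wf_expr e, wf p & wf q]
  | For i b p => [&& 3 <= i, i < scratch, b < 3, wf p & i \notin assigned p]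
  end.

Fixpoint comp_expr (e : expr) (t : nat) : cmd :=
  match e with
  | Var r => Seq (Const t 0) (Add t t r)
  | Cst c => Const t c
  | Plus e1 e2 => Seq (Seq (comp_expr e1 t) (comp_expr e2 t.+1)) (Add t t t.+1)
  | Minus e1 e2 => Seq (Seq (comp_expr e1 t) (comp_expr e2 t.+1)) (Sub t t t.+1)
  | Fetch e => Seq (comp_expr e t) (Read t t)
  end.

Definition comp_asg (r : nat) (e : expr) : cmd :=
  Seq (comp_expr e scratch) (Seq (Const r 0) (Add r r scratch)).

Fixpoint comp (p : prog) : cmd :=
  match p with
  | Nop => Skip
  | Asg r e => comp_asg r e
  | Sto a e => Seq (Seq (comp_expr a scratch) (comp_expr e scratch.+1))
                   (Write scratch scratch.+1)
  | Then p q => Seq (comp p) (comp q)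
  | Ite e p q => Seq (comp_expr e scratch) (If scratch (comp p) (comp q))
  | For i b p =>
      (* The test b - i is recomputed after each iteration, so that nested loops
         can share the register holding it. *)
      Seq (Seq (Const i 0) (Sub scratch b i))
        (While scratch
           (Seq (Seq (comp p) (Seq (Const scratch 1) (Add i i scratch)))
              (Sub scratch b i)))
  end.

Fixpoint expr_cost (e : expr) : nat :=
  match e with
  | Var _ => 2
  | Cst _ => 1
  | Plus e1 e2 => expr_cost e1 + expr_cost e2 + 1
  | Minus e1 e2 => expr_cost e1 + expr_cost e2 + 1
  | Fetch e => expr_cost e + 1
  end.

Fixpoint cost (K : nat) (p : prog) : nat :=
  match p with
  | Nop => 1
  | Asg _ e => expr_cost e + 2
  | Sto a e => expr_cost a + expr_cost e + 1
  | Then p q => cost K p + cost K q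
  | Ite e p q => expr_cost e + (cost K p + cost K q).+1
  | For _ _ p => 3 + K * (cost K p + 4)
  end.

Definition agree (s u : state) : Prop :=
  mem s = mem u /\ forall r, r < scratch -> reg s r = reg u r.

Lemma comp_exprP e t s u : wf_expr e -> scratch <= t -> agree s u ->
  exists u', [/\ runs (comp_expr e t) u (expr_cost e) u',
    reg u' t = eval s e, forall r, r < t -> reg u' r = reg u r & mem u' = mem u].
Proof.
elim: e t u => [r|c|e1 IH1 e2 IH2|e1 IH1 e2 IH2|e IH] t u /= we st su.
- exists (set_reg (set_reg u t 0) t (reg u r)); split => //=.
  + rewrite -[2]/(1 + 1); apply: (runs_seq (runs_const _ _)) => //.
    have := @runs_add (set_reg u t 0) t t r; rewrite /= /upd eqxx.
    by rewrite ifN ?add0n //; apply: contraTneq (leq_trans we st) => ->; rewrite ltnn.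
  + by rewrite /upd eqxx; case: su => _ ->.
  + by move=> x xt; rewrite /upd ifN ?ifN // neq_ltn xt.
- exists (set_reg u t c); split => //=; first exact: runs_const.
    by rewrite /upd eqxx.
  by move=> x xt; rewrite /upd ifN // neq_ltn xt.
- case/andP: we => w1 w2.
  have [u1 [r1 v1 f1 m1]] := IH1 _ _ w1 st su.
  have su1 : agree s u1.
    case: su => ms rs; split; first by rewrite m1.
    by move=> r rs'; rewrite f1 ?rs //; apply: leq_trans st.
  have [u2 [r2 v2 f2 m2]] := IH2 _ _ w2 (leqW st) su1.
  exists (set_reg u2 t (eval s e1 + eval s e2)); split => //=.
  + apply: runs_seq (runs_seq r1 r2) _.
    by have := @runs_add u2 t t t.+1; rewrite v2 f2 // v1.
  + by rewrite /upd eqxx.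
  + by move=> x xt; rewrite /upd ifN ?neq_ltn ?xt // f2 ?f1 // ltnW.
  + by rewrite m2.
- case/andP: we => w1 w2.
  have [u1 [r1 v1 f1 m1]] := IH1 _ _ w1 st su.
  have su1 : agree s u1.
    case: su => ms rs; split; first by rewrite m1.
    by move=> r rs'; rewrite f1 ?rs //; apply: leq_trans st.
  have [u2 [r2 v2 f2 m2]] := IH2 _ _ w2 (leqW st) su1.
  exists (set_reg u2 t (eval s e1 - eval s e2)); split => //=.
  + apply: runs_seq (runs_seq r1 r2) _.
    by have := @runs_sub u2 t t t.+1; rewrite v2 f2 // v1.
  + by rewrite /upd eqxx.
  + by move=> x xt; rewrite /upd ifN ?neq_ltn ?xt // f2 ?f1 // ltnW.
  + by rewrite m2.
- have [u1 [r1 v1 f1 m1]] := IH _ _ we st su.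
  exists (set_reg u1 t (mem s (eval s e))); split => //=.
  + apply: runs_seq r1 _; have := @runs_read u1 t t.
    by rewrite v1 m1 -(proj1 su).
  + by rewrite /upd eqxx.
  + by move=> x xt; rewrite /upd ifN ?neq_ltn ?xt // f1.
Qed.

Lemma agree_frame s u u' : agree s u ->
  (forall r, r < scratch -> reg u' r = reg u r) -> mem u' = mem u -> agree s u'.
Proof.
by case=> ms rs f m; split=> [|r rs']; [rewrite m | rewrite f // rs].
Qed.

Lemma agree_set_reg s u u' x v : agree s u -> mem u' = mem u -> reg u' x = v ->
    (forall r, r < scratch -> r != x -> reg u' r = reg u r) ->
  agree (set_reg s x v) u'.
Proof.
case=> ms rs m xv f; split=> [|r rs'] /=; first by rewrite m.
by rewrite /upd; case: eqVneq => [->|rx]; [rewrite xv | rewrite f // rs].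
Qed.

Lemma comp_asgP r e s u : r < scratch -> wf_expr e -> agree s u ->
  exists2 u', runs (comp_asg r e) u (expr_cost e + 2) u'
            & agree (set_reg s r (eval s e)) u'.
Proof.
move=> rs we su.
have [u1 [r1 v1 f1 m1]] := comp_exprP we (leqnn _) su.
exists (set_reg (set_reg u1 r 0) r (eval s e)).
  apply: (runs_seq r1); rewrite -[2]/(1 + 1).
  apply: (runs_seq (runs_const _ _)) => //.
  have := @runs_add (set_reg u1 r 0) r r scratch; rewrite /= /upd eqxx.
  by rewrite ifN ?add0n ?v1 // neq_ltn rs orbT.
apply: (agree_set_reg su); first by rewrite /= m1.
  by rewrite /= /upd eqxx.
by move=> x xs /negPf xr /=; rewrite /upd xr f1.
Qed.

Lemma compP K p s u : wf p -> (forall b, b < 3 -> reg s b <= K) -> agree s u ->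
  exists2 u', runs (comp p) u (cost K p) u' & agree (run p s) u'.
Proof.
have low q x : wf q -> x < 3 -> x \notin assigned q.
  elim: q => //= [r e|q1 IH1 q2 IH2|e q1 IH1 q2 IH2|i b q IHq].
  - by case/and3P => r3 _ _ x3; rewrite inE neq_ltn (leq_trans x3 r3).
  - by case/andP => w1 w2 x3; rewrite mem_cat negb_or IH1 ?IH2.
  - by case/and3P => _ w1 w2 x3; rewrite mem_cat negb_or IH1 ?IH2.
  - case/and5P => i3 _ _ wq _ x3.
    by rewrite inE negb_or neq_ltn (leq_trans x3 i3) IHq.
elim: p s u => [|r e|a e|p IHp q IHq|e p IHp q IHq|i b p IHp] s u /=.
- by move=> _ _ su; exists u => //; apply: runs_skip.
- by case/and3P => _ rs we _ su; apply: comp_asgP.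
- case/andP => wa we hK su.
  have [u1 [r1 v1 f1 m1]] := comp_exprP wa (leqnn _) su.
  have su1 := agree_frame su f1 m1.
  have [u2 [r2 v2 f2 m2]] := comp_exprP we (leqW (leqnn _)) su1.
  exists (set_mem u2 (eval s a) (eval s e)).
    apply: runs_seq (runs_seq r1 r2) _.
    by have := @runs_write u2 scratch scratch.+1; rewrite v2 f2 // v1.
  case: su => ms rs; split=> [|r rs'] /=; first by rewrite m2 m1 ms.
  by rewrite f2 ?f1 ?rs // ltnW.
- case/andP => wp wq hK su.
  have [u1 r1 su1] := IHp _ _ wp hK su.
  have [|u2 r2 su2] := IHq _ _ wq _ su1.
    by move=> x x3; rewrite run_frame ?hK // low.
  by exists u2 => //; apply: runs_seq r1 r2.
- case/and3P => we wp wq hK su.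
  have [u1 [r1 v1 f1 m1]] := comp_exprP we (leqnn _) su.
  have su1 := agree_frame su f1 m1.
  case: ifPn => [e0|/negPn/eqP e0].
    have [u2 r2 su2] := IHp _ _ wp hK su1; exists u2 => //.
    apply: (runs_seq r1); apply: runs_if_true; first by rewrite v1.
    by apply: runs_weaken r2; rewrite leq_addr.
  have [u2 r2 su2] := IHq _ _ wq hK su1; exists u2 => //.
  apply: (runs_seq r1); apply: runs_if_false; first by rewrite v1.
  by apply: runs_weaken r2; rewrite leq_addl.
case/and5P => i3 is_ b3 wp ip hK su.
have bN : (b == i) = false by apply/negbTE; rewrite neq_ltn (leq_trans b3 i3).
have sN : (i == scratch) = false by apply/negbTE; rewrite neq_ltn is_.
have bsN : (b == scratch) = false by apply/negbTE; rewrite neq_ltn (leq_trans b3).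
set W := While _ _.
have loop m k s1 u1 : k + m = reg s b -> (forall x, x < 3 -> reg s1 x = reg s x) ->
    agree (set_reg s1 i k) u1 -> reg u1 scratch = m ->
    exists2 u2, runs W u1 (m * (cost K p + 4) + 1) u2 &
      agree (set_reg (foldl (fun s k => run p (set_reg s i k)) s1 (iota k m))
                     i (reg s b)) u2.
  elim: m k s1 u1 => [|m IHm] k s1 u1 km low1 su1 tm.
    exists u1; first exact: runs_while_false.
    by rewrite -km addn0.
  have [|u2 r2 su2] := IHp _ _ wp _ su1.
    move=> x x3; rewrite /= /upd; case: eqP => [xi|_]; last by rewrite low1 // hK.
    by move: x3; rewrite xi ltnNge i3.
  set s2 := run p (set_reg s1 i k) in su2.
  have i2 : reg u2 i = k.
    by rewrite -(proj2 su2) // run_frame //= /upd eqxx.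
  have low2 x : x < 3 -> reg s2 x = reg s x.
    move=> x3; rewrite run_frame ?low //= /upd.
    by rewrite ifN ?low1 // neq_ltn (leq_trans x3 i3).
  have b2 : reg u2 b = reg s b by rewrite -(proj2 su2) ?low2 // (leq_trans b3).
  pose u3 := set_reg (set_reg (set_reg u2 scratch 1) i k.+1) scratch m.
  have r3 : runs (Seq (Seq (comp p) (Seq (Const scratch 1) (Add i i scratch)))
              (Sub scratch b i)) u1 (cost K p + (1 + 1) + 1) u3.
    apply: runs_seq.
      apply: runs_seq r2 _; apply: (runs_seq (runs_const _ _)) => //.
      have := @runs_add (set_reg u2 scratch 1) i i scratch.
      rewrite /= /upd eqxx sN i2 addn1; apply.
    have := @runs_sub (set_reg (set_reg u2 scratch 1) i k.+1) scratch b i.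
    rewrite /= /upd eqxx bN bsN b2.
    by have -> : reg s b - k.+1 = m by lia.
  have su3 : agree (set_reg s2 i k.+1) u3.
    apply: (agree_set_reg su2) => //=.
      by rewrite /upd sN eqxx.
    by move=> x xs /negPf xi; rewrite /upd xi (ltn_eqF xs).
  have [||u4 r4 su4] := IHm k.+1 s2 u3 _ low2 su3.
  - by lia.
  - by rewrite /= /upd eqxx.
  - exists u4 => //; have := runs_while_true _ r3 r4; rewrite tm => /(_ isT).
    by apply: runs_weaken; rewrite mulSn; lia.
pose u1 := set_reg (set_reg u i 0) scratch (reg s b).
have r1 : runs (Seq (Const i 0) (Sub scratch b i)) u (1 + 1) u1.
  apply: (runs_seq (runs_const _ _)) => //.
  have := @runs_sub (set_reg u i 0) scratch b i.
  rewrite /= /upd eqxx bN subn0 -(proj2 su) //.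
  by apply: leq_trans b3 _.
have [| |u2 r2 su2] := loop (reg s b) 0 s u1 (add0n _) (fun _ _ => erefl).
- apply: (agree_set_reg su) => //=; first by rewrite /upd sN eqxx.
  by move=> x xs /negPf xi; rewrite /upd xi (ltn_eqF xs).
- by rewrite /u1 /= /upd eqxx.
exists u2 => //; apply: runs_weaken (runs_seq r1 r2).
have : reg s b * (cost K p + 4) <= K * (cost K p + 4).
  by rewrite leq_mul2r hK // orbT.
lia.
Qed.

Lemma cost_poly p : exists c d, forall K, cost K p <= c * K.+1 ^ d.
Proof.
elim: p => /= [|r e|a e|p [c [d H]] q [c' [d' H']]|e p [c [d H]] q [c' [d' H']]|i b p
  [c [d H]]].
- by exists 1, 0.
- by exists (expr_cost e + 2), 0 => K; rewrite muln1.
- by exists (expr_cost a + expr_cost e + 1), 0 => K; rewrite muln1.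
- exists (c + c'), (d + d') => K; rewrite mulnDl.
  apply: leq_add; [apply: leq_trans (H K) _|apply: leq_trans (H' K) _];
    by rewrite leq_mul2l expnD ?leq_pmulr ?leq_pmull ?orbT ?expn_gt0.
- exists (expr_cost e + c + c' + 1), (d + d') => K; rewrite !mulnDl.
  have h1 : c * K.+1 ^ d <= c * K.+1 ^ (d + d').
    by rewrite leq_mul2l expnD leq_pmulr ?orbT // expn_gt0.
  have h2 : c' * K.+1 ^ d' <= c' * K.+1 ^ (d + d').
    by rewrite leq_mul2l expnD leq_pmull ?orbT // expn_gt0.
  have h3 : 0 < K.+1 ^ (d + d') by rewrite expn_gt0.
  have h4 : expr_cost e <= expr_cost e * K.+1 ^ (d + d') by rewrite leq_pmulr.
  by move: (H K) (H' K); lia.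
- exists (3 + c + 4), d.+1 => K.
  have h3 : 0 < K.+1 ^ d by rewrite expn_gt0.
  have hk : K * (cost K p + 4) <= K.+1 * ((c + 4) * K.+1 ^ d).
    by apply: leq_mul => //; rewrite mulnDl leq_add ?H // leq_pmulr.
  have h4 : 3 <= 3 * (K.+1 * K.+1 ^ d) by rewrite leq_pmulr // muln_gt0.
  rewrite expnS -addnA [X in _ <= X]mulnDl; apply: leq_add => //.
  by apply: leq_trans hk _; rewrite mulnCA.
Qed.

End Loops.

(** * The program *)
Section Program.
Local Open Scope nat_scope.

Definition dbl e := Plus e e.
Definition quad e := dbl (dbl e).
Definition slotE t i j := Plus (Plus (quad (quad t)) (quad i)) j.
Definition gluingE t f := let g := Plus (quad t) f in Plus (Plus (quad g) g) (Cst 1).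
Definition eqE e1 e2 := Minus (Cst 1) (Plus (Minus e1 e2) (Minus e2 e1)).
Definition xorE e1 e2 := Plus (Minus e1 e2) (Minus e2 e1).
(** The residue modulo 4 of a number below 8. *)
Definition red4E e := Minus e (quad (Minus (Cst 1) (Minus (Cst 4) e))).
Definition labE u := Fetch (Plus (Var 3) u).
Definition bitE p u := Fetch (Plus (Plus (Var 4) p) u).

Lemma eval_plus s e1 e2 : eval s (Plus e1 e2) = eval s e1 + eval s e2. Proof. by []. Qed.

Lemma eval_slotE s t i j :
  eval s (slotE t i j) = 16 * eval s t + 4 * eval s i + eval s j.
Proof. by rewrite /=; lia. Qed.

Lemma eval_gluingE s t f : eval s (gluingE t f) = 5 * (4 * eval s t + eval s f) + 1.
Proof. by rewrite /=; lia. Qed.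

Lemma eval_eqE s e1 e2 : eval s (eqE e1 e2) = (eval s e1 == eval s e2).
Proof. by rewrite /=; case: eqP; lia. Qed.

Lemma eval_xorE s e1 e2 (b1 b2 : bool) : eval s e1 = b1 -> eval s e2 = b2 ->
  eval s (xorE e1 e2) = b1 (+) b2.
Proof. by move=> /= -> ->; case: b1; case: b2. Qed.

Lemma eval_red4E s e : eval s e < 8 -> eval s (red4E e) = eval s e %% 4.
Proof. by move=> /=; lia. Qed.

(** The registers 0, 1, 2 hold 16 n, n and 4; the registers 3 and 4 hold the
    addresses of the array of labels, indexed by slots, and of the matrix of rows
    on which elimination takes place, whose columns are indexed by slots.  The
    counts of vertices and of dimensions are in the registers 5 and 6. *)
Definition init_labels := For 15 0 (Sto (Plus (Var 3) (Var 15)) (Var 15)).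

(** Merging two classes: the slots labelled like the first one take the label of
    the second one. *)
Definition relabel := For 14 0
  (Ite (eqE (labE (Var 14)) (Var 22)) (Sto (Plus (Var 3) (Var 14)) (Var 23)) Nop).

Definition merge := Then (Asg 22 (labE (Var 20))) (Then (Asg 23 (labE (Var 21))) relabel).

Definition load_partner :=
  Then (Asg 20 (slotE (Var 10) (Var 12) (Var 13)))
    (Ite (Plus (eqE (Var 11) (Var 12)) (eqE (Var 11) (Var 13)))
      (Asg 21 (slotE (Var 10) (Var 13) (Var 12)))
      (let g := gluingE (Var 10) (Var 11) in
       Asg 21 (slotE (Fetch g) (Fetch (Plus (Plus g (Cst 1)) (Var 13)))
                              (Fetch (Plus (Plus g (Cst 1)) (Var 12)))))).

Definition glue_slots :=
  For 10 1 (For 11 2 (For 12 2 (For 13 2 (Then load_partner merge)))).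

Definition init_row :=
  For 16 0 (Sto (Plus (Plus (Var 4) (Var 26)) (Var 16)) (eqE (labE (Var 16)) (Var 15))).

Definition next_row := Asg 26 (Plus (Var 26) (Var 0)).

(** Row a is the indicator function of the class with label a; it vanishes when a
    is not a label.  Register 6 counts the labels, and later holds the binary
    logarithm of the number of vectors spanned by the rows. *)
Definition init_rows :=
  Then (Asg 6 (Cst 0)) (Then (Asg 26 (Cst 0))
    (For 15 0 (Then (Asg 6 (Plus (Var 6) (eqE (labE (Var 15)) (Var 15))))
              (Then init_row next_row)))).

Definition count_vertices :=
  Then (Asg 5 (Cst 0))
    (For 10 1 (For 12 2 (let u := slotE (Var 10) (Var 12) (Var 12) in
       Asg 5 (Plus (Var 5) (eqE (labE u) u))))).

Definition add_pivot :=
  For 16 0 (Sto (Plus (Plus (Var 4) (Var 26)) (Var 16))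
                (xorE (bitE (Var 26) (Var 16)) (bitE (Var 25) (Var 16)))).

Definition clear_pivot :=
  For 16 0 (Sto (Plus (Plus (Var 4) (Var 25)) (Var 16)) (Cst 0)).

(** The condition is imposed in a single pass.  The first row that violates it
    becomes the pivot, of offset held in register 25 and flagged by register 24,
    and is added to the later rows that violate it; no earlier row does. *)
Definition sweep_row :=
  Then (Asg 27 (xorE (xorE (bitE (Var 26) (slotE (Var 10) (Var 11) (Var 12)))
                           (bitE (Var 26) (slotE (Var 10) (Var 11) (Var 13))))
                     (bitE (Var 26) (slotE (Var 10) (Var 12) (Var 13)))))
  (Then (Ite (Var 27)
          (Ite (Var 24) add_pivot (Then (Asg 24 (Cst 1)) (Asg 25 (Var 26))))
          Nop)
        next_row).

Definition eliminate :=
  Then (Asg 24 (Cst 0)) (Then (Asg 26 (Cst 0)) (Then (For 15 0 sweep_row)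
    (Ite (Var 24) (Then (Asg 6 (Minus (Var 6) (Cst 1))) clear_pivot) Nop))).

Definition eliminate_all :=
  For 10 1 (For 11 2 (For 12 2 (For 13 2 eliminate))).

Definition count_edges :=
  For 16 0 (Ite (eqE (labE (Var 16)) (Var 16))
    (Asg 28 (red4E (Plus (Var 28) (dbl (bitE (Var 26) (Var 16)))))) Nop).

Definition tet_edgesE :=
  let e i j := bitE (Var 26) (slotE (Var 10) (Cst i) (Cst j)) in
  Plus (Plus (Plus (Plus (Plus (e 0 1) (e 0 2)) (e 0 3)) (e 1 2)) (e 1 3)) (e 2 3).

(** By [tet_count], with m the number of nonzero edges, each tetrahedron adds m,
    and 2 more if m is not 0. *)
Definition count_tets :=
  For 10 1
   (Then (Asg 31 tet_edgesE)
    (Then (Asg 28 (red4E (Plus (Var 28) (Var 31))))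
      (Asg 28 (red4E (Plus (Var 28) (dbl (Minus (Cst 1) (Minus (Cst 1) (Var 31))))))))).

(** Register 28 holds the [surface_count] of the row modulo 4, which is 0 or 2;
    register 7 records that it was 2 for some row. *)
Definition check_row :=
  Then (Asg 28 (Cst 0)) (Then count_edges (Then count_tets
    (Then (Ite (Var 28) (Asg 7 (Cst 1)) Nop) next_row))).

Definition check_rows := Then (Asg 26 (Cst 0)) (For 15 0 check_row).

(** The loop has 16 n iterations, which bounds the exponents that can occur. *)
Definition power r e :=
  Then (Asg r (Cst 1)) (For 16 0 (Ite (Minus e (Var 16)) (Asg r (dbl (Var r))) Nop)).

(** One of the two differences is 0, so the fraction is reduced. *)
Definition output :=
  Then (power 29 (Minus (Var 6) (Var 5))) (Then (power 30 (Minus (Var 5) (Var 6)))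
  (Then (Ite (Var 7) (Then (Asg 29 (Cst 0)) (Asg 30 (Cst 1))) Nop)
  (Then (Sto (Cst 0) (Cst 0)) (Then (Sto (Cst 1) (Var 29)) (Then (Sto (Cst 2) (Var 30))
  (Then (Sto (Cst 3) (Cst 0)) (Then (Sto (Cst 4) (Cst 0)) (Sto (Cst 5) (Cst 1))))))))).

Definition init_addresses :=
  Then (Asg 3 (Plus (Plus (Var 0) (quad (Var 1))) (Cst 1)))
       (Asg 4 (Plus (Var 3) (Var 0))).

Definition main_prog (check : bool) :=
  Then init_addresses (Then init_labels (Then glue_slots (Then init_rows
  (Then count_vertices (Then eliminate_all
  (Then (Asg 7 (Cst 0)) (Then (if check then check_rows else Nop) output))))))).

Lemma wf_main check : wf (main_prog check).
Proof. by case: check. Qed.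

Definition tv_program (check : bool) : cmd :=
  Seq (comp_asg 1 (Fetch (Cst 0))) (Seq (comp_asg 2 (Cst 4))
  (Seq (comp_asg 0 (quad (quad (Var 1)))) (comp (main_prog check)))).

End Program.

Arguments slotE : simpl never.
Arguments gluingE : simpl never.
Arguments eqE : simpl never.
Arguments xorE : simpl never.
Arguments red4E : simpl never.
Arguments labE : simpl never.
Arguments bitE : simpl never.

(** * Rules for loops *)
Section LoopRules.
Local Open Scope nat_scope.

Lemma reg_set_reg s x v : reg (set_reg s x v) x = v.
Proof. by rewrite /= /upd eqxx. Qed.

Lemma run_then p q s : run (Then p q) s = run q (run p s). Proof. by []. Qed.

Lemma run_asg r e s : run (Asg r e) s = set_reg s r (eval s e). Proof. by []. Qed.

Lemma run_ite e p q s : run (Ite e p q) s = if eval s e != 0 then run p s else run q s.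
Proof. by []. Qed.

Lemma run_sto a e s : run (Sto a e) s = set_mem s (eval s a) (eval s e). Proof. by []. Qed.

(** For loops whose iteration k writes only at address base + k. *)
Lemma run_sweep i b p s base (F : nat -> nat) :
    assigned p = [::] ->
    (forall s1 k, k < reg s b -> (forall r, r != i -> reg s1 r = reg s r) ->
       reg s1 i = k ->
       (forall a, mem s1 a = if base <= a < base + k then F (a - base) else mem s a) ->
       forall a, mem (run p s1) a = if a == base + k then F k else mem s1 a) ->
  forall a, mem (run (For i b p) s) a =
    if base <= a < base + reg s b then F (a - base) else mem s a.
Proof.
move=> p0 Hp.
apply: (run_for (Inv := fun k s1 => (forall r, r != i -> reg s1 r = reg s r) /\
  forall a, mem s1 a = if base <= a < base + k then F (a - base) else mem s a)
  (Q := fun s' => forall a, mem s' a =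
    if base <= a < base + reg s b then F (a - base) else mem s a)).
- by split=> // a; case: ifP => //; lia.
- move=> k s1 kb [rs ms]; split=> [r /negPf ri|a].
    by rewrite run_frame ?p0 //= /upd ri rs // ri.
  rewrite (Hp _ k) //=; last first.
  + by rewrite /upd eqxx.
  + by move=> r /negPf ri; rewrite /upd ri rs // ri.
  case: (eqVneq a (base + k)) => [->|ak].
    by rewrite leq_addr addnS ltnSn /= addKn.
  rewrite ms; have -> // : (base <= a < base + k.+1) = (base <= a < base + k) by lia.
- by move=> s1 [_ ms] a; rewrite ms.
Qed.

(** For loops that compute a value in register acc and only read the memory. *)
Lemma run_counter i b p s acc (Q : nat -> nat -> Prop) : acc != i ->
    Q 0 (reg s acc) ->
    (forall s1 k, k < reg s b ->
       (forall r, r \notin i :: assigned p -> reg s1 r = reg s r) -> reg s1 i = k ->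
       mem s1 = mem s -> Q k (reg s1 acc) ->
       mem (run p s1) = mem s1 /\ Q k.+1 (reg (run p s1) acc)) ->
  mem (run (For i b p) s) = mem s /\ Q (reg s b) (reg (run (For i b p) s) acc).
Proof.
move=> /negPf ai Q0 Hp.
apply: (run_for (Inv := fun k s1 => [/\
  forall r, r \notin i :: assigned p -> reg s1 r = reg s r, mem s1 = mem s &
  Q k (reg s1 acc)])
  (Q := fun s' => mem s' = mem s /\ Q (reg s b) (reg s' acc))).
- by split.
- move=> k s1 kb [rs ms Qk].
  have rs1 r : r \notin i :: assigned p -> reg (set_reg s1 i k) r = reg s r.
    by move=> ri; rewrite /= /upd ifN ?rs //; move: ri; rewrite inE; case: eqP.
  have [|||m1 Q1] := Hp (set_reg s1 i k) k kb rs1 => //=.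
  + by rewrite /upd eqxx.
  + by rewrite /upd ai.
  + split; last by [].
      move=> r ri; rewrite run_frame ?rs1 //.
      by move: ri; rewrite inE negb_or => /andP [].
    by rewrite m1.
- by move=> s1 [rs ms Qk]; rewrite /= /upd ai.
Qed.

(** For loops whose iterations move the memory upwards in a preorder le.  What an
    iteration establishes then persists if it is upward closed, so that nested
    loops need no description of intermediate states. *)
Lemma run_establish (J : state -> Prop) (le : (nat -> nat) -> (nat -> nat) -> Prop)
    (P : nat -> (nat -> nat) -> Prop) i b p s :
    (forall s1 v, J s1 -> J (set_reg s1 i v)) ->
    (forall m, le m m) -> (forall m1 m2 m3, le m1 m2 -> le m2 m3 -> le m1 m3) ->
    (forall k m m', P k m -> le m m' -> P k m') ->
    (forall s1 k, k < reg s b ->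
       (forall r, r \notin i :: assigned p -> reg s1 r = reg s r) -> reg s1 i = k ->
       J s1 -> [/\ J (run p s1), le (mem s1) (mem (run p s1)) & P k (mem (run p s1))]) ->
    J s ->
  [/\ J (run (For i b p) s), le (mem s) (mem (run (For i b p) s))
    & forall k, k < reg s b -> P k (mem (run (For i b p) s))].
Proof.
move=> Ji le0 leT Ple Hp Js.
apply: (run_for (Inv := fun k s1 => [/\
  forall r, r \notin i :: assigned p -> reg s1 r = reg s r, J s1, le (mem s) (mem s1)
  & forall k', k' < k -> P k' (mem s1)])
  (Q := fun s' => [/\ J s', le (mem s) (mem s')
    & forall k, k < reg s b -> P k (mem s')])).
- by split.
- move=> k s1 kb [rs J1 le1 P1].
  have rs1 r : r \notin i :: assigned p -> reg (set_reg s1 i k) r = reg s r.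
    by move=> ri; rewrite /= /upd ifN ?rs //; move: ri; rewrite inE; case: eqP.
  have [||J2 le2 P2] := Hp (set_reg s1 i k) k kb rs1.
  + by rewrite /= /upd eqxx.
  + exact: Ji.
  split=> //.
  + move=> r ri; rewrite run_frame ?rs1 //.
    by move: ri; rewrite inE negb_or => /andP [].
  + exact: leT le1 le2.
  + move=> k'; rewrite ltnS leq_eqVlt => /predU1P [-> //|k'k].
    exact: Ple (P1 _ k'k) le2.
- by move=> s1 [rs J1 le1 P1]; split=> //; apply: Ji.
Qed.

End LoopRules.

Arguments run : simpl never.

(** * Memory layout and computation of the cells *)
Section Layout.
Local Open Scope nat_scope.
Variables (n : nat) (T : triangulation n).

Definition slot_index (u : slot n) : nat := 16 * u.1.1 + 4 * u.1.2 + u.2.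

Lemma slot_index_lt u : slot_index u < 16 * n.
Proof.
case: u => [[t i] j]; rewrite /slot_index /=.
by move: (ltn_ord t) (ltn_ord i) (ltn_ord j); lia.
Qed.

Lemma slot_index_inj : injective slot_index.
Proof.
move=> [[t i] j] [[t' i'] j']; rewrite /slot_index /= => E.
move: (ltn_ord i) (ltn_ord j) (ltn_ord i') (ltn_ord j') => hi hj hi' hj'.
by congr (_, _, _); apply: val_inj => /=; lia.
Qed.

Lemma slot_index_onto a : a < 16 * n -> exists u, slot_index u = a.
Proof.
move=> an; have tn : a %/ 16 < n by lia.
exists (Ordinal tn, inord ((a %/ 4) %% 4), inord (a %% 4)).
by rewrite /slot_index /= !inordK ?ltn_mod //; lia.
Qed.

Lemma nth_flatten_blocks (A : Type) (h : A -> seq nat) (c k r : nat) (l : seq A) a0 :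
    (forall a, size (h a) = c) -> r < c -> k < size l ->
  nth 0 (flatten (map h l)) (c * k + r) = nth 0 (h (nth a0 l k)) r.
Proof.
move=> hc rc; elim: l k => //= a l IHl [|k] kl; rewrite nth_cat hc.
  by rewrite muln0 rc.
by rewrite ifF; [rewrite mulnS -addnA addKn IHl | rewrite mulnS; lia].
Qed.

Lemma nth_faces (t : 'I_n) (f : 'I_4) p0 :
  nth p0 [seq (t, f) | t <- enum 'I_n, f <- enum 'I_4] (4 * t + f) = (t, f).
Proof.
suff H (l : seq 'I_n) k : k < size l ->
    nth p0 [seq (t, f) | t <- l, f <- enum 'I_4] (4 * k + f) = (nth t l k, f).
  by rewrite H ?size_enum_ord // nth_ord_enum.
elim: l k => //= a l IHl [|k] kl; rewrite nth_cat size_map size_enum_ord.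
  by rewrite muln0 ltn_ord (nth_map f) ?size_enum_ord ?ltn_ord // nth_ord_enum.
by rewrite ifF; [rewrite mulnS -addnA addKn IHl | rewrite mulnS; lia].
Qed.

Lemma encode_block (t : 'I_n) (f : 'I_4) r : r < 5 ->
  nth 0 (encode T) (5 * (4 * t + f) + 1 + r) =
  nth 0 ((neighbour T t f : nat) :: [seq (gluing T t f i : nat) | i <- enum 'I_4]) r.
Proof.
move=> r5; rewrite /encode addnAC addn1 /=.
rewrite (nth_flatten_blocks (t, f)) ?nth_faces // => [p|].
  by rewrite /= size_map size_enum_ord.
by rewrite size_allpairs !size_enum_ord; move: (ltn_ord t) (ltn_ord f); lia.
Qed.

Lemma encode_neighbour (t : 'I_n) (f : 'I_4) :
  nth 0 (encode T) (5 * (4 * t + f) + 1) = neighbour T t f.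
Proof. by rewrite -[_ + 1]addn0 encode_block. Qed.

Lemma encode_gluing (t : 'I_n) (f i : 'I_4) :
  nth 0 (encode T) (5 * (4 * t + f) + 1 + 1 + i) = gluing T t f i.
Proof.
rewrite -[_ + 1 + i]addnA encode_block; last by rewrite ltnS.
by rewrite add1n /= (nth_map i) ?size_enum_ord // nth_ord_enum.
Qed.

Definition regs_ok (s : state) : Prop :=
  [/\ reg s 0 = 16 * n, reg s 1 = n, reg s 2 = 4, reg s 3 = 20 * n + 1
    & reg s 4 = 36 * n + 1].

Lemma regs_ok_frame s s' : (forall r, r < 5 -> reg s' r = reg s r) ->
  regs_ok s -> regs_ok s'.
Proof. by move=> rs []; split; rewrite rs. Qed.

Lemma regs_ok_run p s : all (leq 5) (assigned p) -> regs_ok s -> regs_ok (run p s).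
Proof.
move=> /allP p5; apply: regs_ok_frame => r r5; rewrite run_frame //.
by apply/negP => /p5; rewrite leqNgt r5.
Qed.

Lemma regs_ok_set_reg s x v : 5 <= x -> regs_ok s -> regs_ok (set_reg s x v).
Proof.
by move=> x5; apply: regs_ok_frame => r r5; rewrite /= /upd ltn_eqF // (leq_trans r5).
Qed.

Definition input_ok (m : nat -> nat) : Prop :=
  forall a, a < 20 * n + 1 -> m a = nth 0 (encode T) a.

(** The input occupies the addresses 0 to 20 n, the labels the next 16 n. *)
Definition lab (m : nat -> nat) (a : nat) : nat := m (20 * n + 1 + a).

Definition labelled (m : nat -> nat) (rep : slot n -> slot n) : Prop :=
  forall u, lab m (slot_index u) = slot_index (rep u).

(** Labels are slots of the same cell.  That equal labels mean equal cells is thus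
    an invariant; the converse holds once all the gluings are processed. *)
Definition labelling (rep : slot n -> slot n) : Prop :=
  (forall u, rep (rep u) = rep u) /\ (forall u, slot_cell T (rep u) = slot_cell T u).

Definition partial_labels (s : state) : Prop :=
  [/\ regs_ok s, input_ok (mem s)
    & exists2 rep, labelled (mem s) rep & labelling rep].

Definition coarser (m m' : nat -> nat) : Prop :=
  forall u v : slot n, lab m (slot_index u) = lab m (slot_index v) ->
    lab m' (slot_index u) = lab m' (slot_index v).

Lemma eval_labE s e : regs_ok s -> eval s (labE e) = lab (mem s) (eval s e).
Proof. by case=> _ _ _ r3 _; rewrite /labE /= r3. Qed.

Lemma init_labels_spec s : regs_ok s -> input_ok (mem s) ->
  partial_labels (run init_labels s).
Proof.
move=> rs ins.
have mE a : mem (run init_labels s) a =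
    if 20 * n + 1 <= a < 20 * n + 1 + reg s 0 then a - (20 * n + 1) else mem s a.
  apply: (run_sweep (F := id)) => // s1 k kb rs1 rk _ b; rewrite run_sto /= /upd rk rs1 //.
  by case: rs => _ _ _ -> _.
have [r0 _ _ _ _] := rs.
split; first exact: regs_ok_run.
  by move=> a an; rewrite mE ifF ?ins //; lia.
exists id => // u; rewrite /lab mE r0; have := slot_index_lt u.
by move: (slot_index u) => a an; rewrite ifT; lia.
Qed.

Lemma merge_spec s u v : partial_labels s ->
    reg s 20 = slot_index u -> reg s 21 = slot_index v ->
    slot_cell T u = slot_cell T v ->
  [/\ partial_labels (run merge s), coarser (mem s) (mem (run merge s))
    & lab (mem (run merge s)) (slot_index u) = lab (mem (run merge s)) (slot_index v)].
Proof.
move=> [rs ins [rep repE [repK repC]]] ru rv uv.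
set x := slot_index (rep u); set y := slot_index (rep v).
pose s1 := set_reg (set_reg s 22 x) 23 y.
have -> : run merge s = run relabel s1.
  rewrite /merge !run_then !run_asg !eval_labE //.
  by rewrite [eval _ (Var 20)]ru [eval _ (Var 21)]rv !repE.
have rs1 : regs_ok s1 by do 2![apply: regs_ok_set_reg => //].
pose F a := if lab (mem s) a == x then y else lab (mem s) a.
have mE a : mem (run relabel s1) a =
    if 20 * n + 1 <= a < 20 * n + 1 + reg s1 0 then F (a - (20 * n + 1)) else mem s a.
  apply: (run_sweep (s := s1) (F := F)) => // s2 k kb rs2 rk ms b.
  have rs2' : regs_ok s2 by apply: regs_ok_frame rs1 => r r5;
    rewrite rs2 // ltn_eqF // (leq_trans r5).
  have lk : lab (mem s2) k = lab (mem s) k by rewrite /lab ms ifF //; lia.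
  rewrite run_ite eval_eqE eval_labE // [eval s2 (Var 14)]rk lk [eval s2 (Var 22)]rs2 //.
  rewrite [reg s1 22]/= /F; case: (lab (mem s) k == x) => /=.
    by rewrite rk !rs2 //= /upd; case: rs => _ _ _ -> _.
  by case: eqP => // ->; rewrite -lk.
have [r0 _ _ _ _] := rs1.
have labE w : lab (mem (run relabel s1)) (slot_index w) =
    slot_index (if rep w == rep u then rep v else rep w).
  rewrite {1}/lab mE r0 ifT; last by have := slot_index_lt w; lia.
  rewrite addKn /F repE /x /y (inj_eq slot_index_inj).
  by case: ifP.
split.
- split; first exact: regs_ok_run.
    by move=> a an; rewrite mE ifF ?ins //; lia.
  exists (fun w => if rep w == rep u then rep v else rep w) => //; split=> w.
    case: (eqVneq (rep w) (rep u)) => [_|/negPf wu]; rewrite repK; last by rewrite wu.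
    by case: ifP.
  by case: eqP => [wu|_]; rewrite repC // -uv -(repC u) -wu repC.
- move=> w w'; rewrite !repE !labE => /slot_index_inj ->.
  by [].
- by rewrite !labE eqxx; case: ifP.
Qed.

Lemma load_partner_spec s (t : 'I_n) (f i j : 'I_4) : partial_labels s ->
    reg s 10 = t -> reg s 11 = f -> reg s 12 = i -> reg s 13 = j ->
  [/\ mem (run load_partner s) = mem s,
      reg (run load_partner s) 20 = slot_index (t, i, j)
    & reg (run load_partner s) 21 = slot_index (partner T (t, i, j) f)].
Proof.
move=> [rs ins _] rt rf ri rj.
set s1 := set_reg s 20 (slot_index (t, i, j)).
have -> : run load_partner s = run (Ite (Plus (eqE (Var 11) (Var 12))
  (eqE (Var 11) (Var 13)))
      (Asg 21 (slotE (Var 10) (Var 13) (Var 12)))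
      (let g := gluingE (Var 10) (Var 11) in
       Asg 21 (slotE (Fetch g) (Fetch (Plus (Plus g (Cst 1)) (Var 13)))
                              (Fetch (Plus (Plus g (Cst 1)) (Var 12)))))) s1.
  by rewrite /load_partner run_then run_asg eval_slotE /= rt ri rj.
have r1 : [/\ reg s1 10 = t, reg s1 11 = f, reg s1 12 = i & reg s1 13 = j] by [].
have m1 : mem s1 = mem s by [].
have r20 : reg s1 20 = slot_index (t, i, j) by [].
case: r1 => r10 r11 r12 r13.
have evalP : eval s1 (Plus (eqE (Var 11) (Var 12)) (eqE (Var 11) (Var 13)))
    = (f == i) + (f == j).
  by rewrite eval_plus !eval_eqE /= /upd /= rf ri rj.
rewrite run_ite evalP /partner.
move: r20 m1 r10 r11 r12 r13; move: s1 {evalP} => s1 r20 m1 r10 r11 r12 r13.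
have -> : ((f == i) + (f == j) != 0) = (f == i) || (f == j) by case: (f == i);
  case: (f == j).
have g1 (k : 'I_4) : mem s (5 * (4 * t + f) + 1 + 1 + k) = gluing T t f k.
  rewrite ins ?encode_gluing //.
  by move: (ltn_ord t) (ltn_ord f) (ltn_ord k); lia.
case: ifP => _; rewrite run_asg eval_slotE /= ?eval_gluingE /= r10 ?r11 ?r12 ?r13 ?m1
  /upd /=; split=> //.
rewrite (_ : _ + (t + t + (t + t) + f) + 1 = 5 * (4 * t + f) + 1); last by lia.
rewrite !g1 ins ?encode_neighbour //.
by move: (ltn_ord t) (ltn_ord f); lia.
Qed.

Definition glued_slots (m : nat -> nat) (u : slot n) (f : 'I_4) : Prop :=
  lab m (slot_index u) = lab m (slot_index (partner T u f)).

Lemma partial_labels_set_reg s x v : 5 <= x -> partial_labels s ->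
  partial_labels (set_reg s x v).
Proof. by move=> x5 [rs ins lbl]; split=> //; apply: regs_ok_set_reg. Qed.

Lemma glue_slots_spec s : partial_labels s ->
  partial_labels (run glue_slots s) /\
  (forall u f, glued_slots (mem (run glue_slots s)) u f).
Proof.
move=> Js; have leR m : coarser m m by [].
have leT m1 m2 m3 : coarser m1 m2 -> coarser m2 m3 -> coarser m1 m3.
  by move=> h1 h2 u v /h1 /h2.
have reg1 s1 : partial_labels s1 -> reg s1 1 = n by case; case.
have reg2 s1 : partial_labels s1 -> reg s1 2 = 4 by case; case.
pose P (t f i j : nat) m := forall (u : slot n) (g : 'I_4),
  u.1.1 = t :> nat -> g = f :> nat -> u.1.2 = i :> nat -> u.2
    = j :> nat -> glued_slots m u g.
have Ple t f i j m m' : P t f i j m -> coarser m m' -> P t f i j m'.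
  by move=> Pm mm' u g ut gf ui uj; apply: mm'; apply: Pm.
have Jset x s1 v : 5 <= x -> partial_labels s1 -> partial_labels (set_reg s1 x v).
  exact: partial_labels_set_reg.
pose p1 := Then load_partner merge; pose p2 := For 13 2 p1; pose p3 := For 12 2 p2.
pose p4 := For 11 2 p3.
have H1 t f i j s1 : t < n -> f < 4 -> i < 4 -> j < 4 -> partial_labels s1 ->
    reg s1 10 = t -> reg s1 11 = f -> reg s1 12 = i -> reg s1 13 = j ->
    [/\ partial_labels (run p1 s1), coarser (mem s1) (mem (run p1 s1))
      & P t f i j (mem (run p1 s1))].
  move=> tn f4 i4 j4 J1 rt rf ri rj.
  have [m2 r20 r21] := @load_partner_spec s1 (Ordinal tn) (Ordinal f4) (Ordinal i4)
    (Ordinal j4) J1 rt rf ri rj.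
  have J2 : partial_labels (run load_partner s1).
    by case: J1 => rs ins lbl; split; [exact: regs_ok_run | rewrite m2 | rewrite m2].
  have [|J3 le3 P3] := merge_spec J2 r20 r21; first by rewrite slot_cell_partner.
  rewrite m2 in le3; rewrite /p1 run_then; split; [exact: J3 | exact: le3 | ].
  move: (mem (run merge _)) P3 => m P3.
  move=> [[t' i'] j'] g /= ut gf ui uj.
  have -> : t' = Ordinal tn by apply: val_inj.
  have -> : i' = Ordinal i4 by apply: val_inj.
  have -> : j' = Ordinal j4 by apply: val_inj.
  have -> : g = Ordinal f4 by apply: val_inj.
  exact: P3.
have H2 t f i s1 : t < n -> f < 4 -> i < 4 -> partial_labels s1 ->
    reg s1 10 = t -> reg s1 11 = f -> reg s1 12 = i ->
    [/\ partial_labels (run p2 s1), coarser (mem s1) (mem (run p2 s1))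
      & forall j, j < 4 -> P t f i j (mem (run p2 s1))].
  move=> tn f4 i4 J1 rt rf ri; rewrite -(reg2 _ J1).
  apply: (run_establish (fun s v => @Jset 13 s v isT) leR leT _ _ J1).
  - by move=> j m m' Pm mm'; apply: Ple mm'.
  by move=> s2 j; rewrite (reg2 _ J1) => j4 rs rj J2; apply: H1 => //; rewrite rs.
have H3 t f s1 : t < n -> f < 4 -> partial_labels s1 -> reg s1 10 = t -> reg s1 11 = f ->
    [/\ partial_labels (run p3 s1), coarser (mem s1) (mem (run p3 s1))
      & forall i, i < 4 -> forall j, j < 4 -> P t f i j (mem (run p3 s1))].
  move=> tn f4 J1 rt rf; rewrite -{1}(reg2 _ J1).
  apply: (run_establish (P := fun i m => forall j, j < 4 -> P t f i j m)
    (fun s v => @Jset 12 s v isT) leR leT _ _ J1).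
  - by move=> i m m' Pm mm' j j4; apply: Ple mm'; apply: Pm.
  by move=> s2 i; rewrite (reg2 _ J1) => i4 rs ri J2; apply: H2 => //; rewrite rs.
have H4 t s1 : t < n -> partial_labels s1 -> reg s1 10 = t ->
    [/\ partial_labels (run p4 s1), coarser (mem s1) (mem (run p4 s1))
      & forall f, f < 4 -> forall i, i < 4 -> forall j,
        j < 4 -> P t f i j (mem (run p4 s1))].
  move=> tn J1 rt; rewrite -{1}(reg2 _ J1).
  apply: (run_establish (P := fun f m => forall i, i < 4 -> forall j,
    j < 4 -> P t f i j m) (fun s v => @Jset 11 s v isT) leR leT _ _ J1).
  - by move=> f m m' Pm mm' i i4 j j4; apply: Ple mm'; apply: Pm.
  by move=> s2 f; rewrite (reg2 _ J1) => f4 rs rf J2; apply: H3 => //; rewrite rs.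
have [|||J5 _ P5] := @run_establish partial_labels coarser
    (fun t m => forall f, f < 4 -> forall i, i < 4 -> forall j, j < 4 -> P t f i j m)
    10 1 p4 s (fun s1 v => @Jset 10 s1 v isT) leR leT.
- by move=> t m m' Pm mm' f f4 i i4 j j4; apply: Ple mm'; apply: Pm.
- by move=> s1 t; rewrite (reg1 _ Js) => tn rs rt J1; apply: H4.
- by [].
split=> // -[[t i] j] f; rewrite (reg1 _ Js) in P5.
exact: (P5 t (ltn_ord t) f (ltn_ord f) i (ltn_ord i) j (ltn_ord j) (t, i, j) f).
Qed.

Definition cell_labels (m : nat -> nat) (rep : slot n -> slot n) : Prop :=
  [/\ labelled m rep, labelling rep &
     forall u v, slot_cell T u = slot_cell T v -> rep u = rep v].

Lemma cell_labels_spec s : partial_labels s ->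
  exists2 rep, cell_labels (mem (run glue_slots s)) rep
    & regs_ok (run glue_slots s) /\ input_ok (mem (run glue_slots s)).
Proof.
case/glue_slots_spec => -[rs ins [rep repE repP]] glued; exists rep => //.
split=> //; apply: slot_cell_ind => u f; apply: slot_index_inj.
by rewrite -!repE; apply/esym/glued.
Qed.

End Layout.

(** * Computation of a spanning set of cocycles *)
Section InitialRows.
Local Open Scope nat_scope.
Variables (n : nat) (T : triangulation n) (rep : slot n -> slot n).
Hypothesis rep_labelling : labelling T rep.
Hypothesis rep_cell : forall u v, slot_cell T u = slot_cell T v -> rep u = rep v.
Local Notation bits := {ffun slot n -> bool}.
Local Notation index := 'I_(16 * n).

Definition slot_ord (u : slot n) : index := Ordinal (slot_index_lt u).

Lemma slot_ord_bij : bijective slot_ord.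
Proof.
apply: inj_card_bij; first by move=> u v /(congr1 val) /= /slot_index_inj.
by rewrite !card_prod !card_ord; lia.
Qed.

Lemma sum_slots (F : nat -> nat) : \sum_(a < 16 * n) F a
  = \sum_(u : slot n) F (slot_index u).
Proof. by rewrite (reindex slot_ord) //=; apply/onW_bij/slot_ord_bij. Qed.

Definition representative : {pred slot n} := [pred u | rep u == u].

Lemma representative_inj u v : u \in representative -> v \in representative ->
  slot_cell T u = slot_cell T v -> u = v.
Proof. by rewrite !inE => /eqP <- /eqP <-; rewrite !(proj2 rep_labelling) => /rep_cell. Qed.

Lemma representative_onto u :
  exists2 v, v \in representative & slot_cell T v = slot_cell T u.
Proof.
exists (rep u); first by rewrite inE (proj1 rep_labelling).
exact: (proj2 rep_labelling).
Qed.

(** The matrix starts after the labels, and its rows have length 16 n. *)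
Definition entry (m : nat -> nat) (a b : nat) : nat := m (36 * n + 1 + a * (16 * n) + b).

Definition represents (m : nat -> nat) (R : index -> bits) : Prop :=
  forall (a : index) (u : slot n), entry m a (slot_index u) = R a u.

Definition rows (m : nat -> nat) : index -> bits :=
  fun a => [ffun u => entry m a (slot_index u) != 0].

Lemma rows_represents m R : represents m R -> rows m = R.
Proof.
move=> mR; apply/funext => a; apply/ffunP => u.
by rewrite ffunE mR; case: (R a u).
Qed.

Definition row_base (a : nat) : nat := 36 * n + 1 + a * (16 * n).

Lemma row_base_in a a' b : b < 16 * n ->
  (row_base a <= row_base a' + b < row_base a + 16 * n) = (a == a').
Proof.
move=> bn; rewrite /row_base; case: (ltngtP a a') => [aa|aa|->]; last by lia.
- have : a.+1 * (16 * n) <= a' * (16 * n) by rewrite leq_mul2r aa orbT.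
  by rewrite mulSn; move: (a * _) (a' * _) => p p'; lia.
- have : a'.+1 * (16 * n) <= a * (16 * n) by rewrite leq_mul2r aa orbT.
  by rewrite mulSn; move: (a * _) (a' * _) => p p'; lia.
Qed.

Lemma labelled_low m m' : (forall a, a < 36 * n + 1 -> m' a = m a) ->
  labelled m rep -> labelled m' rep.
Proof.
by move=> mm' mr u; rewrite -mr /lab mm' //; have := slot_index_lt u; lia.
Qed.

Lemma write_row m m' (a0 : nat) (F : nat -> nat) (x : bits) :
    (forall a, m' a = if row_base a0 <= a < row_base a0 + 16 * n
                      then F (a - row_base a0) else m a) ->
    (forall u, F (slot_index u) = x u) ->
  (forall a (u : slot n), entry m' a (slot_index u) =
     if a0 == a then nat_of_bool (x u) else entry m a (slot_index u))
    /\ (forall a, a < 36 * n + 1 -> m' a = m a).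
Proof.
move=> m'E Fx; split=> [a u|a an]; last by rewrite m'E ifF //; rewrite /row_base; lia.
rewrite /entry -/(row_base a) m'E row_base_in ?slot_index_lt //.
by case: eqP => [<-|//]; rewrite addKn Fx.
Qed.

Lemma eval_bitE s e1 e2 a : regs_ok n s -> eval s e1 = a * (16 * n) ->
  eval s (bitE e1 e2) = entry (mem s) a (eval s e2).
Proof. by case=> _ _ _ _ r4 E; rewrite /bitE /= r4 E. Qed.

(** The indicator function of the class with label a. *)
Definition unit_row (a : index) : bits := [ffun u => slot_index (rep u) == a].

Lemma combination_unit c u : combination unit_row c u = c (slot_ord (rep u)).
Proof.
rewrite /combination sum_ffunE (bigD1 (slot_ord (rep u))) //= big1 => [|a].
  by case: (c _); rewrite ?ffunE /= ?eqxx.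
move=> au; case: (c a); rewrite ffunE //=.
by apply: contraNF au => /eqP ua; apply/eqP/val_inj.
Qed.

Definition spread (A : {set slot n}) : bits := [ffun u => rep u \in A].

(** The combinations of the indicator functions correspond to the sets of
    representatives, which yields both the span and its cardinality. *)
Lemma span_unit :
  span unit_row = spread @: powerset [set u | u \in representative].
Proof.
have ordE u v : (slot_ord u == slot_ord v) = (u == v).
  by rewrite (bij_eq slot_ord_bij).
apply/setP => x; apply/imsetP/imsetP => [[c _ ->] | [A _ ->]].
  exists [set u | (u \in representative) && c (slot_ord u)].
    by rewrite powersetE; apply/fintype.subsetP => u; rewrite !inE => /andP [].
  apply/ffunP => u; rewrite combination_unit ffunE !inE (proj1 rep_labelling).
  by rewrite eqxx.
exists [ffun a => [exists u in A, slot_ord u == a]] => //.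
apply/ffunP => u; rewrite combination_unit !ffunE.
apply/idP/existsP => [uA|[v /andP [vA]]]; first by exists (rep u); rewrite uA eqxx.
by rewrite ordE => /eqP <-.
Qed.

Lemma card_span_unit : #|span unit_row| = 2 ^ #|representative|.
Proof.
rewrite span_unit card_in_imset ?card_powerset ?cardsE // => A B.
rewrite !powersetE => /fintype.subsetP AE /fintype.subsetP BE E; apply/setP => u.
have H (D : {set slot n}) : {subset D <= [set u | u \in representative]} ->
  u \notin representative -> (u \in D) = false.
  by move=> DE uE; apply: contraNF uE => /DE; rewrite inE.
case: (boolP (u \in representative)) => [|uE]; last by rewrite !H.
by move/ffunP/(_ u): E; rewrite !ffunE inE => /[swap] /eqP ->.
Qed.

Lemma constant_span_unit x : (x \in span unit_row) = constant_on_cells T x.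
Proof.
apply/idP/constant_on_cellsP => [/imsetP [c _ ->] u v uv|xT].
  by rewrite !combination_unit (rep_cell uv).
apply/imsetP; exists [ffun a => [exists u, (slot_ord u == a) && x u]] => //.
apply/ffunP => u; rewrite combination_unit ffunE; apply/idP/existsP => [xu|[v]].
  by exists (rep u); rewrite eqxx (xT _ u) ?(proj2 rep_labelling).
rewrite (bij_eq slot_ord_bij) => /andP [/eqP ->].
by rewrite (xT _ u) ?(proj2 rep_labelling).
Qed.

Definition rows_ok (s : state) : Prop := regs_ok n s /\ labelled (mem s) rep.

Lemma rows_ok_frame s s' : (forall r, r < 5 -> reg s' r = reg s r) ->
    (forall a, a < 36 * n + 1 -> mem s' a = mem s a) ->
  rows_ok s -> rows_ok s'.
Proof.
by move=> rs ms [rok lbl]; split; [exact: regs_ok_frame rok | exact: labelled_low lbl].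
Qed.

Lemma write_row_loop s rp e (a : nat) (x : bits) : regs_ok n s ->
    rp != 16 -> reg s rp = a * (16 * n) ->
    (forall s1 (u : slot n), (forall r, r != 16 -> reg s1 r = reg s r) ->
       reg s1 16 = slot_index u ->
       (forall b, ~~ (row_base a <= b < row_base a + slot_index u) -> mem s1 b = mem s b) ->
       eval s1 e = x u) ->
  let s' := run (For 16 0 (Sto (Plus (Plus (Var 4) (Var rp)) (Var 16)) e)) s in
  (forall a' (u : slot n), entry (mem s') a' (slot_index u) =
     if a == a' then nat_of_bool (x u) else entry (mem s) a' (slot_index u))
    /\ (forall b, b < 36 * n + 1 -> mem s' b = mem s b).
Proof.
move=> rs rp16 rrp ex s'; have [r0 _ _ _ r4] := rs.
pose F b := nat_of_bool [exists u, (slot_index u == b) && x u].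
have Fx u : F (slot_index u) = x u.
  congr nat_of_bool; apply/existsP/idP => [[v /andP [/eqP /slot_index_inj ->]] //|xu].
  by exists u; rewrite eqxx.
have mE b : mem s' b =
    if row_base a <= b < row_base a + reg s 0 then F (b - row_base a) else mem s b.
  apply: (run_sweep (s := s) (F := F)) => // s1 k kb rs1 rk ms c.
  rewrite r0 in kb; have [u uk] := slot_index_onto kb.
  rewrite run_sto -uk Fx -(ex s1 u) ?uk //; last by move=> d /negPf nd; rewrite ms nd.
  by rewrite /= rk !rs1 // r4 rrp.
by rewrite r0 in mE; apply: (write_row mE).
Qed.

Lemma init_row_spec s (a : index) : rows_ok s ->
    reg s 15 = a -> reg s 26 = a * (16 * n) ->
  (forall a' (u : slot n), entry (mem (run init_row s)) a' (slot_index u) =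
     if val a == a' then nat_of_bool (unit_row a u) else entry (mem s) a' (slot_index u))
    /\ (forall b, b < 36 * n + 1 -> mem (run init_row s) b = mem s b).
Proof.
move=> [rs lbl] r15 r26; apply: write_row_loop => // s1 u rs1 r16 ms.
have rs1' : regs_ok n s1 by apply: regs_ok_frame rs => r r5;
  rewrite rs1 // ltn_eqF // (leq_trans r5).
rewrite eval_eqE (eval_labE _ rs1') /= r16 rs1 // r15 ffunE -lbl.
by rewrite /lab ms // /row_base; have := slot_index_lt u; lia.
Qed.

(** No cocycle has been lost so far, and the dimension is known. *)
Definition solution_rows (s : state) : Prop :=
  rows_ok s /\ exists2 R, represents (mem s) R &
    cocycles T \subset span R /\ #|span R| = 2 ^ reg s 6.

Lemma init_rows_spec s : rows_ok s ->
  solution_rows (run init_rows s) /\ rows (mem (run init_rows s)) = unit_row.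
Proof.
move=> sok.
pose s0 := set_reg (set_reg s 6 0) 26 0.
have -> : run init_rows s = run (For 15 0
  (Then (Asg 6 (Plus (Var 6) (eqE (labE (Var 15)) (Var 15))))
              (Then init_row next_row))) s0 by [].
have s0ok : rows_ok s0.
  apply: rows_ok_frame sok => // r r5.
  by rewrite /= /upd !ltn_eqF // (leq_trans r5).
have r00 : reg s0 0 = 16 * n by case: s0ok => [[]].
have card_rep : #|representative| = \sum_(a < 16 * n) (lab n (mem s) a == a).
  rewrite (sum_slots (fun a => lab n (mem s) a == a)) -sum1_card big_mkcond.
  apply: eq_bigr => u _ /=.
  by rewrite (proj2 sok) inE (inj_eq (@slot_index_inj n)); case: eqP.
pose Inv k s1 := [/\ rows_ok s1, reg s1 26 = k * (16 * n),
  reg s1 6 = \sum_(0 <= a < k) (lab n (mem s) a == a),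
  forall a, a < 36 * n + 1 -> mem s1 a = mem s a &
  forall (a : index) u, a < k -> entry (mem s1) a (slot_index u) = unit_row a u].
apply: (run_for (Inv := Inv) (Q := fun s' => solution_rows s' /\
  rows (mem s') = unit_row)).
- by split=> //; rewrite big_geq.
- move=> k s1; rewrite r00 => kN [sok1 r26 r6 low1 ent1].
  rewrite run_then run_asg run_then.
  set s2 := set_reg _ 6 _.
  have r6' : reg s2 6 = \sum_(0 <= a < k.+1) (lab n (mem s) a == a).
    rewrite big_nat_recr // -r6.
    have -> : reg s2 6 = reg s1 6 + eval (set_reg s1 15 k) (eqE (labE (Var 15)) (Var 15)).
      by [].
    have rs1 : regs_ok n (set_reg s1 15 k) by apply: regs_ok_set_reg => //; case: sok1.
    rewrite eval_eqE (eval_labE _ rs1) /= /upd eqxx /lab /= low1 //.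
    by lia.
  have sok2 : rows_ok s2.
    apply: rows_ok_frame sok1 => // r r5.
    by rewrite /= /upd !ltn_eqF // (leq_trans r5).
  have [||ent3 low3] := @init_row_spec s2 (Ordinal kN) sok2.
  + by [].
  + by rewrite -r26.
  have f3 r : r != 16 -> reg (run init_row s2) r = reg s2 r.
    by move=> r16; rewrite run_frame // inE.
  move: (run init_row s2) ent3 low3 f3 => s3 ent3 low3 f3.
  rewrite /next_row run_asg; split.
  + apply: rows_ok_frame sok2 => [r r5|//].
    by rewrite /= /upd ltn_eqF ?(leq_trans r5) // f3 // ltn_eqF // (leq_trans r5).
  + rewrite /= /upd eqxx !f3 // mulSn addnC [reg s2 26]r26 [reg s2 0](_ : _ = 16 * n) //.
    by case: sok2 => [[]].
  + by rewrite -r6' -(f3 6).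
  + by move=> a an; rewrite /= low3 // low1.
  + move=> a u; rewrite ltnS leq_eqVlt => /orP [/eqP ak|ak].
      rewrite [mem _]/= ent3 /= ak eqxx; congr (nat_of_bool (unit_row _ u)).
      exact: val_inj.
    by rewrite [mem _]/= ent3 /= ifF; [exact: ent1 | rewrite gtn_eqF].
- move=> s1 [sok1 r26 r6 low1 ent1]; rewrite r00 in ent1 r6.
  have rep1 : represents (mem (set_reg s1 15 (reg s0 0))) unit_row.
    by move=> a u; apply: ent1.
  split; last exact: rows_represents.
  split.
    apply: rows_ok_frame sok1 => // r r5.
    by rewrite /= /upd ltn_eqF // (leq_trans r5).
  exists unit_row => //; split; last by rewrite card_span_unit card_rep [reg _ 6]r6
    big_mkord.
  apply/fintype.subsetP => x; rewrite inE constant_span_unit => /andP [//].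
Qed.

End InitialRows.

Section Constraints.
Local Open Scope nat_scope.
Variables (n : nat) (T : triangulation n) (rep : slot n -> slot n).
Hypothesis rep_labelling : labelling T rep.
Hypothesis rep_cell : forall u v, slot_cell T u = slot_cell T v -> rep u = rep v.
Local Notation bits := {ffun slot n -> bool}.
Local Notation index := 'I_(16 * n).

Lemma rows_ok_set_reg s x v : 5 <= x -> rows_ok rep s -> rows_ok rep (set_reg s x v).
Proof. by move=> x5 [rs lbl]; split=> //; apply: regs_ok_set_reg. Qed.

Lemma rows_ok_run p s : all (leq 5) (assigned p) ->
    (forall a, a < 36 * n + 1 -> mem (run p s) a = mem s a) ->
  rows_ok rep s -> rows_ok rep (run p s).
Proof.
by move=> p5 ms [rs lbl]; split; [exact: regs_ok_run | exact: labelled_low lbl].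
Qed.

Lemma count_vertices_spec s : rows_ok rep s ->
  mem (run count_vertices s) = mem s /\
  reg (run count_vertices s) 5 = #|[set u in representative rep | u.1.2 == u.2]|.
Proof.
move=> sok; pose g t i := let a := 16 * t + 4 * i + i in nat_of_bool (lab n (mem s) a == a).
have gE : #|[set u in representative rep | u.1.2 == u.2]| =
    \sum_(0 <= t < n) \sum_(0 <= i < 4) g t i.
  rewrite big_mkord -sum1_card big_mkcond /=.
  rewrite (eq_bigr (fun u : slot n => nat_of_bool ((rep u == u) && (u.1.2 == u.2))));
    last first.
    by move=> u _; rewrite !inE; case: ifP.
  rewrite (eq_bigr (fun u : slot n => (fun (p : 'I_n * 'I_4) (j : 'I_4) =>
     nat_of_bool ((rep (p, j) == (p, j)) && (p.2 == j))) u.1 u.2)); last by case.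
  rewrite -(pair_bigA _ (fun (p : 'I_n * 'I_4) (j : 'I_4) =>
     nat_of_bool ((rep (p, j) == (p, j)) && (p.2 == j)))) /=.
  rewrite (eq_bigr (fun p : 'I_n * 'I_4 => (fun (t : 'I_n) (i : 'I_4) => g t i) p.1
    p.2)); last first.
    move=> [t i] _; rewrite (bigD1 i) //= eqxx andbT big1 ?addn0 => [|j /negPf ji].
      have := proj2 sok (t, i, i); rewrite /slot_index /= => lE.
      by rewrite /g /= lE -(inj_eq (@slot_index_inj n)).
    by rewrite [i == j]eq_sym ji andbF.
  rewrite -(pair_bigA _ (fun (t : 'I_n) (i : 'I_4) => g t i)) /=.
  by apply: eq_bigr => t _; rewrite big_mkord.
pose body := let u := slotE (Var 10) (Var 12) (Var 12) in Asg 5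
  (Plus (Var 5) (eqE (labE u) u)).
have inner s1 t : rows_ok rep s1 -> mem s1 = mem s -> reg s1 10 = t ->
    mem (run (For 12 2 body) s1) = mem s1 /\
    reg (run (For 12 2 body) s1) 5 = reg s1 5 + \sum_(0 <= i < 4) g t i.
  move=> sok1 m1 r10; have r2 : reg s1 2 = 4 by case: sok1 => [[]].
  rewrite -[X in \sum_(0 <= i < X) _]r2.
  apply: (run_counter (Q := fun k v => v = reg s1 5 + \sum_(0 <= i < k) g t i)) => //.
    by rewrite big_geq // addn0.
  move=> s2 k k4 rs2 r12 m2 r5; split=> //.
  have ok2 : regs_ok n s2.
    by case: sok1 => ok1 _; apply: regs_ok_frame ok1 => r r5';
      rewrite rs2 // !inE !ltn_eqF // (leq_trans r5').
  have -> : reg (run body s2) 5 = reg s2 5 + eval s2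
    (eqE (labE (slotE (Var 10) (Var 12) (Var 12))) (slotE (Var 10) (Var 12) (Var 12))).
    by [].
  rewrite eval_eqE (eval_labE _ ok2) eval_slotE /= r5 r12 rs2 // r10 m2 m1.
  by rewrite big_nat_recr //= addnA.
have sok0 : rows_ok rep (set_reg s 5 0) by apply: rows_ok_set_reg.
have r1 : reg (set_reg s 5 0) 1 = n by case: sok0 => [[]].
rewrite gE -[X in \sum_(0 <= t < X) _]r1 /count_vertices run_then.
apply: (run_counter (s := set_reg s 5 0)
  (Q := fun k v => v = \sum_(0 <= t < k) \sum_(0 <= i < 4) g t i)) => //.
  by rewrite big_geq.
move=> s1 k kn rs1 r10 m1 r5.
have sok1 : rows_ok rep s1.
  apply: rows_ok_frame sok0 => [r r5'|a _]; last by rewrite m1.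
  by rewrite rs1 // !inE !ltn_eqF // (leq_trans r5').
have [m2 r5'] := inner s1 k sok1 m1 r10; split=> //.
by rewrite [LHS]r5' r5 (big_nat_recr k).
Qed.

Section OneConstraint.
Variables (t : 'I_n) (i j k : 'I_4).
Let l := @cocycle_form n t i j k.

Lemma cocycle_form_additive : additive_form l.
Proof.
move=> x y; rewrite /l /cocycle_form !ffunE.
by do 6![case: (fun_of_fin _ _)].
Qed.

Definition at_constraint (s : state) : Prop :=
  [/\ reg s 10 = t, reg s 11 = i, reg s 12 = j & reg s 13 = k].

(** The rows after the pass has dealt with the rows below a0, p being the pivot. *)
Definition swept (R : index -> bits) (p : index) (a0 : nat) (a : index) : bits :=
  if [&& a < a0, a != p & l (R a)] then (R a + R p)%R else R a.

Definition sweep_inv (s : state) (R : index -> bits) (a0 : nat) (s1 : state) : Prop :=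
  [/\ rows_ok rep s1, at_constraint s1, reg s1 6 = reg s 6, reg s1 26 = a0 * (16 * n) &
    [/\ reg s1 24 = 0, represents (mem s1) R & forall a : index, a < a0 -> ~~ l (R a)] \/
    exists p : index, [/\ p < a0, reg s1 24 = 1, reg s1 25 = p * (16 * n), l (R p)
      & (forall a : index, a < p -> ~~ l (R a)) /\ represents (mem s1) (swept R p a0)]].

Lemma eval_bitE_bit s e1 e2 R (a : index) (u : slot n) : rows_ok rep s ->
    represents (mem s) R -> eval s e1 = a * (16 * n) -> eval s e2 = slot_index u ->
  eval s (bitE e1 e2) = R a u.
Proof. by move=> [ok _] mR E1 E2; rewrite (eval_bitE _ ok E1) E2 mR. Qed.

Lemma represents_set (m m' : nat -> nat) (R : index -> bits) (p : index) (x : bits) :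
    (forall a' (u : slot n), entry n m' a' (slot_index u) =
       if val p == a' then nat_of_bool (x u) else entry n m a' (slot_index u)) ->
    represents m R ->
  represents m' (fun a => if a == p then x else R a).
Proof.
by move=> m'E mR a u; rewrite m'E mR -val_eqE eq_sym; case: ifP.
Qed.

Lemma sweep_row_spec s R (a : index) s1 : represents (mem s) R ->
  sweep_inv s R a s1 -> sweep_inv s R a.+1 (run sweep_row (set_reg s1 15 a)).
Proof.
move=> mR [ok1 [t1 i1 j1 k1] d1 r26 H].
set s2 := set_reg _ 15 _.
have ok2 : rows_ok rep s2 by apply: rows_ok_set_reg.
have [Rc mRc Rca] : exists2 Rc, represents (mem s1) Rc & Rc a = R a.
  case: H => [[_ mR1 _] | [p [pa _ _ _ [_ mR1]]]]; first by exists R.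
  by exists (swept R p a) => //; rewrite /swept ltnn.
rewrite /sweep_row run_then run_asg.
set e := xorE _ _.
have eE : eval s2 e = l (R a).
  rewrite /e -Rca /l /cocycle_form; apply: eval_xorE; [apply: eval_xorE | ];
    apply: eval_bitE_bit => //; by rewrite eval_slotE /= /upd /= ?t1 ?i1 ?j1 ?k1.
rewrite eE; set s3 := set_reg s2 27 _.
have ok3 : rows_ok rep s3 by apply: rows_ok_set_reg.
rewrite run_then /next_row run_asg run_ite.
have step s4 : rows_ok rep s4 -> at_constraint s4 -> reg s4 6 = reg s 6 ->
    reg s4 26 = a * (16 * n) ->
    ([/\ reg s4 24 = 0, represents (mem s4) R & forall b : index, b < a.+1 -> ~~ l (R b)] \/
    exists p : index, [/\ p < a.+1, reg s4 24 = 1, reg s4 25 = p * (16 * n), l (R p)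
      & (forall b : index, b < p -> ~~ l (R b)) /\ represents (mem s4) (swept R p a.+1)]) ->
    sweep_inv s R a.+1 (set_reg s4 26 (eval s4 (Plus (Var 26) (Var 0)))).
  move=> ok4 [t4 i4 j4 k4] d4 r26' H4; split=> //.
  have r40 : reg s4 0 = 16 * n by case: ok4 => [[]].
  by rewrite /= /upd eqxx r26' r40 [RHS]mulSn addnC.
have ltS (b : index) : (b < a.+1) = (b == a) || (b < a).
  by rewrite ltnS leq_eqVlt -val_eqE.
have below (b : index) : b < a.+1 -> b = a \/ b < a.
  by rewrite ltS => /orP [/eqP|]; auto.
have e27 : reg s3 27 = l (R a) by [].
have m3 : mem s3 = mem s1 by [].
have f3 r : r != 27 -> r != 15 -> reg s3 r = reg s1 r.
  by move=> /negPf r27 /negPf r15; rewrite /= /upd r27 r15.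
move: s3 ok3 e27 m3 f3 => s3 ok3 e27 m3 f3.
have cs3 : at_constraint s3 by split; rewrite f3.
rewrite [eval s3 (Var 27)]e27; case la: (l (R a)); last first.
  apply: step; rewrite ?m3 ?f3 //.
  case: H => [[f0 mR1 lR] | [p [pa f1 pp lp [lR mR1]]]]; [left | right].
    by split=> // b /below [-> | /lR //]; rewrite la.
  exists p; split=> //; first exact: ltnW.
  split=> // b u; rewrite mR1 /swept ltS.
  by case: (eqVneq b a) => [->|_] //=; rewrite la !andbF.
set s4 := (X in set_reg X 26 (eval X _)).
have E4 : s4 = if reg s3 24 != 0 then run add_pivot s3
    else set_reg (set_reg s3 24 1) 25 (reg s3 26) by [].
rewrite f3 // in E4; move: s4 E4 => s4 E4;
  case: H => [[f0 mR1 lR] | [p [pa f1 pp lp [lR mR1]]]].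
- rewrite f0 /= in E4; rewrite E4; apply: step; rewrite ?m3.
  + by do 2![apply: rows_ok_set_reg => //].
  + by case: cs3.
  + by rewrite -d1 -f3.
  + by rewrite -r26 -f3.
  right; exists a; split=> //; first by rewrite -r26 -f3.
  split=> // b u.
  rewrite mR1 /swept ltS.
  case: (eqVneq b a) => [->|_] //=.
  by case: ltnP => //= ba; rewrite (negPf (lR _ ba)).
- rewrite f1 /= in E4; rewrite E4.
  have pa' : p != a by rewrite -val_eqE ltn_eqF.
  have [||||mE low] := @write_row_loop n s3 26
    (xorE (bitE (Var 26) (Var 16)) (bitE (Var 25) (Var 16))) a (R a + R p)%R.
  + by case: ok3.
  + by [].
  + by rewrite f3.
  + move=> s5 u rs5 r16 ms5.
    have ok5 : regs_ok n s5.
      case: ok3 => ok3 _; apply: regs_ok_frame ok3 => r r5.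
      by rewrite rs5 // ltn_eqF // (leq_trans r5).
    have entE (c : index) : ~~ (row_base n a <= row_base n c + slot_index u < row_base
      n a + slot_index u) ->
        entry n (mem s5) c (slot_index u) = entry n (mem s1) c (slot_index u).
      by move=> nc; rewrite /entry ms5 ?m3.
    rewrite ffunE; apply: eval_xorE.
      rewrite (@eval_bitE n s5 (Var 26) (Var 16) a ok5); last by rewrite /= rs5 // f3.
      rewrite [eval s5 (Var 16)]r16 entE ?mRc ?Rca //.
      by rewrite ltnn andbF.
    rewrite (@eval_bitE n s5 (Var 25) (Var 16) p ok5); last by rewrite /= rs5 // f3.
    rewrite [eval s5 (Var 16)]r16 entE ?mR1 /swept ?eqxx ?andbF //.
    apply/negP => H; have := row_base_in a p (slot_index_lt u).
    rewrite val_eqE eq_sym (negPf pa').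
    by move: H; have := slot_index_lt u; lia.
  apply: step.
  + exact: rows_ok_run.
  + by case: cs3 => *; split; rewrite run_frame.
  + by rewrite run_frame // f3.
  + by rewrite run_frame // f3.
  rewrite m3 in mE; right; exists p; split; rewrite ?run_frame ?f3 //.
    exact: ltnW.
  split=> // b u; have := represents_set mE mR1; rewrite /add_pivot => ->.
  rewrite /swept ltS.
  by case: (eqVneq b a) => [->|_] //=; rewrite la eq_sym pa'.
Qed.

Lemma eliminate_spec s R : rows_ok rep s -> at_constraint s -> represents (mem s) R ->
  [/\ rows_ok rep (run eliminate s), at_constraint (run eliminate s) &
   exists2 R', represents (mem (run eliminate s)) R' &
    [/\ reg (run eliminate s) 6 = reg s 6, R' = R & forall a, ~~ l (R a)] \/
    exists p, [/\ l (R p), reg (run eliminate s) 6 = (reg s 6).-1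
      & forall a, R' a = if l (R a) then (R a + R p)%R else R a]].
Proof.
move=> ok cs mR; rewrite /eliminate !run_then !run_asg.
set s0 := set_reg _ 26 _.
have ok0 : rows_ok rep s0 by do 2![apply: rows_ok_set_reg => //].
have r0 : reg s0 0 = 16 * n by case: ok0 => [[]].
have : exists2 s1, run (For 15 0 sweep_row) s0 = set_reg s1 15 (16 * n) &
    sweep_inv s R (16 * n) s1.
  apply: (run_for (Inv := sweep_inv s R)
    (Q := fun s' => exists2 s1, s' = set_reg s1 15 (16 * n) &
    sweep_inv s R (16 * n) s1)).
  + by case: cs => *; split=> //; left; split.
  + move=> a s1; rewrite r0 => aN; exact: (@sweep_row_spec s R (Ordinal aN)).
  + by rewrite r0 => s1 inv; exists s1.
case=> s1 -> [ok1 [t1 i1 j1 k1] d1 r26 H].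
set s2 := set_reg s1 15 _.
have ok2 : rows_ok rep s2 by apply: rows_ok_set_reg.
have cs2 : at_constraint s2 by [].
set A := Then (Asg 6 _) _.
have E1 : run (Ite (Var 24) A Nop) s2 = if reg s1 24 != 0 then run A s2 else s2 by [].
rewrite {}E1; case: H => [[f0 mR1 lR] | [p [pa f1 pp lp [lR mR1]]]].
  have -> : (if reg s1 24 != 0 then run A s2 else s2) = s2 by rewrite f0.
  split=> //; exists R => //; left; split=> // a.
  exact: lR.
pose s3 := set_reg s2 6 ((reg s 6).-1).
have -> : (if reg s1 24 != 0 then run A s2 else s2) = run clear_pivot s3.
  by rewrite f1 /s3 -d1 -subn1.
have ok3 : rows_ok rep s3 by apply: rows_ok_set_reg.
have [||||mE low] := @write_row_loop n s3 25 (Cst 0) p 0%R.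
- by case: ok3.
- by [].
- exact: pp.
- by move=> s4 u _ _ _; rewrite ffunE.
split; [exact: rows_ok_run | by split; rewrite run_frame | ].
exists (fun a => if a == p then 0%R else swept R p (16 * n) a).
  exact: represents_set mE mR1.
right; exists p; split=> //.
  by rewrite run_frame.
move=> a; rewrite /swept ltn_ord /=.
by case: eqVneq => [->|] //=; rewrite lp bits_addxx.
Qed.

End OneConstraint.

Lemma solution_step s (t : 'I_n) (i j k : 'I_4) : solution_rows T rep s ->
    at_constraint t i j k s ->
  [/\ solution_rows T rep (run eliminate s),
     span (@rows n (mem (run eliminate s))) \subset span (@rows n (mem s)) &
     forall x, x \in span (@rows n (mem (run eliminate s))) -> ~~ cocycle_form t i j k x].
Proof.
move=> [ok [R mR [ZR cR]]] cs.
have [ok' _ [R' mR' H]] := eliminate_spec ok cs mR.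
have lD := cocycle_form_additive t i j k.
rewrite (rows_represents mR) (rows_represents mR').
case: H => [[d' RR lR] | [p [lp d' R'E]]].
  rewrite RR in mR' *; split=> //; last by move=> x; apply: form_span.
  by split=> //; exists R; rewrite // d'; split.
have spanE := span_eliminate lD lp R'E.
split; last by move=> x; rewrite spanE inE => /andP [].
  split=> //; exists R' => //; split.
    apply/fintype.subsetP => x xZ; rewrite spanE inE (fintype.subsetP ZR) //.
    by move: xZ; rewrite inE => /andP [_ /cocycleP]; apply.
  have := card_eliminate lD (row_in_span R p) lp (@spanD _ _ R).
  rewrite cR -spanE d'; case: (reg s 6) => [|d]; last by rewrite expnS mul2n => /double_inj.
  by move=> /(congr1 odd); rewrite odd_double.
by apply/fintype.subsetP => x; rewrite spanE inE => /andP [].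
Qed.

(** Imposing further conditions shrinks the span, so each condition still holds at
    the end; and the span contains all cocycles throughout. *)
Lemma eliminate_all_spec s : solution_rows T rep s ->
    @rows n (mem s) = unit_row rep ->
  let s' := run eliminate_all s in
  [/\ rows_ok rep s', span (@rows n (mem s')) = cocycles T,
      #|cocycles T| = 2 ^ reg s' 6 & exists R, @represents n (mem s') R].
Proof.
move=> sol0 rows0.
pose le (m m' : nat -> nat) := is_true (span (@rows n m') \subset span (@rows n m)).
have leR m : le m m by rewrite /le.
have leT m1 m2 m3 : le m1 m2 -> le m2 m3 -> le m1 m3.
  by move=> h1 h2; apply: fintype.subset_trans h2 h1.
pose J := solution_rows T rep.
have reg1 s1 : J s1 -> reg s1 1 = n by case; case; case.
have reg2 s1 : J s1 -> reg s1 2 = 4 by case; case; case.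
pose P (t i j k : nat) m := forall (t' : 'I_n) (i' j' k' : 'I_4),
  t' = t :> nat -> i' = i :> nat -> j' = j :> nat -> k' = k :> nat ->
  forall x, x \in span (@rows n m) -> ~~ cocycle_form t' i' j' k' x.
have Ple t i j k m m' : P t i j k m -> le m m' -> P t i j k m'.
  move=> Pm /fintype.subsetP mm' t' i' j' k' tt ii jj kk x /mm' xm.
  exact: (Pm t' i' j' k').
have Jset x s1 v : 7 <= x -> J s1 -> J (set_reg s1 x v).
  move=> x7 [ok [R mR HR]]; split; first by apply: rows_ok_set_reg;
    first exact: ltnW (ltnW x7).
  by exists R => //; rewrite /= /upd ltn_eqF.
pose p2 := For 13 2 eliminate; pose p3 := For 12 2 p2; pose p4 := For 11 2 p3.
have H1 t i j k s1 : t < n -> i < 4 -> j < 4 -> k < 4 -> J s1 ->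
    reg s1 10 = t -> reg s1 11 = i -> reg s1 12 = j -> reg s1 13 = k ->
    [/\ J (run eliminate s1), le (mem s1) (mem (run eliminate s1))
      & P t i j k (mem (run eliminate s1))].
  move=> tn i4 j4 k4 J1 rt ri rj rk.
  have [|J2 le2 P2] := @solution_step s1 (Ordinal tn) (Ordinal i4) (Ordinal j4)
    (Ordinal k4) J1.
    by split.
  split=> // t' i' j' k' tt ii jj kk x xin; move: (P2 x xin).
  by congr (~~ cocycle_form _ _ _ _ _); apply: val_inj.
have H2 t i j s1 : t < n -> i < 4 -> j < 4 -> J s1 ->
    reg s1 10 = t -> reg s1 11 = i -> reg s1 12 = j ->
    [/\ J (run p2 s1), le (mem s1) (mem (run p2 s1))
      & forall k, k < 4 -> P t i j k (mem (run p2 s1))].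
  move=> tn i4 j4 J1 rt ri rj; rewrite -(reg2 _ J1).
  apply: (run_establish (fun s v => @Jset 13 s v isT) leR leT _ _ J1).
  - by move=> k m m' Pm mm'; apply: Ple mm'.
  by move=> s2 k; rewrite (reg2 _ J1) => k4 rs rk J2; apply: H1 => //; rewrite rs.
have H3 t i s1 : t < n -> i < 4 -> J s1 -> reg s1 10 = t -> reg s1 11 = i ->
    [/\ J (run p3 s1), le (mem s1) (mem (run p3 s1))
      & forall j, j < 4 -> forall k, k < 4 -> P t i j k (mem (run p3 s1))].
  move=> tn i4 J1 rt ri; rewrite -{1}(reg2 _ J1).
  apply: (run_establish (P := fun j m => forall k, k < 4 -> P t i j k m)
    (fun s v => @Jset 12 s v isT) leR leT _ _ J1).
  - by move=> j m m' Pm mm' k k4; apply: Ple mm'; apply: Pm.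
  by move=> s2 j; rewrite (reg2 _ J1) => j4 rs rj J2; apply: H2 => //; rewrite rs.
have H4 t s1 : t < n -> J s1 -> reg s1 10 = t ->
    [/\ J (run p4 s1), le (mem s1) (mem (run p4 s1))
      & forall i, i < 4 -> forall j, j < 4 -> forall k,
        k < 4 -> P t i j k (mem (run p4 s1))].
  move=> tn J1 rt; rewrite -{1}(reg2 _ J1).
  apply: (run_establish (P := fun i m => forall j, j < 4 -> forall k, k < 4 -> P t i j k m)
    (fun s v => @Jset 11 s v isT) leR leT _ _ J1).
  - by move=> i m m' Pm mm' j j4 k k4; apply: Ple mm'; apply: Pm.
  by move=> s2 i; rewrite (reg2 _ J1) => i4 rs ri J2; apply: H3 => //; rewrite rs.
have [|||J5 le5 P5] := @run_establish J le
    (fun t m => forall i, i < 4 -> forall j, j < 4 -> forall k, k < 4 -> P t i j k m)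
    10 1 p4 s (fun s1 v => @Jset 10 s1 v isT) leR leT.
- by move=> t m m' Pm mm' i i4 j j4 k k4; apply: Ple mm'; apply: Pm.
- by move=> s1 t; rewrite (reg1 _ sol0) => tn rs rt J1; apply: H4.
- exact: sol0.
rewrite (reg1 _ sol0) in P5; case: J5 => [ok [R mR [ZR cR]]] s'.
have spanE : span (@rows n (mem s')) = cocycles T.
  apply/eqP; rewrite finset.eqEsubset (rows_represents mR) ZR andbT -(rows_represents mR).
  apply/fintype.subsetP => x xin; rewrite inE; apply/andP; split.
    by rewrite -(constant_span_unit rep_labelling rep_cell) -rows0;
      apply: (fintype.subsetP le5).
  apply/cocycleP => t i j k.
  exact: (P5 t (ltn_ord t) i (ltn_ord i) j (ltn_ord j) k (ltn_ord k) t i j k).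
split=> //; last by exists R.
by rewrite -spanE -cR (rows_represents mR).
Qed.

End Constraints.

(** * Parity check and output *)
Section Check.
Local Open Scope nat_scope.
Variables (n : nat) (T : triangulation n) (rep : slot n -> slot n).
Local Notation bits := {ffun slot n -> bool}.
Local Notation index := 'I_(16 * n).

Lemma nonzero_edges_le4 (x : bits) t : x \in cocycles T -> nonzero_edges x t <= 4.
Proof.
by move=> xZ; rewrite (nonzero_edges_label _ xZ) /=; do 3![case: (label _ _ _)].
Qed.

Lemma tet_edges_spec s (a : index) (x : bits) (t : 'I_n) : regs_ok n s ->
    reg s 26 = a * (16 * n) -> reg s 10 = t ->
    (forall u, entry n (mem s) a (slot_index u) = x u) ->
  eval s tet_edgesE = nonzero_edges x t.
Proof.
move=> ok r26 r10 ent.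
have E i j : i < 4 -> j < 4 ->
    eval s (bitE (Var 26) (slotE (Var 10) (Cst i) (Cst j))) = edge_bit x t i j.
  move=> i4 j4; rewrite (@eval_bitE n s (Var 26) _ a ok r26) eval_slotE
    [eval s (Var 10)]r10.
  by rewrite -ent /slot_index /= !inordK.
by rewrite /tet_edgesE !eval_plus !E.
Qed.

Lemma check_row_spec s (a : index) (x : bits) : rows_ok rep s ->
    reg s 26 = a * (16 * n) -> (forall u, entry n (mem s) a (slot_index u) = x u) ->
    x \in cocycles T ->
  [/\ mem (run check_row s) = mem s,
      reg (run check_row s) 26 = reg s 26 + reg s 0 &
      reg (run check_row s) 7 =
        if 4 %| surface_count (representative rep) x then reg s 7 else 1].
Proof.
move=> ok r26 ent xZ; rewrite /check_row run_then run_asg.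
set s0 := set_reg s 28 _.
have ok0 : rows_ok rep s0 by apply: rows_ok_set_reg.
pose g b := (lab n (mem s) b == b) * entry n (mem s) a b.
have ent01 b : b < 16 * n -> entry n (mem s) a b <= 1.
  by move=> bN; have [u <-] := slot_index_onto bN; rewrite ent; case: (x u).
have r00 : reg s0 0 = 16 * n by case: ok0 => [[]].
have [m1 e1] : mem (run count_edges s0) = mem s0 /\
    reg (run count_edges s0) 28 = (2 * \sum_(0 <= b < reg s0 0) g b) %% 4.
  apply: (run_counter (Q := fun k v => v = (2 * \sum_(0 <= b < k) g b) %% 4)) => //.
    by rewrite big_geq.
  move=> s1 k; rewrite r00 => kN rs1 r16 ms r28.
  have ok1 : regs_ok n s1.
    case: ok0 => ok0 _; apply: regs_ok_frame ok0 => r r5.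
    by rewrite rs1 // !inE !ltn_eqF // (leq_trans r5).
  have r26' : reg s1 26 = a * (16 * n) by rewrite rs1.
  rewrite run_ite eval_eqE (eval_labE _ ok1) [eval s1 (Var 16)]r16 ms.
  rewrite big_nat_recr // mulnDr -modnDml -r28 /g -/s0.
  rewrite [lab n (mem s0) k]/(lab n (mem s) k).
  set body := Asg 28 _; case: (lab n (mem s) k == k); last first.
    by split=> //; rewrite mul0n muln0 addn0 modn_small // r28 ltn_mod.
  have -> : (if nat_of_bool true != 0 then run body s1 else run Nop s1) =
    set_reg s1 28 (eval s1 (red4E (Plus (Var 28) (dbl (bitE (Var 26) (Var 16)))))) by [].
  split=> //; rewrite reg_set_reg.
  have bE : eval s1 (bitE (Var 26) (Var 16)) = entry n (mem s) a k.
    by rewrite (@eval_bitE n s1 (Var 26) _ a ok1 r26') [eval s1 (Var 16)]r16 ms.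
  have dE : eval s1 (Plus (Var 28) (dbl (bitE (Var 26) (Var 16)))) =
      reg s1 28 + 2 * entry n (mem s) a k by rewrite !eval_plus bE mul2n addnn.
  rewrite eval_red4E dE ?mul1n //.
  by have := ent01 k kN; have := ltn_pmod (2 * \sum_(0 <= b < k) g b) (isT : 0 < 4);
    rewrite r28; lia.
rewrite r00 in e1; set s1 := run count_edges s0 in m1 e1 *.
have f1 r : r < 28 -> r != 16 -> reg s1 r = reg s r.
  move=> r28 r16; rewrite run_frame; last by rewrite !inE negb_or r16 ltn_eqF.
  by rewrite /= /upd ltn_eqF.
have ok1 : rows_ok rep s1.
  apply: rows_ok_frame ok => [r r5|b _]; last by rewrite m1.
  by rewrite f1 // ?ltn_eqF // (leq_trans r5).
have r11 : reg s1 1 = n by case: ok1 => [[]].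
rewrite run_then -/s1.
pose h t := if insub t is Some t' then tet_count x t' else 0.
have [m2 e2] : mem (run count_tets s1) = mem s1 /\
    reg (run count_tets s1) 28 = (2 * (\sum_(0 <= b < 16 * n) g b) +
      \sum_(0 <= t < reg s1 1) h t) %% 4.
  apply: (run_counter (Q := fun k v => v =
     (2 * (\sum_(0 <= b < 16 * n) g b) + \sum_(0 <= t < k) h t) %% 4)) => //.
    by rewrite [X in _ = (_ + X) %% _]big_geq // addn0.
  move=> s2 k; rewrite r11 => kn rs2 r10 ms r28.
  have ok2 : regs_ok n s2.
    case: ok1 => ok1 _; apply: regs_ok_frame ok1 => r r5.
    by rewrite rs2 // !inE !ltn_eqF // (leq_trans r5).
  have mE : eval s2 tet_edgesE = nonzero_edges x (Ordinal kn).
    apply: (tet_edges_spec (a := a)) => //; first by rewrite rs2 // f1.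
    by move=> u; rewrite ms m1.
  have hk : h k = tet_count x (Ordinal kn) by rewrite /h insubT.
  rewrite !run_then !run_asg mE; set c := nonzero_edges _ _ in mE hk *.
  have c4 : c <= 4 by apply: nonzero_edges_le4.
  split=> //; rewrite [X in _ = (_ + X) %% _]big_nat_recr // hk /tet_count -/c.
  set s3 := set_reg s2 31 c.
  have e3 : eval s3 (red4E (Plus (Var 28) (Var 31))) = (reg s2 28 + c) %% 4.
    by rewrite eval_red4E // eval_plus [eval s3 (Var 28)]/= [eval s3 (Var 31)]/= /upd
      /= r28; lia.
  rewrite e3; set s4 := set_reg s3 28 _.
  rewrite reg_set_reg.
  have e4 : eval s4 (Plus (Var 28) (dbl (Minus (Cst 1) (Minus (Cst 1) (Var 31))))) =
    (reg s2 28 + c) %% 4 + (c != 0).*2.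
    rewrite eval_plus; congr (_ + _); rewrite /= /upd /=.
    by case: (c) => [|c'] //=; lia.
  rewrite eval_red4E e4; last by case: (c != 0); lia.
  rewrite r28 /=; move: (\sum_(0 <= b < _) g b) (\sum_(0 <= t < k) h t) => u v.
  by case: (c != 0); lia.
rewrite r11 in e2; set s2 := run count_tets s1 in m2 e2 *.
have f2 r : r < 28 -> r != 16 -> r != 10 -> reg s2 r = reg s r.
  move=> r28 r16 r10; rewrite run_frame ?f1 // !inE !negb_or r10 !ltn_eqF //.
    exact: leq_trans r28 _.
have e3 : reg s2 28 = surface_count (representative rep) x %% 4.
  rewrite e2 /surface_count mul2n big_mkord (sum_slots n g) big_mkord.
  congr ((_.*2 + _) %% 4); last first.
    by apply: eq_bigr => t _; rewrite /h valK.
  rewrite [RHS]big_mkcond; apply: eq_bigr => u _.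
  rewrite /g (proj2 ok) ent (inj_eq (@slot_index_inj n)) /= inE.
  by case: eqP => _; rewrite ?mul1n.
rewrite run_then -/s2 /next_row run_then run_asg run_ite [eval s2 (Var 28)]e3 /dvdn.
move: s2 m2 {e2} f2 {e3} => s2 m2 f2.
by case: eqP => _ /=; split; rewrite ?m2 ?m1 // /upd /= !f2.
Qed.

Lemma check_rows_spec s (R : index -> bits) : rows_ok rep s -> represents (mem s) R ->
    (forall a, R a \in cocycles T) -> reg s 7 = 0 ->
  mem (run check_rows s) = mem s /\
  reg (run check_rows s) 7 =
    [exists a, ~~ (4 %| surface_count (representative rep) (R a))].
Proof.
move=> ok mR RZ r7; rewrite /check_rows run_then run_asg.
set s0 := set_reg s 26 _.
have ok0 : rows_ok rep s0 by apply: rows_ok_set_reg.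
have r00 : reg s0 0 = 16 * n by case: ok0 => [[]].
pose bad k := [exists a : index, (a < k) && ~~
  (4 %| surface_count (representative rep) (R a))].
pose Inv k s1 := [/\ rows_ok rep s1, mem s1 = mem s, reg s1 26 = k * (16 * n)
  & reg s1 7 = bad k].
apply: (run_for (Inv := Inv) (Q := fun s' => mem s' = mem s /\
   reg s' 7 = [exists a, ~~ (4 %| surface_count (representative rep) (R a))])).
- split=> //; rewrite [LHS]r7 (_ : bad 0 = false) //.
  by apply/negbTE/existsP => -[a /andP []].
- move=> k s1; rewrite r00 => kN [ok1 ms r26 b1].
  set s2 := set_reg s1 15 k.
  have ok2 : rows_ok rep s2 by apply: rows_ok_set_reg.
  have [|m3 r26' r7'] := @check_row_spec s2 (Ordinal kN) (R (Ordinal kN)) ok2 r26 _ (RZ _).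
    by move=> u; rewrite [mem s2]ms mR.
  have ok3 : rows_ok rep (run check_row s2).
    by apply: rows_ok_run ok2 => // b _; rewrite m3.
  split=> //; first by rewrite m3.
  + rewrite r26' [reg s2 26]r26 [RHS]mulSn addnC; congr (_ + _).
    by case: ok2 => [[]].
  + rewrite r7' [reg s2 7]b1; case: ifP => d4.
      congr nat_of_bool; apply/existsP/existsP => [] [b /andP [bk Hb]]; exists b;
        rewrite Hb andbT.
        exact: leqW.
      move: bk; rewrite ltnS leq_eqVlt => /orP [/eqP bk|//].
      by move: Hb; have -> : b = Ordinal kN by [apply: val_inj]; rewrite d4.
    rewrite (_ : bad k.+1 = true) //; apply/existsP; exists (Ordinal kN).
    by rewrite ltnSn d4.
- move=> s1; rewrite r00 => -[_ ms _ b1]; split=> //; rewrite [LHS]b1.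
  by congr nat_of_bool; apply: eq_existsb => a; rewrite ltn_ord.
Qed.

Lemma power_spec s r e m : r != 16 -> reg s 0 = 16 * n -> m <= 16 * n ->
    r != 0 ->
    (forall s1, (forall x, x != r -> x != 16 -> reg s1 x = reg s x) -> eval s1 e = m) ->
  mem (run (power r e) s) = mem s /\ reg (run (power r e) s) r = 2 ^ m.
Proof.
move=> r16 r0 mN rr0 em; rewrite /power run_then run_asg; set s0 := set_reg s r _.
have r00 : reg s0 0 = 16 * n by rewrite /= /upd eq_sym (negPf rr0).
have -> : 2 ^ m = 2 ^ minn (reg s0 0) m by rewrite r00 (minn_idPr mN).
apply: (run_counter (Q := fun k v => v = 2 ^ minn k m)) => //.
  by rewrite min0n /= /upd eqxx.
move=> s1 k kN rs1 r16' ms rr; rewrite run_ite.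
have eE : eval s1 (Minus e (Var 16)) = m - k.
  rewrite [LHS]/= r16' (em s1) // => x xr x16.
  rewrite rs1; first by rewrite /= /upd (negPf xr).
  by rewrite /= !inE negb_or x16 xr.
rewrite eE; case: eqP => mk; split=> //.
  by rewrite [LHS]rr; congr (2 ^ _); lia.
rewrite run_asg [reg _ _]/= /upd eqxx rr addnn -mul2n -expnS.
by congr (2 ^ _); lia.
Qed.

End Check.

Section Main.
Local Open Scope nat_scope.
Variables (n : nat) (T : triangulation n).

(** The output for the value 0 if bad, and 2^D / 2^V otherwise: sign, numerator and
    denominator of the two coordinates, the second of which is 0. *)
Definition value_code (bad : bool) (D V : nat) : seq nat :=
  [:: 0; if bad then 0 else 2 ^ (D - V); if bad then 1 else 2 ^ (V - D); 0; 0; 1].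

Lemma output_spec s D V (bad : bool) : regs_ok n s -> D <= 16 * n -> V <= 16 * n ->
    reg s 6 = D -> reg s 5 = V -> reg s 7 = bad ->
  outputs (run output s) (value_code bad D V).
Proof.
move=> ok DN VN r6 r5 r7; rewrite /output run_then.
have r0 : reg s 0 = 16 * n by case: ok.
have [|||||_ p1] := @power_spec n s 29 (Minus (Var 6) (Var 5)) (D - V); rewrite ?r0 //.
- exact: leq_trans (leq_subr _ _) DN.
- by move=> s1 rs /=; rewrite !rs // r6 r5.
set s1 := run _ s in p1 *.
have f1 r : r != 29 -> r != 16 -> reg s1 r = reg s r.
  by move=> r29 r16; rewrite run_frame //= !inE !negb_or r29 r16.
move: s1 p1 f1 => s1 p1 f1; rewrite run_then.
have [|||||_ p2] := @power_spec n s1 30 (Minus (Var 5) (Var 6)) (V - D); rewrite ?f1 ?r0 //.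
- exact: leq_trans (leq_subr _ _) VN.
- by move=> s2 rs /=; rewrite !rs // !f1 // r6 r5.
set s2 := run _ s1 in p2 *.
have f2 r : r != 30 -> r != 16 -> reg s2 r = reg s1 r.
  by move=> r29 r16; rewrite run_frame //= !inE !negb_or r29 r16.
move: s2 p2 f2 => s2 p2 f2; rewrite run_then.
set s3 := run (Ite _ _ _) s2.
have [q1 q2] : reg s3 29 = (if bad then 0 else 2 ^ (D - V)) /\
    reg s3 30 = (if bad then 1 else 2 ^ (V - D)).
  rewrite /s3 run_ite [eval s2 (Var 7)]f2 // f1 // r7.
  by case: bad {r7} => /=; rewrite ?p2 ?f2.
move: s3 q1 q2 => s3 q1 q2.
rewrite !run_then !run_sto /= /upd => i; rewrite /value_code.
by case: i => [|[|[|[|[|[|]]]]]] //=; rewrite ?q1 ?q2.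
Qed.

Lemma main_prog_spec (check : bool) s : regs_ok n (run init_addresses s) ->
  input_ok T (mem s) ->
  exists (E : {pred slot n}) (D : nat) (bad : bool),
  [/\ (forall u v, u \in E -> v \in E -> slot_cell T u = slot_cell T v -> u = v)
        /\ (forall u, exists2 v, v \in E & slot_cell T v = slot_cell T u),
      #|cocycles T| = 2 ^ D,
      bad -> check /\ exists2 x, x \in cocycles T & ~~ (4 %| surface_count E x),
      ~~ bad -> orientable T -> ~~ check \/ forall x,
        x \in cocycles T -> 4 %| surface_count E x
    & outputs (run (main_prog check) s) (value_code bad D #|cells T 1|)].
Proof.
move=> ok0 in0; rewrite /main_prog run_then.
have in0' : input_ok T (mem (run init_addresses s)) by [].
move: (run init_addresses s) ok0 in0' => {in0} s0 ok0 in0.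
rewrite run_then; have := init_labels_spec ok0 in0.
move: (run init_labels s0) => {ok0 in0} s0 lab0.
rewrite run_then; have [rep [lbl lblg rep_cell] [ok0 _]] := cell_labels_spec lab0.
move: (run glue_slots s0) lbl ok0 => {lab0} s0 lbl ok0.
rewrite run_then; have sok0 : rows_ok rep s0 by [].
have [sol0 rows0] := init_rows_spec lblg rep_cell sok0.
move: (run init_rows s0) sol0 rows0 => {lbl ok0 sok0} s0 sol0 rows0.
rewrite run_then; have [mV rV] := count_vertices_spec (proj1 sol0).
have sol1 : solution_rows T rep (run count_vertices s0).
  case: sol0 => sok0 H; split; first by apply: rows_ok_run sok0 => // a _; rewrite mV.
  by rewrite mV run_frame.
rewrite -mV in rows0; move: (run count_vertices s0) rV sol1 rows0 =>
  {sol0 mV} s0 rV sol0 rows0.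
rewrite run_then; have [sok1 spanE cardZ [R mR]] := eliminate_all_spec lblg rep_cell
  sol0 rows0.
have r5 : reg (run eliminate_all s0) 5 = #|[set u in representative rep | u.1.2 == u.2]|.
  by rewrite run_frame.
move: (run eliminate_all s0) sok1 spanE cardZ mR r5 =>
  {sol0 rows0 rV} s0 sok0 spanE cardZ mR r5.
rewrite run_then run_asg; set s1 := set_reg s0 7 _.
have sok1 : rows_ok rep s1 by apply: rows_ok_set_reg.
rewrite run_then.
pose E := representative rep.
have E_inj := representative_inj lblg rep_cell; have E_onto := representative_onto lblg.
have VE : #|cells T 1| = #|[set u in E | u.1.2 == u.2]| := card_vertices E_inj E_onto.
have RZ a : R a \in cocycles T by rewrite -spanE (rows_represents mR) row_in_span.
pose bad := check && [exists a, ~~ (4 %| surface_count E (R a))].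
have r7 : reg (run (if check then check_rows else Nop) s1) 7 = bad.
  rewrite /bad; case: (check) => //=.
  by have [] := check_rows_spec (R := R) sok1 mR RZ.
set s2 := run _ s1 in r7 *.
have f2 r : r < 7 -> reg s2 r = reg s0 r.
  by move=> r7'; rewrite run_frame; [rewrite /= /upd ltn_eqF | case: (check) => //;
    rewrite !inE !negb_or !ltn_eqF //; apply: leq_trans r7' _].
exists E, (reg s0 6), bad; split=> //.
- by case/andP => -> /existsP [a Ha]; split=> //; exists (R a).
- rewrite negb_and => /orP [nc | /existsPn all4] oT; [by left | right].
  move=> x; rewrite -spanE (rows_represents mR) => /imsetP [c _ ->].
  have scD := surface_countD oT E.
  have Z0 : (0 : {ffun slot n -> bool})%R \in cocycles T.
    rewrite inE; apply/andP; split; first by apply/constant_on_cellsP => u v _;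
      rewrite !ffunE.
    by apply/cocycleP => t i j k; rewrite /cocycle_form !ffunE.
  suff [] : combination R c \in cocycles T /\ 4 %| surface_count E (combination R c) by [].
  rewrite /combination.
  apply: (big_ind (fun x => x \in cocycles T /\ 4 %| surface_count E x)).
  + by split=> //; have := scD _ _ Z0 Z0; rewrite addr0; lia.
  + move=> y z [yZ y4] [zZ z4]; split; first exact: cocyclesD.
    by have := scD _ _ yZ zZ; lia.
  + move=> a _; case: (c a); first by split=> //; have /negPn := all4 a.
    by split=> //; have := scD _ _ Z0 Z0; rewrite addr0; lia.
apply: output_spec r7.
- by apply: regs_ok_frame (proj1 sok0) => r r5'; rewrite f2 // (leq_trans r5').
- rewrite -(leq_exp2l (m := 2)) // -cardZ -spanE.
  have := leq_imset_card (combination (rows (mem s0))) {ffun 'I_(16 * n) -> bool}.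
  by rewrite card_ffun card_bool card_ord.
- rewrite VE; apply: leq_trans (max_card _) _.
  by rewrite !card_prod !card_ord; lia.
- by rewrite f2.
- by rewrite f2 // r5 VE.
Qed.

Lemma encode_lt a : nth 0 (encode T) a < n + 5.
Proof.
have /allP H : all (fun v => v < n + 5) (encode T).
  rewrite /encode [all _ _]/=; apply/andP; split; first by lia.
  apply/allP => v /flattenP [l /mapP [[t f] _ ->]]; rewrite inE /= => /orP [/eqP ->|].
    exact: ltn_addr.
  by case/mapP => i _ ->; apply: leq_trans (ltn_ord _) _; rewrite addnC.
case: (ltnP a (size (encode T))) => [an|an]; first exact/H/mem_nth.
by rewrite nth_default // addnS.
Qed.

Lemma initial_bounded : bounded (n + 6) (initial_state (encode T)).
Proof.
split; first by rewrite addnC.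
  by move=> r; rewrite /= expn_gt0.
move=> a; apply: ltn_trans (encode_lt a) _.
by have := ltn_expl (n + 6) (isT : 1 < 2); move: (2 ^ _) => e; lia.
Qed.

(** Initially the values are below n + 5, hence have at most n + 6 bits; the
    60 covers the operations setting up the registers 0, 1 and 2. *)
Lemma tv_program_run (check : bool) c d :
    (forall K, cost K (main_prog check) <= c * K.+1 ^ d) ->
  exists (E : {pred slot n}) (D : nat) (bad : bool),
  [/\ (forall u v, u \in E -> v \in E -> slot_cell T u = slot_cell T v -> u = v)
        /\ (forall u, exists2 v, v \in E & slot_cell T v = slot_cell T u),
      #|cocycles T| = 2 ^ D,
      bad -> check /\ exists2 x, x \in cocycles T & ~~ (4 %| surface_count E x),
      ~~ bad -> orientable T -> ~~ check \/ forall x,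
        x \in cocycles T -> 4 %| surface_count E x
    & exists s k, [/\ exec (tv_program check) (initial_state (encode T)) k s,
        k <= 2 * (c + 60) * (c + 62) * (16 * n + 5) ^ (d + d + 1) &
        outputs s (value_code bad D #|cells T 1|)]].
Proof.
move=> costP; set i0 := initial_state (encode T).
have in0 : input_ok T (mem i0) by [].
have a0 : agree i0 i0 by [].
have [u1 x1 a1] := @comp_asgP 1 (Fetch (Cst 0)) i0 i0 isT isT a0.
have [u2 x2 a2] := @comp_asgP 2 (Cst 4) _ _ isT isT a1.
have [u3 x3 a3] := @comp_asgP 0 (quad (quad (Var 1))) _ _ isT isT a2.
set s3 := set_reg _ 0 _ in a3.
have s3E : [/\ reg s3 0 = 16 * n, reg s3 1 = n & reg s3 2 = 4].
  by split=> //; rewrite /s3 reg_set_reg /= /upd /=; lia.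
case: s3E => r0 r1 r2.
have ok3 : regs_ok n (run init_addresses s3).
  rewrite /init_addresses run_then !run_asg; split; rewrite ?[LHS]r0 ?[LHS]r1 ?[LHS]r2 //.
  - by rewrite /= /upd /= ?[LHS]/=; rewrite -/(reg s3 0) -/(reg s3 1); lia.
  - by rewrite /= /upd /=; lia.
have [E [D [bad [HE cardZ bad1 bad0 out]]]] := main_prog_spec check ok3 in0.
exists E, D, bad; split=> //.
have [|u4 x4 a4] := @compP (16 * n + 4) (main_prog check) s3 u3 (wf_main check) _ a3.
  by case=> [|[|[|]]] // _; rewrite ?r0 ?r1 ?r2; lia.
have [k [ek kle _]] := runs_seq x1 (runs_seq x2 (runs_seq x3 x4)) initial_bounded.
exists u4, k; split=> //; last by case: a4 => m4 _ i isz; rewrite -m4 out.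
apply: leq_trans kle _.
set B := (16 * n + 5) ^ d; set A := 16 * n + 5.
have B0 : 0 < B by rewrite expn_gt0 addnS.
have mle : expr_cost (Fetch (Cst 0)) + 2 + (expr_cost (Cst 4) + 2 +
    (expr_cost (quad (quad (Var 1))) + 2 + cost (16 * n + 4) (main_prog check))) <=
      (c + 60) * B.
  have : cost (16 * n + 4) (main_prog check) <= c * B.
    by have := costP (16 * n + 4); rewrite -addnS.
  by move: (cost _ _) => K; rewrite mulnDl /=; lia.
move: mle; set m := (_ + _ + _) => mle.
have mA : m <= (c + 60) * B * A by apply: leq_trans mle _; rewrite leq_pmulr // /A addnS.
have nA : n + 6 + m <= (c + 62) * B * A.
  have : A <= B * A by rewrite leq_pmull.
  have -> : (c + 62) * B * A = (c + 60) * B * A + 2 * (B * A) by ring.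
  by rewrite /A in mA *; lia.
apply: leq_trans (_ : 2 * ((c + 60) * B) * ((c + 62) * B * A) <= _).
  by apply: leq_mul => //; rewrite leq_mul2l.
by rewrite !expnD expn1 -/B -/A; apply: eq_leq; ring.
Qed.

End Main.

(** * The theorem *)
Section Value.
Local Open Scope ring_scope.

Definition value (bad : bool) (D V : nat) : rat := if bad then 0 else 2 ^+ D / 2 ^+ V.

Lemma value_reduced D V : value false D V =
  (2 ^ (D - V))%N%:Z%:~R / (2 ^ (V - D))%N%:Z%:~R :> rat.
Proof.
have two0 (m : nat) : (2 : rat) ^+ m != 0 by rewrite expf_neq0.
rewrite /value -!pmulrn !natrX; case: (leqP V D) => VD.
  have -> : (V - D = 0)%N by lia.
  by rewrite expr0 divr1 -{1}(subnK VD) exprD mulfK.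
have -> : (D - V = 0)%N by lia.
by rewrite expr0 -{1}(subnK (ltnW VD)) exprD invfM mulrCA mulfV ?mulr1 ?mul1r.
Qed.

Lemma encode_value bad D V :
  encode_rat (value bad D V) ++ encode_rat 0 = value_code bad D V.
Proof.
have pow_gt0 m : (0 < 2 ^ m)%N by rewrite expn_gt0.
have cop : coprime (2 ^ (D - V)) (2 ^ (V - D)).
  case: (leqP V D) => VD.
    by have -> : (V - D = 0)%N by [lia]; rewrite expn0 coprimen1.
  by have -> : (D - V = 0)%N by [lia]; rewrite expn0 coprime1n.
rewrite /value_code; case: bad; first by [].
rewrite /encode_rat -[_ ++ _]/[:: _; _; _; _; _; _]; congr [:: _; _; _; _; _; _].
- by rewrite ltNge /value divr_ge0 ?exprn_ge0.
- rewrite value_reduced coprimeq_num //= gtr0_sg ?mul1r //.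
  by rewrite ltz_nat.
- rewrite value_reduced coprimeq_den //= ifF //.
  by apply/negbTE; rewrite eqz_nat -lt0n.
Qed.

Lemma poly_bound e n : ((16 * n + 5) ^ e.+1 <= 21 ^ e.+1 * n ^ e.+1 + 21 ^ e.+1)%N.
Proof.
case: n => [|n].
  by apply: leq_trans (leq_addl _ _); rewrite leq_exp2r.
by apply: leq_trans (leq_addr _ _); rewrite -expnMn leq_exp2r //; lia.
Qed.

End Value.

Theorem mainTheorem1 (R : realType) (q : nat)
    (hq0 : (0 < q)%N) (hq6 : (q < 6)%N) (hq : coprime 3 q) :
  exists (P : cmd) (c d : nat),
  forall (n : nat) (T : triangulation n),
    closed_manifold R (underlying_space R T) 3 ->
    orientable T ->
    exists (s : state) (k : nat) (a b : rat),
      [/\ exec P (initial_state (encode T)) k s,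
          (k <= c * n ^ d + c)%N,
          turaev_viro R 3 q T = ratr a + ratr b * zeta R 3 q
        & outputs s (encode_rat a ++ encode_rat b)].
Proof.
have [c [d costP]] := cost_poly (main_prog (odd q)).
pose e := (d + d + 1)%N; pose C := (2 * (c + 60) * (c + 62) * 21 ^ e)%N.
exists (tv_program (odd q)), C, e => n T _ oT.
have [E [D [bad [[E_inj E_onto] cardZ bad1 bad0 [s [k [ek kle out]]]]]]] :=
  tv_program_run T costP.
exists s, k, (value bad D #|cells T 1|), 0; split=> //.
- apply: leq_trans kle _; rewrite -/e /C -[X in (_ <= X + _)%N]mulnA -mulnDr.
  by rewrite leq_mul2l /e addn1 poly_bound orbT.
- rewrite /turaev_viro rmorph0 mul0r addr0.
  have eps2 : (-1) ^+ q * (-1) ^+ q = 1 :> R[i] by rewrite -expr2 sqrr_sign.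
  have z0 := zeta_neq0 R hq0 hq6 hq; have zt := zeta_trace R hq0 hq6 hq.
  case: bad bad1 bad0 {out} => [/(_ isT) [qodd [x xZ x4]] _ | _ /(_ isT oT) H].
    rewrite rmorph0; apply: (state_sum_zero z0 eps2 zt E_inj E_onto oT _ xZ x4).
    by rewrite -signr_odd qodd expr1.
  rewrite (state_sum_trivial z0 eps2 zt E_inj E_onto).
    rewrite cardZ /value rmorphM fmorphV !rmorphXn /= rmorph_nat natrX exprVn.
    exact: mulrC.
  case: H => [qeven | all4]; [left | by right].
  by rewrite -signr_odd (negPf qeven) expr0.
- by rewrite encode_value.
Qed.
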